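(* Uniformly in $m\in\mathbb Z_+^2$, $$Q_z^r\{\xi=m\}=f_{a_z,K_z}(m)+O(|n|^{-5/3}),\qquad n\to\infty .$$
   Context: $\mathbb Z_+=\{0,1,2,\dots\}$; $\mathcal X=\{x=(x_1,x_2)\in\mathbb Z_+^2:\gcd(x_1,x_2)=1\}$ (containing $(1,0)$ and $(0,1)$ but not $(0,0)$). For $z=(z_1,z_2)\in(0,1)^2$ and $x\in\mathbb Z_+^2$ write $z^x=z_1^{x_1}z_2^{x_2}$ and $z^{kx}=(z^x)^k$. Fix $r\in(0,\infty)$. $Q_z^r$ is the probability measure on $(\mathbb Z_+)^{\mathcal X}$ under which the coordinates $\nu(x)$, $x\in\mathcal X$, are mutually independent with $$Q_z^r\{\nu(x)=k\}=\binom{r+k-1}{k}z^{kx}(1-z^x)^r,\qquad k\in\mathbb Z_+,\qquad \binom{r+k-1}{k}=\frac{r(r+1)\cdots(r+k-1)}{k!}.$$ Almost surely only finitely many $\nu(x)$ are nonzero, and $\xi=\sum_{x\in\mathcal X}x\,\nu(x)$. $E_z^r$ is expectation under $Q_z^r$, $a_z=E_z^r(\xi)$, and $K_z=\mathrm{Cov}(\xi,\xi)=E_z^r[(\xi-a_z)^\top(\xi-a_z)]$ is the ($2\times2$, positive definite) covariance matrix of the row vector $\xi$. $f_{a_z,K_z}$ is the density of the two-dimensional normal distribution with mean $a_z$ and covariance matrix $K_z$: $f_{a_z,K_z}(x)=\frac{1}{2\pi}(\det K_z)^{-1/2}e^{-|(x-a_z)V_z|^2/2}$, $x\in\mathbb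 R^2$, where $V_z=K_z^{-1/2}$ is the symmetric positive definite square root of $K_z^{-1}$ and $|\cdot|$ is the Euclidean norm. The parameter $z$ depends on $n=(n_1,n_2)$ as follows: $z_j=e^{-\alpha_j}$, $\alpha_j=\delta_jn_j^{-1/3}$ ($j=1,2$), $\delta_1=\kappa r^{1/3}(n_2/n_1)^{1/3}$, $\delta_2=\kappa r^{1/3}(n_1/n_2)^{1/3}$, $\kappa=(\zeta(3)/\zeta(2))^{1/3}$, with $\zeta$ the Riemann zeta function. The limit $n\to\infty$ means $n_1,n_2\to\infty$ with $n_1/n_2$ bounded away from $0$ and $\infty$. *)

(* Defs.v *)
From mathcomp Require Import all_boot all_order all_algebra.
From mathcomp Require Import all_classical all_reals all_analysis.

Set Implicit Arguments.
Unset Strict Implicit.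
Unset Printing Implicit Defensive.

Import Order.TTheory GRing.Theory Num.Theory.
Import numFieldNormedType.Exports.

Local Open Scope classical_set_scope.
Local Open Scope ring_scope.

Definition natvec (R : realType) (x : 'rV[nat]_2) : 'rV[R]_2 :=
  map_mx (fun k : nat => k%:R) x.

(* The library norm on row vectors is the max norm. *)
Definition enorm (R : realType) (v : 'rV[R]_2) : R :=
  Num.sqrt (\sum_(j < 2) v 0 j ^+ 2).

(* The Riemann zeta function on real arguments s > 1. *)
Definition zeta (R : realType) (s : R) : R :=
  limn (series (fun k : nat => k.+1%:R `^ (- s))).

(* [coprime 0 0 = false] and [coprime 1 0 = coprime 0 1 = true]. *)
Definition coprime_point : Type :=
  {x : 'rV[nat]_2 | coprime (x 0 0) (x 0 1)}.

Definition config : Type := coprime_point -> nat.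

Definition cylinders : set (set config) :=
  [set E | exists (x : coprime_point) (A : set nat), E = [set nu | A (nu x)]].

(* The space Z_+^X equipped with its product sigma-algebra. *)
Definition config_space := g_sigma_algebraType cylinders.

Definition zpow (R : realType) (z : 'rV[R]_2) (x : 'rV[nat]_2) : R :=
  \prod_(j < 2) z 0 j ^+ x 0 j.

Definition gbinom (R : realType) (r : R) (k : nat) : R :=
  (\prod_(i < k) (r + i%:R)) / k`!%:R.

Definition coordinates_independent (R : realType)
    (Q : probability config_space R) : Prop :=
  forall (J : seq coprime_point) (A : coprime_point -> set nat), uniq J ->
    Q [set nu : config_space | forall x, x \in J -> A x (nu x)] =
    (\prod_(x <- J) Q [set nu : config_space | A x (nu x)])%E.

(* Q is the measure Q_z^r; it is determined by these two properties. *)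
Definition is_Q (R : realType) (r : R) (z : 'rV[R]_2)
    (Q : probability config_space R) : Prop :=
  coordinates_independent Q /\
  forall (x : coprime_point) (k : nat),
    Q [set nu : config_space | nu x = k] =
    (gbinom r k * zpow z (val x) ^+ k * (1 - zpow z (val x)) `^ r)%:E.

(* The sum has value 0 on the null set of configurations with infinite
   support. *)
Definition xi (nu : config_space) : 'rV[nat]_2 :=
  \sum_(x \in [set: coprime_point]) val x *+ nu x.

Definition xi_coord (R : realType) (j : 'I_2) (nu : config_space) : R :=
  natvec R (xi nu) 0 j.

Definition mean_xi (R : realType) (Q : probability config_space R) :
    'rV[R]_2 :=
  \row_(j < 2) fine 'E_Q[xi_coord R j].

Definition cov_xi (R : realType) (Q : probability config_space R) :
    'M[R]_2 :=
  \matrix_(i < 2, j < 2) fine (covariance Q (xi_coord R i) (xi_coord R j)).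

Definition sym_posdef (R : realType) (A : 'M[R]_2) : Prop :=
  A^T = A /\ forall u : 'rV[R]_2, u != 0 -> 0 < (u *m A *m u^T) 0 0.

(* The symmetric positive definite square root of A, which exists and is
   unique when A is itself symmetric positive definite. *)
Definition sqrtmx (R : realType) (A : 'M[R]_2) : 'M[R]_2 :=
  xget 0 [set V | sym_posdef V /\ V *m V = A].

Definition normal_density (R : realType) (a : 'rV[R]_2) (K : 'M[R]_2)
    (x : 'rV[R]_2) : R :=
  (2 * pi)^-1 * \det K `^ (- (1 / 2)) *
  expR (- (enorm ((x - a) *m sqrtmx (invmx K)) ^+ 2 / 2)).

Definition kappa (R : realType) : R :=
  (zeta (3 : R) / zeta (2 : R)) `^ (1 / 3).

(* [rev_ord] exchanges the two indices of 'I_2. *)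
Definition delta (R : realType) (r : R) (n : 'rV[nat]_2) (j : 'I_2) : R :=
  kappa R * r `^ (1 / 3) *
  ((n 0 (rev_ord j))%:R / (n 0 j)%:R) `^ (1 / 3).

Definition alpha (R : realType) (r : R) (n : 'rV[nat]_2) (j : 'I_2) : R :=
  delta r n j * (n 0 j)%:R `^ (- (1 / 3)).

Definition zparam (R : realType) (r : R) (n : 'rV[nat]_2) : 'rV[R]_2 :=
  \row_(j < 2) expR (- alpha r n j).

(* Main.v *)
Require Import Defs.
From mathcomp Require Import all_boot all_order all_algebra.
From mathcomp Require Import all_classical all_reals all_analysis.
From mathcomp Require Import complex measurable_realfun.
From mathcomp Require Import ring lra zify.

Set Implicit Arguments.
Unset Strict Implicit.
Unset Printing Implicit Defensive.

Import Order.TTheory GRing.Theory Num.Theory.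
Import numFieldNormedType.Exports.
Import ComplexField.Normc.

Local Open Scope classical_set_scope.
Local Open Scope ring_scope.

(** The vector xi is a sum of independent lattice vectors x nu(x), so this is a
    local limit theorem for a triangular array, proved by Fourier inversion.

    Orders of magnitude.  Let L be of the order of |n|^(1/3).  Both alpha_j are
    of order 1/L ([alpha_scaling]), so about L^2 coprime points x, those of norm
    O(L), carry the sum, and for most of them the variance of nu(x) is bounded below.
    Hence the covariance form of xi is at least a multiple of L^4 |u|^2, while
    the sum of the third moments of the summands is O(L^5).  The
    relative error L^5 / (L^4)^(3/2) = 1/L, times the height L^-4 of the normal
    density, gives L^-5 = O(|n|^(-5/3)).

    Inversion.  The probability of a lattice point m is (2 pi)^-2 times the
    integral over [-pi, pi]^2 of the real part of the characteristic function
    multiplied by exp(- i u.m) ([fourier_box]), and the normal density is the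
    same integral over the plane for the Gaussian with the same mean and
    covariance ([gauss_fourier2]).  Both integrands are products over x.  Their
    factors differ by at most 6 E(nu(x)^3) |u.x|^3 ([charf_gauss]), and both are
    at most exp(- P(nu(x) = 0) P(nu(x) = 1) (1 - cos(u.x))).  Telescoping the
    products ([prod_compare]) bounds the difference of the integrands by a
    multiple of L^5 |u|^3 exp(- damp(u)), where damp(u) sums these exponents.

    The lower bound on damp.  What remains is the estimate
    damp(u) >= c L^2 min(1, L^2 |u|^2) on the whole square [-pi, pi]^2; it says
    that no character is nearly constant on the coprime points.  Among the
    points of [1, L]^2 strictly more than half are coprime, because the inverse
    squares of the primes have sum below 1/2 ([coprime_count]).  For each small
    k, a set of that density contains a positive proportion of the pairs
    (a, b), (a + k, b), and each such pair contributes at least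
    (1 - cos(k u_1)) / 2 ([one_sub_cos_pair], [row_pairing]); a suitable k makes
    this large ([exists_multiplier]).  The same bound, applied to u shrunk
    towards 0, gives the lower bound on the covariance form ([qform_ge]).
    Integrating the majorant gives [finite_local_limit].

    Truncation.  All of this is done for the finitely many x with coordinates
    below N and for min(nu(x), N + 1), where expectations are finite sums, with
    constants independent of N.  As N tends to infinity, monotone convergence
    yields the finiteness of xi almost surely and the limits of its first and
    second moments, dominated convergence the limit of the point
    probabilities, and the estimate passes to the limit ([local_limit_bound]).
*)

(** * Gaussian weights on the line *)

Section oneD.
Variable R : realType.
Local Notation mu := (@lebesgue_measure R).

(** The fundamental theorem of calculus on [-n, n], followed by dominated
    convergence. It serves as an integration by parts whose boundary terms
    vanish at infinity. *)
Lemma Rintegral_derivative_eq0 (F k : R -> R) :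
  (forall x : R, is_derive x (1 : R) F (k x)) -> continuous k ->
  mu.-integrable setT (EFin \o k) ->
  F n%:R @[n --> \oo] --> 0 -> F (- n%:R) @[n --> \oo] --> 0 ->
  \int[mu]_x k x = 0.
Proof.
move=> dF ck ik Fp Fm.
pose kn (n : nat) := fun x => ((k \_ `[- n%:R, n%:R]) x)%:E.
have mk : measurable_fun setT k by exact: continuous_measurable_fun.
have [] := @dominated_convergence _ _ _ mu setT measurableT kn (EFin \o k)
  (fun x => `|k x|%:E).
- move=> n; apply/measurable_EFinP.
  apply/(measurable_restrictT k); first exact: measurable_itv.
  exact: measurable_funTS.
- by apply/measurable_EFinP.
- apply: aeW => x _ /=.
  apply: cvg_near_cst.
  near=> n; rewrite /kn patchE mem_set//= in_itv/= -ler_norml.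
  by near: n; exact: nbhs_infty_ger.
- exact: (integrable_norm ik).
- apply: aeW => x n _ /=; rewrite /kn patchE lee_fin; case: ifP => _ //=.
  by rewrite normr0.
move=> _ _ /=.
have -> : (fun n => (\int[mu]_x kn n x)%E) = (fun n => (F n%:R - F (- n%:R))%:E).
  apply/funext => n.
  have -> : (\int[mu]_x kn n x = \int[mu]_(x in `[(- n%:R)%R, (n%:R)%R]) (k x)%:E)%E.
    rewrite [RHS]integral_mkcond/=; apply: eq_integral => x _.
    by rewrite /kn restrict_EFin.
  case: n => [|n].
    by rewrite oppr0 subrr set_itv1 integral_set1.
  rewrite (@continuous_FTC2 _ k F)//.
  - by rewrite gtrN.
  - exact: continuous_subspaceT.
  - have cF x : F z @[z --> x] --> F x.
      by apply/differentiable_continuous/derivable1_diffP; case: (dF x).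
    split.
    + by move=> x _; case: (dF x).
    + exact: cvg_at_right_filter.
    + exact: cvg_at_left_filter.
  - by move=> x _; rewrite derive1E; exact: derive_val.
move=> h.
have h2 : (F n%:R - F (- n%:R))%:E @[n --> \oo] --> 0%:E.
  apply: cvg_EFin; first by apply: nearW.
  by rewrite -[X in _ --> X](subrr 0); apply: cvgB.
by rewrite /Rintegral (cvg_unique _ h h2).
Unshelve. all: end_near. Qed.

Definition gaussw (s c u : R) : R := expR (- (s * (u - c) ^+ 2 / 2)).

Lemma gaussw_normal s c : 0 < s ->
  gaussw s c = normal_fun c (Num.sqrt s)^-1.
Proof.
move=> s0; apply/funext => u; rewrite /gaussw /normal_fun.
by congr expR; rewrite exprVn sqr_sqrtr ?ltW// -mulr_natr; field; lra.
Qed.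

Lemma continuous_gaussw s c : continuous (gaussw s c).
Proof.
move=> x; apply/differentiable_continuous/derivable1_diffP.
apply: ex_derive; apply: is_derive_eq.
Qed.

Lemma integrable_gaussw s c : 0 < s -> mu.-integrable setT (EFin \o gaussw s c).
Proof.
move=> s0.
have t0 : (Num.sqrt s)^-1 != 0 :> R by rewrite invr_neq0 ?sqrtr_eq0 -?ltNge.
have := integrableZl measurableT (normal_peak (Num.sqrt s)^-1)^-1 (integrable_normal_pdf c
  (Num.sqrt s)^-1).
apply: eq_integrable => // x _ /=.
rewrite gaussw_normal// normal_pdfE// -EFinM mulrA mulVf ?mul1r//.
by rewrite gt_eqF// normal_peak_gt0.
Qed.

Lemma integral_gaussw s c : 0 < s ->
  \int[mu]_u gaussw s c u = Num.sqrt (2 * pi / s).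
Proof.
move=> s0.
have t0 : (Num.sqrt s)^-1 != 0 :> R by rewrite invr_neq0 ?sqrtr_eq0 -?ltNge.
have p0 : normal_peak (Num.sqrt s)^-1 != 0 :> R by rewrite gt_eqF// normal_peak_gt0.
have := integral_normal_pdf c (Num.sqrt s)^-1.
under eq_integral do rewrite normal_pdfE// EFinM -gaussw_normal//.
rewrite integralZl//; last exact: integrable_gaussw.
move=> h.
have h2 : normal_peak (Num.sqrt s)^-1 * (\int[mu]_u gaussw s c u) = 1.
  have fi := integrable_fin_num measurableT (integrable_gaussw c s0).
  by rewrite /Rintegral; apply: EFin_inj; rewrite EFinM fineK.
have -> : Num.sqrt (2 * pi / s) = (normal_peak (Num.sqrt s)^-1)^-1 :> R.
  rewrite /normal_peak invrK; congr Num.sqrt.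
  by rewrite exprVn sqr_sqrtr ?ltW// -mulr_natr; field; lra.
by apply: (mulfI p0); rewrite h2 divff.
Qed.

End oneD.

(** * Fourier transform of a Gaussian on the line *)

Section fourier1.
Variable R : realType.
Local Notation mu := (@lebesgue_measure R).

Lemma is_derive_continuous (f df : R -> R) :
  (forall x : R, is_derive x (1 : R) f (df x)) -> continuous f.
Proof.
by move=> h x; apply/differentiable_continuous/derivable1_diffP; case: (h x).
Qed.

Lemma integrable_dominated (f g : R -> R) :
  continuous f -> (forall x, `|f x| <= g x) ->
  mu.-integrable setT (EFin \o g) -> mu.-integrable setT (EFin \o f).
Proof.
move=> cf fg ig; apply: le_integrable ig => //.
  by apply/measurable_EFinP; exact: continuous_measurable_fun.
move=> x _ /=; rewrite lee_fin (le_trans (fg x))//.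
by rewrite ler_norm.
Qed.

(** With it the factor |u - c| that appears under differentiation is absorbed by
    half of the Gaussian exponent. *)
Lemma norm_le_expR (s x : R) : 0 < s ->
  `|x| <= (1 + 4 / s) * expR (s / 4 * x ^+ 2).
Proof.
move=> s0.
have h := expR_ge1Dx (s / 4 * x ^+ 2).
have h1 : `|x| <= 1 + x ^+ 2.
  rewrite -[x ^+ 2]real_normK ?num_real//; move: (normr_ge0 x).
  set t := `|x| => t0; have := sqr_ge0 (t - 1); nra.
have h2 : (1 + 4 / s) * (1 + s / 4 * x ^+ 2) = 1 + x ^+ 2 + (4/s + s / 4 * x ^+2).
  field; lra.
have h3 : 0 < 4 / s by apply: divr_gt0.
have h4 : 0 <= s / 4 * x ^+ 2 by apply: mulr_ge0; [lra|exact: sqr_ge0].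
apply: (le_trans h1); apply: (@le_trans _ _ ((1 + 4 / s) * (1 + s / 4 * x ^+ 2))).
  by rewrite h2; lra.
by rewrite ler_pM2l//; lra.
Qed.

Lemma integrable_norm_gaussw (s c : R) : 0 < s ->
  mu.-integrable setT (EFin \o (fun u => `|u - c| * gaussw s c u)).
Proof.
move=> s0.
have s2 : 0 < s / 2 by lra.
have ig := integrableZl measurableT (1 + 4 / s) (integrable_gaussw c s2).
apply: le_integrable ig => //.
  apply/measurable_EFinP/measurable_funM.
    by apply: measurableT_comp => //; exact: measurable_funB.
  by apply: continuous_measurable_fun; exact: continuous_gaussw.
move=> x _ /=; rewrite lee_fin ger0_norm ?mulr_ge0 ?expR_ge0//.
have -> : gaussw s c x = expR (- (s / 4 * (x - c) ^+ 2)) * gaussw (s / 2) c x.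
  by rewrite /gaussw -expRD; congr expR; field.
rewrite mulrA [X in _ <= X]ger0_norm; last first.
  by rewrite mulr_ge0 ?expR_ge0//; have : 0 < 4 / s; [exact: divr_gt0|lra].
rewrite ler_wpM2r ?expR_ge0// expRN ler_pdivrMr ?expR_gt0//.
exact: norm_le_expR.
Qed.

Lemma integrable_cos_gaussw (s c b y : R) : 0 < s ->
  mu.-integrable setT
    (EFin \o (fun u => cos ((u - c) * y + b) * gaussw s c u)).
Proof.
move=> s0; apply: (integrable_dominated _ _ (integrable_gaussw c s0)).
  by apply: is_derive_continuous => x; apply: is_derive_eq.
move=> x; rewrite normrM [X in _ * X]ger0_norm ?expR_ge0//.
by rewrite ler_piMl ?expR_ge0// cos_max.
Qed.

Lemma cvg_gaussw_tail (s c : R) (u : nat -> R) : 0 < s ->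
  (forall n, `|u n| = n%:R) -> gaussw s c (u n) @[n --> \oo] --> 0.
Proof.
move=> s0 un.
have h0 : 16 / s * harmonic n @[n --> \oo] --> 16 / s * (0 : R).
  by apply: cvgMr; exact: cvg_harmonic.
rewrite mulr0 in h0.
apply: (@squeeze_cvgr _ _ _ _ (cst 0) _ _ _ _ _ h0); last exact: cvg_cst.
near=> n; rewrite expR_ge0/= /gaussw expRN.
have n1 : 1 <= n%:R :> R by near: n; exact: nbhs_infty_ger.
have nc : 2 * `|c| <= n%:R by near: n; exact: nbhs_infty_ger.
have h : n%:R / 2 <= `|u n - c|.
  by have := lerB_dist (u n) c; rewrite un; lra.
have h2 : s * n%:R / 8 <= s * (u n - c) ^+ 2 / 2.
  have : n%:R / 4 <= (u n - c) ^+ 2.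
    rewrite -[X in _ <= X]real_normK ?num_real//; nra.
  nra.
rewrite /= -[16 / s]invf_div -invfM lef_pV2 ?posrE ?expR_gt0//; last first.
  by rewrite mulr_gt0// divr_gt0.
rewrite (le_trans _ (expR_ge1Dx _))// -[n.+1%:R]natr1.
have h3 : 0 <= s * (n%:R - 1) by rewrite mulr_ge0 ?subr_ge0// ltW.
lra.
Unshelve. all: end_near. Qed.

(** A real form of the Gaussian Fourier transform. The centre c and the phase b
    are parameters because in the plane both depend on the outer variable of
    integration. *)
Definition gauss_cos (s c b y : R) :=
  \int[mu]_u (cos ((u - c) * y + b) * gaussw s c u).

(** Differentiation under the integral sign brings out a factor - (u - c) sin;
    since - s (u - c) gaussw is the derivative of gaussw, an integration by
    parts turns the result back into gauss_cos. *)
Lemma is_derive_gauss_cos (s c b y : R) : 0 < s ->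
  is_derive y (1 : R) (gauss_cos s c b) (- (y / s) * gauss_cos s c b y).
Proof.
move=> s0.
pose f (y : R) (u : R) := cos ((u - c) * y + b) * gaussw s c u.
have df (y' u : R) : is_derive y' (1 : R) (f^~ u)
   (- ((u - c) * sin ((u - c) * y' + b)) * gaussw s c u).
  rewrite /f; apply: is_derive_eq; rewrite /GRing.scale/=; ring.
have d1f (y' u : R) : partial1of2 f y' u =
    - ((u - c) * sin ((u - c) * y' + b)) * gaussw s c u.
  by rewrite partial1of2E; exact: derive_val.
have yI : `]y - 1, y + 1[%classic y by rewrite /= in_itv/=; lra.
have If x : `]y - 1, y + 1[%classic x -> mu.-integrable setT (EFin \o f x).
  by move=> _; exact: integrable_cos_gaussw.
have Df (x u : R) : `]y - 1, y + 1[%classic x -> [set: R] u -> derivable (f^~ u) x 1.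
  by move=> _ _; case: (df x u).
have G0 u : 0 <= `|u - c| * gaussw s c u by rewrite mulr_ge0 ?expR_ge0.
have Gub x u : `]y - 1, y + 1[%classic x -> [set: R] u ->
    `|partial1of2 f x u| <= `|u - c| * gaussw s c u.
  move=> _ _; rewrite d1f normrM normrN normrM.
  rewrite (ger0_norm (expR_ge0 _)) ler_wpM2r ?expR_ge0//.
  by rewrite ler_piMr ?normr_ge0// sin_max.
have D1 := @derivable_under_integral R _ _ mu f setT measurableT y (y-1) (y+1)
  yI If Df _ G0 (integrable_norm_gaussw c s0) Gub.
have D2 := @differentiation_under_integral R _ _ mu f setT measurableT y (y-1) (y+1)
  yI If Df _ G0 (integrable_norm_gaussw c s0) Gub.
apply: DeriveDef; first exact: D1.
rewrite -derive1E [LHS]D2.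
under eq_Rintegral do rewrite d1f.
(* integration by parts: the derivative of [sin * gaussw] integrates to 0 *)
pose F u := sin ((u - c) * y + b) * gaussw s c u.
pose k u := y * f y u + s * (- ((u - c) * sin ((u - c) * y + b)) * gaussw s c u).
have dF (u : R) : is_derive u (1 : R) F (k u).
  by rewrite /F /k /f /gaussw; apply: is_derive_eq; rewrite /GRing.scale/=; field.
have ck : continuous k.
  by apply: is_derive_continuous => x; rewrite /k /f /gaussw; apply: is_derive_eq.
have c2 : continuous (fun u => - ((u - c) * sin ((u - c) * y + b)) * gaussw s c u).
  by apply: is_derive_continuous => x; rewrite /gaussw; apply: is_derive_eq.
have i1 : mu.-integrable setT (EFin \o f y) by exact: integrable_cos_gaussw.
have i2 : mu.-integrable setT (EFin \o (fun u => - ((u - c) * sin ((u - c) * y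
  + b)) * gaussw s c u)).
  apply: (integrable_dominated c2 _ (integrable_norm_gaussw c s0)) => u.
  by have := Gub y u yI I; rewrite d1f.
have i1y : mu.-integrable setT (EFin \o (fun u => y * f y u)).
  exact: (integrableZl measurableT y i1).
have i2s : mu.-integrable setT (EFin \o (fun u => s * (- ((u - c) * sin ((u - c) * y
  + b)) * gaussw s c u))).
  exact: (integrableZl measurableT s i2).
have ik : mu.-integrable setT (EFin \o k).
  exact: (integrableD measurableT i1y i2s).
have := Rintegral_derivative_eq0 dF ck ik.
rewrite /k RintegralD// !RintegralZl//.
set A := Rintegral _ _ _; set B := Rintegral _ _ _ => h.
have {}h : y * A + s * B = 0.
  have tl (u : nat -> R) : (forall n, `|u n| = n%:R) -> F (u n) @[n --> \oo] --> 0.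
    move=> un; apply: norm_cvg0.
    apply: (@squeeze_cvgr _ _ _ _ (cst 0) _ _ _ _ _ (cvg_gaussw_tail c s0 un));
      last exact: cvg_cst.
    near=> n; rewrite normr_ge0/= /F normrM [X in _ * X]ger0_norm ?expR_ge0//.
    by rewrite ler_piMl ?expR_ge0// sin_max.
  by apply: h; apply: tl => n; rewrite ?normrN ger0_norm.
rewrite /gauss_cos -/A; apply: (mulfI (lt0r_neq0 s0)).
have -> : s * B = - (y * A) by lra.
by field; lra.
Unshelve. all: end_near. Qed.

(** By the differential equation of is_derive_gauss_cos, gauss_cos times exp(y^2
    / (2 s)) is constant in y, and its value at 0 is the Gaussian integral. *)
Lemma gauss_cosE (s c b y : R) : 0 < s ->
  gauss_cos s c b y = cos b * Num.sqrt (2 * pi / s) * expR (- (y ^+ 2 / (2 * s))).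
Proof.
move=> s0.
have g0 : gauss_cos s c b 0 = cos b * Num.sqrt (2 * pi / s).
  rewrite /gauss_cos; under eq_Rintegral do rewrite mulr0 add0r.
  by rewrite RintegralZl ?integral_gaussw//; exact: integrable_gaussw.
pose K y := gauss_cos s c b y * expR (y ^+ 2 / (2 * s)).
have dK (x : R) : is_derive x (1 : R) K 0.
  have d1 := is_derive_gauss_cos c b x s0.
  by rewrite /K; apply: is_derive_eq; rewrite /GRing.scale/=; field; lra.
have := is_derive_0_is_cst y 0 dK.
rewrite /K g0 expr0n/= mul0r expR0 mulr1 => <-.
by rewrite -mulrA -expRD subrr expR0 mulr1.
Qed.

End fourier1.

(** * Fourier transform of a Gaussian on the plane *)

Section twoD.
Variable R : realType.
Local Notation mu := (@lebesgue_measure R).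
Local Notation mu2 := (mu \x mu)%E.

Lemma EFin_Rintegral d (T : measurableType d) (m : {measure set T -> \bar R})
    (f : T -> R) : m.-integrable setT (EFin \o f) ->
  (\int[m]_x (f x)%:E)%E = (\int[m]_x f x)%:E.
Proof. by move=> h; rewrite /Rintegral fineK//; exact: integrable_fin_num. Qed.

Lemma measurable_gaussw d (T : measurableType d) (s : R) (c u : T -> R) :
  measurable_fun setT c -> measurable_fun setT u ->
  measurable_fun setT (fun x => gaussw s (c x) (u x)).
Proof.
move=> mc mu_; apply: measurableT_comp => //; apply: measurable_funN.
apply: measurable_funM => //; apply: measurable_funM => //.
by apply: measurable_funX; exact: measurable_funB.
Qed.

Lemma integrable_gaussw2 (f : R * R -> R) (s t k : R) :
  0 < s -> 0 < t -> measurable_fun setT f ->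
  (forall x, `|f x| <= gaussw s (k * x.2) x.1 * gaussw t 0 x.2) ->
  mu2.-integrable setT (EFin \o f).
Proof.
move=> s0 t0 mf fb.
have mg : measurable_fun setT (fun x : R * R => gaussw s (k * x.2) x.1 * gaussw t 0 x.2).
  by apply: measurable_funM; apply: measurable_gaussw => //; apply: measurable_funM.
have ig : mu2.-integrable setT (EFin \o (fun x : R * R => gaussw s (k * x.2) x.1
  * gaussw t 0 x.2)).
  apply/integrable21ltyP; first exact/measurable_EFinP.
  under eq_integral => y _.
    under eq_integral => x _ do
      rewrite /= ger0_norm ?mulr_ge0 ?expR_ge0// mulrC EFinM.
    rewrite integralZl//; last exact: integrable_gaussw.
    rewrite EFin_Rintegral; last exact: integrable_gaussw.
    rewrite integral_gaussw// muleC.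
    over.
  rewrite integralZl//; last exact: integrable_gaussw.
  rewrite EFin_Rintegral; last exact: integrable_gaussw.
  by rewrite -EFinM ltry.
apply: le_integrable ig => //; first exact/measurable_EFinP.
move=> x _ /=; rewrite lee_fin [X in _ <= X]ger0_norm//.
by rewrite mulr_ge0 ?expR_ge0.
Qed.

Lemma Rintegral_fubini (f : R * R -> R) : mu2.-integrable setT (EFin \o f) ->
  (\int[mu]_y \int[mu]_x (f (x, y))%:E)%E = (\int[mu2]_x f x)%:E.
Proof.
by move=> fi; rewrite -EFin_Rintegral//; have := integral21_prod_meas1 fi.
Qed.

Definition qform (A B D x y : R) : R := A * x ^+ 2 + 2 * B * x * y + D * y ^+ 2.

(** Completing the square in x, so that plane integrals can be computed one
    variable at a time. *)
Lemma expR_qform (A B D x y : R) : A != 0 ->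
  expR (- (qform A B D x y / 2)) =
  gaussw A (- B / A * y) x * gaussw (D - B ^+ 2 / A) 0 y.
Proof.
by move=> A0; rewrite /gaussw -expRD /qform; congr expR; field.
Qed.

Lemma measurable_cos_qform (A B D y1 y2 : R) :
  measurable_fun setT (fun x : R * R =>
    cos (x.1 * y1 + x.2 * y2) * expR (- (qform A B D x.1 x.2 / 2))).
Proof.
apply: measurable_funM.
  apply: measurableT_comp.
    by apply: continuous_measurable_fun; exact: continuous_cos.
  by apply: measurable_funD; apply: measurable_funM.
apply: measurableT_comp => //; apply: measurable_funN; apply: measurable_funM => //.
rewrite /qform; apply: measurable_funD; first apply: measurable_funD.
- by apply: measurable_funM => //; apply: measurable_funX.
- by apply: measurable_funM => //; apply: measurable_funM.
- by apply: measurable_funM => //; apply: measurable_funX.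
Qed.

Lemma schur_gt0 (A B D : R) : 0 < A -> 0 < A * D - B ^+ 2 -> 0 < D - B ^+ 2 / A.
Proof.
move=> A0 h; have -> : D - B ^+ 2 / A = (A * D - B ^+ 2) / A by field; lra.
exact: divr_gt0.
Qed.

Lemma integrable_cos_qform (A B D y1 y2 : R) :
  0 < A -> 0 < A * D - B ^+ 2 ->
  mu2.-integrable setT (EFin \o (fun x : R * R =>
    cos (x.1 * y1 + x.2 * y2) * expR (- (qform A B D x.1 x.2 / 2)))).
Proof.
move=> A0 h; have D0 := schur_gt0 A0 h.
apply: (integrable_gaussw2 (k := - B / A) A0 D0); first exact: measurable_cos_qform.
move=> x; rewrite -expR_qform ?lt0r_neq0// normrM [X in _ * X]ger0_norm ?expR_ge0//.
by rewrite ler_piMl ?expR_ge0// cos_max.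
Qed.

(** Fubini and completion of the square reduce this to two transforms on the
    line; the second one has as its scale the Schur complement D - B^2 / A,
    whose product with A is the determinant. *)
Lemma gauss_fourier2 (A B D y1 y2 : R) : 0 < A -> 0 < A * D - B ^+ 2 ->
  \int[mu2]_x (cos (x.1 * y1 + x.2 * y2) * expR (- (qform A B D x.1 x.2 / 2))) =
  2 * pi / Num.sqrt (A * D - B ^+ 2) *
  expR (- (qform D (- B) A y1 y2 / (A * D - B ^+ 2) / 2)).
Proof.
move=> A0 h; have D0 := schur_gt0 A0 h.
apply: EFin_inj; rewrite -Rintegral_fubini; last exact: integrable_cos_qform.
pose E := Num.sqrt (2 * pi / A) * expR (- (y1 ^+ 2 / (2 * A))).
have A0' := lt0r_neq0 A0.
under eq_integral => y _.
  under eq_integral => x _.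
    rewrite /= expR_qform//.
    have -> : x * y1 + y * y2 = (x - - B / A * y) * y1 + y * (y2 - B / A * y1) by field.
    rewrite [cos _ * (_ * _)]mulrA [cos _ * _ * _]mulrC EFinM. over.
  rewrite integralZl//; last exact: integrable_cos_gaussw.
  rewrite EFin_Rintegral; last exact: integrable_cos_gaussw.
  rewrite -/(gauss_cos A (- B / A * y) (y * (y2 - B / A * y1)) y1) gauss_cosE//.
  rewrite -[cos _ * _ * _]mulrA -/E -EFinM.
  have -> : gaussw (D - B ^+ 2 / A) 0 y * (cos (y * (y2 - B / A * y1)) * E) =
    E * (cos ((y - 0) * (y2 - B / A * y1) + 0) * gaussw (D - B ^+ 2 / A) 0 y).
    by rewrite subr0 addr0; ring.
  rewrite EFinM. over.
rewrite integralZl//; last exact: integrable_cos_gaussw.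
rewrite EFin_Rintegral; last exact: integrable_cos_gaussw.
rewrite -/(gauss_cos _ _ _ _) gauss_cosE// cos0 mul1r -EFinM; congr EFin.
rewrite /E mulrACA -expRD; congr (_ * expR _).
  rewrite -sqrtrM; last by rewrite divr_ge0 ?mulr_ge0 ?pi_ge0 ?ltW.
  have -> : 2 * pi / A * (2 * pi / (D - B ^+ 2 / A)) = (2 * pi) ^+ 2 / (A * D - B ^+ 2).
    by field; rewrite A0' /=; apply/andP; split; lra.
  rewrite sqrtrM ?sqr_ge0// sqrtr_sqr ger0_norm ?mulr_ge0 ?pi_ge0// sqrtrV//.
  exact: ltW.
rewrite /qform; field; rewrite A0' /=; apply/andP; split; lra.
Qed.

End twoD.

(** * Fourier inversion on the square *)

Section inversion.
Variable R : realType.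
Local Notation mu := (@lebesgue_measure R).
Local Notation mu2 := (mu \x mu)%E.

Definition box1 (t : R) : R := \1_(`[- pi, pi]) t.
Definition box (x : R * R) : R := box1 x.1 * box1 x.2.

Lemma box1_ge0 t : 0 <= box1 t. Proof. by rewrite /box1 indicE. Qed.

Lemma measurable_box1 : measurable_fun setT box1.
Proof. by apply: measurable_indic; exact: measurable_itv. Qed.

Lemma measurable_box : measurable_fun setT box.
Proof.
rewrite /box; apply: measurable_funM.
  exact: (measurableT_comp measurable_box1 measurable_fst).
exact: (measurableT_comp measurable_box1 measurable_snd).
Qed.

Lemma integrable_box1 : mu.-integrable setT (EFin \o box1).
Proof. exact: integrable_indic_itv. Qed.

Lemma integral_box1 : \int[mu]_t box1 t = 2 * pi.
Proof.
rewrite /Rintegral integral_indic//=.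
rewrite setIT lebesgue_measure_itv/= lte_fin gtrN ?pi_gt0//=.
by rewrite opprK; ring.
Qed.

Lemma prod_integrable (u v : R -> R) :
  (forall x, 0 <= u x) -> (forall x, 0 <= v x) ->
  mu.-integrable setT (EFin \o u) -> mu.-integrable setT (EFin \o v) ->
  mu2.-integrable setT (EFin \o (fun x : R * R => u x.1 * v x.2)).
Proof.
move=> u0 v0 iu iv.
have mf : measurable_fun setT (fun x : R * R => u x.1 * v x.2).
  apply: measurable_funM.
    by apply: measurableT_comp => //; apply/measurable_EFinP; exact: measurable_int iu.
  by apply: measurableT_comp => //; apply/measurable_EFinP; exact: measurable_int iv.
apply/integrable21ltyP; first exact/measurable_EFinP.
under eq_integral => y _.
  under eq_integral => x _ do rewrite /= ger0_norm ?mulr_ge0// mulrC EFinM.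
  rewrite integralZl// EFin_Rintegral// muleC.
  over.
by rewrite integralZl// EFin_Rintegral// -EFinM ltry.
Qed.

Lemma Rintegral_prod (u v : R -> R) :
  (forall x, 0 <= u x) -> (forall x, 0 <= v x) ->
  mu.-integrable setT (EFin \o u) -> mu.-integrable setT (EFin \o v) ->
  \int[mu2]_x (u x.1 * v x.2) = (\int[mu]_x u x) * (\int[mu]_x v x).
Proof.
move=> u0 v0 iu iv.
apply: EFin_inj; rewrite -Rintegral_fubini; last exact: prod_integrable.
under eq_integral => y _.
  under eq_integral => x _ do rewrite /= mulrC EFinM.
  rewrite integralZl// EFin_Rintegral// muleC.
  over.
by rewrite integralZl// EFin_Rintegral// -EFinM.
Qed.

Lemma integral_box1_cos (k : int) (b : R) :
  \int[mu]_t (box1 t * cos (t * k%:~R + b)) = if k == 0 then 2 * pi * cos b else 0.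
Proof.
have [->|k0] := eqVneq k 0.
  under eq_Rintegral do rewrite mulr0 add0r mulrC.
  by rewrite RintegralZl ?integral_box1 1?mulrC//; exact: integrable_box1.
have k0' : k%:~R != 0 :> R by rewrite intr_eq0.
have -> : \int[mu]_t (box1 t * cos (t * k%:~R + b)) =
   \int[mu]_(t in `[- pi, pi]) cos (t * k%:~R + b).
  rewrite [RHS]Rintegral_mkcond; apply: eq_Rintegral => t _.
  by rewrite /box1 indicE patchE; case: ifP => _; rewrite ?mul1r ?mul0r.
pose F t := (k%:~R)^-1 * sin (t * k%:~R + b).
have dF (x : R) : is_derive x (1 : R) F (cos (x * k%:~R + b)).
  by rewrite /F; apply: is_derive_eq; rewrite /GRing.scale/=; field.
have ck : continuous (fun t : R => cos (t * k%:~R + b)).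
  by apply: is_derive_continuous => x; apply: is_derive_eq.
have cF : continuous F by exact: is_derive_continuous dF.
rewrite /Rintegral (@continuous_FTC2 _ (fun t : R => cos (t * k%:~R + b)) F)//.
- rewrite /= /F -mulrBr.
  suff -> : sin (pi * k%:~R + b) = sin (- pi * k%:~R + b) :> R by rewrite subrr mulr0.
  case: k k0 k0' {F dF ck cF} => n _ _.
    have -> : pi * (Posz n)%:~R + b = - pi * (Posz n)%:~R + b + pi *+ 2 *+ n :> R.
      by rewrite -pmulrn; ring.
    by rewrite (periodicn (@sinD2pi R)).
  have -> : - pi * (Negz n)%:~R + b = pi * (Negz n)%:~R + b + pi *+ 2 *+ n.+1 :> R.
    by rewrite NegzE mulrNz -pmulrn; ring.
  by rewrite (periodicn (@sinD2pi R)).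
- by rewrite gtrN ?pi_gt0.
- exact: continuous_subspaceT.
- split.
  + by move=> x _; case: (dF x).
  + by apply: cvg_at_right_filter; exact: cF.
  + by apply: cvg_at_left_filter; exact: cF.
- by move=> x _; rewrite derive1E; exact: derive_val.
Qed.

Lemma measurable_box_cos (y1 y2 : R) :
  measurable_fun setT (fun x : R * R => box x * cos (x.1 * y1 + x.2 * y2)).
Proof.
apply: measurable_funM; first exact: measurable_box.
apply: measurableT_comp.
  by apply: continuous_measurable_fun; exact: continuous_cos.
by apply: measurable_funD; apply: measurable_funM.
Qed.

Lemma integrable_box_cos (y1 y2 : R) :
  mu2.-integrable setT (EFin \o (fun x : R * R => box x * cos (x.1 * y1 + x.2 * y2))).
Proof.
have := prod_integrable box1_ge0 box1_ge0 integrable_box1 integrable_box1.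
apply: le_integrable => //.
  by apply/measurable_EFinP; exact: measurable_box_cos.
by move=> x _ /=; rewrite lee_fin normrM ler_piMr// cos_max.
Qed.

(** Orthogonality of characters: this is what extracts the probability of a
    single lattice point from a characteristic function. *)
Lemma fourier_box (k l : int) :
  \int[mu2]_x (box x * cos (x.1 * k%:~R + x.2 * l%:~R)) =
  if (k == 0) && (l == 0) then (2 * pi) ^+ 2 else 0.
Proof.
apply: EFin_inj; rewrite -Rintegral_fubini; last exact: integrable_box_cos.
have ibc (j : int) (b : R) : mu.-integrable setT (EFin \o (fun t => box1 t * cos (t * j%:~R
  + b))).
  apply: le_integrable integrable_box1 => //.
    apply/measurable_EFinP; apply: measurable_funM; first exact: measurable_box1.
    apply: continuous_measurable_fun.
    by apply: is_derive_continuous => x; apply: is_derive_eq.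
  by move=> x _ /=; rewrite lee_fin normrM ler_piMr// cos_max.
under eq_integral => y _.
  under eq_integral => x _ do rewrite /box /= [box1 x * box1 y]mulrC -mulrA EFinM.
  rewrite integralZl//; last exact: (ibc k (y * l%:~R)).
  rewrite (EFin_Rintegral (ibc k (y * l%:~R))) integral_box1_cos.
  have -> : ((box1 y)%:E * (if k == 0 then 2 * pi * cos (y * l%:~R) else 0)%:E =
     (if k == 0 then 2 * pi else 0)%:E * (box1 y * cos (y * l%:~R + 0))%:E)%E.
    by rewrite addr0 -!EFinM; congr EFin; case: ifP => _; ring.
  over.
rewrite integralZl//; last exact: (ibc l 0).
rewrite (EFin_Rintegral (ibc l 0)) integral_box1_cos cos0 -EFinM; congr EFin.
by case: (k == 0); case: (l == 0); rewrite ?mulr0 ?mul0r ?mulr1 ?expr2.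
Qed.

(** The difference of the two inversion integrands lives on the square and,
    through the Gaussian tail, outside of it; hence a majorant made of one part
    of each kind. *)
Lemma le_Rintegral_gauss_box (f : R * R -> R) (s C1 C2 : R) :
  0 < s -> mu2.-integrable setT (EFin \o f) ->
  (forall x, `|f x| <= C1 * (gaussw s 0 x.1 * gaussw s 0 x.2) + C2 * box x) ->
  `|\int[mu2]_x f x| <= C1 * (2 * pi / s) + C2 * (2 * pi) ^+ 2.
Proof.
move=> s0 fi fb.
have g0 x : 0 <= gaussw s 0 x by exact: expR_ge0.
have ig := prod_integrable g0 g0 (integrable_gaussw 0 s0) (integrable_gaussw 0 s0).
have ib := prod_integrable box1_ge0 box1_ge0 integrable_box1 integrable_box1.
have ig' := integrableZl measurableT C1 ig.
have ib' := integrableZl measurableT C2 ib.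
apply: (le_trans (le_normr_Rintegral measurableT fi)).
apply: (@le_trans _ _ (\int[mu2]_x (C1 * (gaussw s 0 x.1 * gaussw s 0 x.2) + C2 * box x))).
  apply: le_Rintegral => //; first exact: integrable_norm.
  exact: (integrableD measurableT ig' ib').
rewrite RintegralD// !RintegralZl// !Rintegral_prod//; try exact: integrable_gaussw;
  try exact: integrable_box1; try exact: box1_ge0.
rewrite integral_gaussw// integral_box1 -expr2 sqr_sqrtr -?expr2//.
by rewrite divr_ge0 ?mulr_ge0 ?pi_ge0// ltW.
Qed.

End inversion.

(** * Taylor bounds and unit complex numbers *)

Section trig.
Variable R : realType.

(** Integrates inequalities: each Taylor bound below applies it to the
    difference of two sides. *)
Lemma ge0_derive_le (f df : R -> R) :
  (forall x : R, is_derive x (1 : R) f (df x)) -> (forall x, 0 <= x -> 0 <= df x) ->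
  forall u, 0 <= u -> f 0 <= f u.
Proof.
move=> fd d0 u u0.
have cf : continuous f.
  by move=> x; apply/differentiable_continuous/derivable1_diffP; case: (fd x).
have [c] := MVT_segment u0 (fun x _ => fd x) (continuous_subspaceT cf).
rewrite in_itv/= => /andP[c0 _] h.
by rewrite -subr_ge0 h mulr_ge0 ?d0 ?subr0.
Qed.

Lemma sin_le (u : R) : 0 <= u -> sin u <= u.
Proof.
move=> u0; pose f (x : R) := x - sin x.
have fd (x : R) : is_derive x (1 : R) f (1 - cos x) by rewrite /f; apply: is_derive_eq.
have := ge0_derive_le fd _ u0; rewrite /f sin0 subr0 subr_ge0; apply.
by move=> x _; rewrite subr_ge0 cos_le1.
Qed.

Lemma cos_ge_quad (u : R) : 1 - u ^+ 2 / 2 <= cos u.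
Proof.
wlog u0 : u / 0 <= u => [h|].
  by have [/h//|/ltW u0] := leP 0 u; rewrite -cosN -sqrrN; apply: h; rewrite oppr_ge0.
pose f (x : R) := cos x + x ^+ 2 / 2.
have fd (x : R) : is_derive x (1 : R) f (x - sin x).
  by rewrite /f; apply: is_derive_eq; rewrite /GRing.scale/=; field.
have := ge0_derive_le fd _ u0; rewrite /f cos0 expr0n/= mul0r addr0 lerBlDr; apply.
by move=> x x0; rewrite subr_ge0 sin_le.
Qed.

Lemma sin_ge_quad (u : R) : 0 <= u -> u - u ^+ 2 / 2 <= sin u.
Proof.
move=> u0.
have h1 (x : R) : 0 <= x -> 1 - cos x <= x.
  move=> x0; pose g (x : R) := x + cos x.
  have gd (y : R) : is_derive y (1 : R) g (1 - sin y) by rewrite /g; apply: is_derive_eq.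
  have := ge0_derive_le gd _ x0; rewrite /g cos0 add0r lerBlDr; apply.
  by move=> y _; rewrite subr_ge0 sin_le1.
pose f (x : R) := sin x + x ^+ 2 / 2 - x.
have fd (x : R) : is_derive x (1 : R) f (x - (1 - cos x)).
  by rewrite /f; apply: is_derive_eq; rewrite /GRing.scale/=; field.
have := ge0_derive_le fd _ u0; rewrite /f sin0 expr0n/= mul0r !addr0 subrr.
have -> : (u - u ^+ 2 / 2 <= sin u) = (0 <= sin u + u ^+ 2 / 2 - u) by lra.
by apply => x x0; rewrite subr_ge0 h1.
Qed.

Lemma cos_taylor2 (u : R) : `|cos u - 1 + u ^+ 2 / 2| <= `|u| ^+ 3.
Proof.
wlog u0 : u / 0 <= u => [h|].
  by have [/h//|/ltW u0] := leP 0 u; rewrite -cosN -sqrrN -[in leRHS]normrN; apply: h;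
    rewrite oppr_ge0.
have h0 := cos_ge_quad u.
rewrite ger0_norm ?(ger0_norm u0); last by lra.
pose f (x : R) := x ^+ 3 / 6 - (cos x + x ^+ 2 / 2).
have fd (x : R) : is_derive x (1 : R) f (x ^+ 2 / 2 - (x - sin x)).
  by rewrite /f; apply: is_derive_eq; rewrite /GRing.scale/=; field.
have := ge0_derive_le fd _ u0; rewrite /f cos0 !expr0n/= !mul0r !addr0 sub0r => h.
have {}h : -1 <= u ^+ 3 / 6 - (cos u + u ^+ 2 / 2).
  by apply: h => x x0; have := sin_ge_quad x0; lra.
have u3 : 0 <= u ^+ 3 by rewrite exprn_ge0.
lra.
Qed.

Lemma sin_taylor1 (u : R) : `|sin u - u| <= `|u| ^+ 3.
Proof.
wlog u0 : u / 0 <= u => [h|].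
  have [/h//|/ltW u0] := leP 0 u; rewrite -normrN opprD -sinN.
  by rewrite -[in leRHS]normrN; apply: h; rewrite oppr_ge0.
rewrite -normrN opprB ger0_norm ?(ger0_norm u0) ?subr_ge0 ?sin_le//.
pose f (x : R) := x ^+ 3 / 6 - (x - sin x).
have fd (x : R) : is_derive x (1 : R) f (x ^+ 2 / 2 - (1 - cos x)).
  by rewrite /f; apply: is_derive_eq; rewrite /GRing.scale/=; field.
have := ge0_derive_le fd _ u0; rewrite /f sin0 !expr0n/= !mul0r !subr0 => h.
have {}h : 0 <= u ^+ 3 / 6 - (u - sin u).
  by apply: h => x x0; have := cos_ge_quad x; lra.
have u3 : 0 <= u ^+ 3 by rewrite exprn_ge0.
lra.
Qed.

(** Stated in t instead of t^2 so that the error is a cube, like the errors of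
    the characteristic function with which this exponential is compared. *)
Lemma expRN_taylor1 (t : R) : 0 <= t ->
  `|expR (- (t ^+ 2 / 2)) - 1 + t ^+ 2 / 2| <= t ^+ 3.
Proof.
move=> t0; set u := t ^+ 2 / 2.
have u0 : 0 <= u by rewrite divr_ge0// sqr_ge0.
have h1 := expR_ge1Dx (- u).
have h2 : expR (- u) <= (1 + u)^-1.
  rewrite expRN lef_pV2 ?posrE ?expR_gt0 ?expR_ge1Dx//; lra.
have h3 : expR (- u) <= 1 by rewrite -expR0 ler_expR; lra.
rewrite ger0_norm; last by lra.
have [t1|t1] := leP t 1.
  have h4 : (1 + u)^-1 <= 1 - u + u ^+ 2.
    rewrite -[leLHS]mul1r ler_pdivrMr; last by lra.
    have -> : (1 - u + u ^+ 2) * (1 + u) = 1 + u ^+ 3 by ring.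
    by rewrite lerDl exprn_ge0.
  have h5 : u ^+ 2 <= t ^+ 3.
    rewrite /u expr_div_n -exprM ler_pdivrMr//.
    have := exprn_ge0 3 t0 => h.
    have -> : t ^+ (2 * 2) = t ^+ 3 * t by rewrite -exprSr.
    by rewrite ler_wpM2l//; lra.
  lra.
have h6 : u <= t ^+ 3.
  by rewrite /u exprS; have := sqr_ge0 t; nra.
lra.
Qed.
End trig.

Section cis.
Variable R : realType.
Implicit Types (a b t : R).

Definition cis t : R[i] := (cos t +i* sin t)%C.

Lemma cisD a b : cis (a + b) = cis a * cis b.
Proof. by rewrite /cis cosD sinD; apply/eqP; rewrite eq_complex/=; apply/andP; split;
  apply/eqP; ring. Qed.

Lemma cis0 : cis 0 = 1.
Proof. by rewrite /cis cos0 sin0. Qed.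

Lemma normc_cis t : normc (cis t) = 1.
Proof. by rewrite /normc /cis cos2Dsin2 sqrtr1. Qed.

Lemma normcD (x y : R[i]) : normc (x + y) <= normc x + normc y.
Proof. exact: (@le_normcD R x y). Qed.

Lemma normc_real (a : R) : normc (a%:C)%C = `|a|.
Proof. by rewrite /normc/= expr0n/= addr0 sqrtr_sqr. Qed.

Lemma normc_ge0 (x : R[i]) : 0 <= normc x.
Proof. by case: x => a b; rewrite /normc sqrtr_ge0. Qed.

Lemma normc_le_ReIm (x : R[i]) : normc x <= `|complex.Re x| + `|complex.Im x|.
Proof.
case: x => a b /=; rewrite -ler_sqr ?nnegrE ?sqrtr_ge0 ?addr_ge0//.
rewrite sqr_sqrtr ?addr_ge0 ?sqr_ge0// -(real_normK (num_real a)) -(real_normK (num_real b)).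
have := mulr_ge0 (normr_ge0 a) (normr_ge0 b).
rewrite !real_normK ?num_real// => h; rewrite sqrrD !real_normK ?num_real//; lra.
Qed.

Lemma Re_le_normc (x : R[i]) : `|complex.Re x| <= normc x.
Proof.
case: x => a b /=; rewrite -sqrtr_sqr ler_wsqrtr// lerDl sqr_ge0//.
Qed.

Lemma normc_sum n (F : nat -> R[i]) :
  normc (\sum_(k < n) F k) <= \sum_(k < n) normc (F k).
Proof.
elim: n => [|n IH]; first by rewrite !big_ord0 normc0.
by rewrite !big_ord_recr/= (le_trans (normcD _ _))// lerD2r.
Qed.
End cis.

(** * Characteristic functions of finite laws on the integers *)

Section law.
Variable R : realType.
Implicit Types (p : nat -> R) (n : nat).

(** A finite law on the integers is a weight function together with a cutoff n,
    which makes every moment a finite sum. *)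
Definition charf p n (t : R) : R[i] := \sum_(k < n) (p k)%:C%C * cis (k%:R * t).
Definition lmean p n : R := \sum_(k < n) p k * k%:R.
Definition lvar p n : R := \sum_(k < n) p k * (k%:R - lmean p n) ^+ 2.
Definition mom3 p n : R := \sum_(k < n) p k * k%:R ^+ 3.

Definition is_law p n := (forall k, 0 <= p k) /\ \sum_(k < n) p k = 1.

Lemma sum_ord2_le p n (F : nat -> R) : (forall k, 0 <= F k) ->
  F 0%N + F 1%N <= \sum_(k < n.+2) F k.
Proof.
move=> F0; rewrite !big_ord_recl/= addrA lerDl; apply: sumr_ge0 => i _; exact: F0.
Qed.

(** The atoms at 0 and 1 suffice: the modulus of p_0 + p_1 exp(it) falls short
    of p_0 + p_1 by at least p_0 p_1 (1 - cos t), and the remaining mass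
    contributes at most itself. *)
Lemma normc_charf_le p n t : is_law p n.+2 ->
  normc (charf p n.+2 t) <= expR (- (p 0%N * p 1%N * (1 - cos t))).
Proof.
move=> [p0 p1]; set d := p 0%N * p 1%N * (1 - cos t).
have s1 : p 0%N + p 1%N <= 1 by rewrite -p1; exact: sum_ord2_le.
have a0 := p0 0%N; have b0 := p0 1%N.
have c0 := cos_le1 t; have c1 := cos_geN1 t.
have d0 : 0 <= d by rewrite !mulr_ge0//; lra.
have pp : p 0%N * p 1%N <= p 0%N * 1 by rewrite ler_wpM2l//; lra.
have pp' : p 0%N * p 1%N <= 1 * p 1%N by rewrite ler_wpM2r//; lra.
have d1 : d <= p 0%N + p 1%N.
  apply: (@le_trans _ _ (p 0%N * p 1%N * 2)); last lra.
  by rewrite ler_wpM2l ?mulr_ge0//; lra.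
have hd : normc ((p 0%N)%:C%C * cis (0%:R * t) + (p 1%N)%:C%C * cis (1%:R * t)) <=
  p 0%N + p 1%N - d.
  have -> : (p 0%N)%:C%C * cis (0%:R * t) + (p 1%N)%:C%C * cis (1%:R * t) =
     ((p 0%N + p 1%N * cos t) +i* (p 1%N * sin t))%C.
    rewrite mul0r mul1r cis0 mulr1; apply/eqP; rewrite eq_complex/=.
    by rewrite !mul0r subr0 add0r !addr0 !eqxx.
  rewrite /normc -ler_sqr ?nnegrE ?sqrtr_ge0//; last by lra.
  rewrite sqr_sqrtr ?addr_ge0 ?sqr_ge0//.
  have -> : (p 0%N + p 1%N * cos t) ^+ 2 + (p 1%N * sin t) ^+ 2 = (p 0%N + p 1%N) ^+ 2 - 2 * d.
    have h := cos2Dsin2 t; rewrite /d.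
    have -> : (p 0%N + p 1%N * cos t) ^+ 2 + (p 1%N * sin t) ^+ 2 =
      p 0%N ^+ 2 + 2 * p 0%N * p 1%N * cos t + p 1%N ^+ 2 * (cos t ^+ 2 + sin t ^+ 2) by ring.
    by rewrite h; ring.
  have h1 : 0 <= d * (1 - (p 0%N + p 1%N)) by rewrite mulr_ge0//; lra.
  have h2 := sqr_ge0 d.
  have -> : (p 0%N + p 1%N - d) ^+ 2 = (p 0%N + p 1%N) ^+ 2 - 2 * d + 2 * (d * (1 - (p 0%N
    + p 1%N))) + d ^+ 2 by ring.
  lra.
apply: (@le_trans _ _ (1 - d)); last first.
  by have := expR_ge1Dx (- d).
rewrite /charf !big_ord_recl/= addrA (le_trans (normcD _ _))//.
have -> : 1 - d = (p 0%N + p 1%N - d) + \sum_(i < n) p i.+2.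
  rewrite -p1 !big_ord_recl/=.
  have -> : \sum_(i < n) p (bump 0 (bump 0 i)) = \sum_(i < n) p i.+2 by exact: eq_bigr.
  by rewrite /bump/=; ring.
apply: lerD => //.
rewrite (le_trans (normc_sum n (fun k => (p (bump 0 (bump 0 k)))%:C%C
  * cis ((bump 0 (bump 0 k))%:R * t)) ))//.
by apply: ler_sum => i _; rewrite normcM normc_real normc_cis mulr1 ger0_norm.
Qed.

(** The atoms at 0 and 1 have this much variance about any centre m, since (p_0
    + p_1) (p_0 m^2 + p_1 (1 - m)^2) is p_0 p_1 plus a square. *)
Lemma lvar_ge p n : is_law p n.+2 -> p 0%N * p 1%N <= lvar p n.+2.
Proof.
move=> [p0 p1]; set m := lmean p n.+2.
have s1 : p 0%N + p 1%N <= 1 by rewrite -p1; exact: sum_ord2_le.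
have a0 := p0 0%N; have b0 := p0 1%N.
apply: (@le_trans _ _ (p 0%N * (0%:R - m) ^+ 2 + p 1%N * (1%:R - m) ^+ 2)); last first.
  by apply: (@sum_ord2_le p n (fun k => p k * (k%:R - m) ^+ 2)) => k;
    rewrite mulr_ge0// sqr_ge0.
set V := _ + _.
have V0 : 0 <= V by rewrite addr_ge0// mulr_ge0// sqr_ge0.
have hV : (p 0%N + p 1%N) * V = p 0%N * p 1%N + (p 0%N * m - p 1%N * (1 - m)) ^+ 2
  by rewrite /V; ring.
have h2 := sqr_ge0 (p 0%N * m - p 1%N * (1 - m)).
have h3 : 0 <= V * (1 - (p 0%N + p 1%N)) by rewrite mulr_ge0//; lra.
lra.
Qed.

Lemma lmean_ge0 p n : is_law p n -> 0 <= lmean p n.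
Proof. by move=> [p0 _]; apply: sumr_ge0 => k _; rewrite mulr_ge0. Qed.

Lemma lvar_ge0 p n : is_law p n -> 0 <= lvar p n.
Proof. by move=> [p0 _]; apply: sumr_ge0 => k _; rewrite mulr_ge0// sqr_ge0. Qed.

(** The Gaussian factor obeys the decay bound of normc_charf_le, so that both
    fit into one telescoping product. *)
Lemma gauss_factor_le p n t : is_law p n.+2 ->
  expR (- (lvar p n.+2 * t ^+ 2 / 2)) <= expR (- (p 0%N * p 1%N * (1 - cos t))).
Proof.
move=> hl; rewrite ler_expR lerN2.
have h1 := lvar_ge hl; have h2 := cos_ge_quad t; have [p0 _] := hl.
have pp : 0 <= p 0%N * p 1%N by rewrite mulr_ge0.
apply: (@le_trans _ _ (p 0%N * p 1%N * (t ^+ 2 / 2))).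
  by rewrite ler_wpM2l//; lra.
by rewrite -[leRHS]mulrA ler_wpM2r// divr_ge0// sqr_ge0.
Qed.

Definition abs3 p n : R := \sum_(k < n) p k * `|k%:R - lmean p n| ^+ 3.

Lemma sum_centered p n : is_law p n ->
  \sum_(k < n) p k * (k%:R - lmean p n) = 0.
Proof.
move=> [_ p1]; under eq_bigr do rewrite mulrBr.
by rewrite sumrB -mulr_suml p1 mul1r subrr.
Qed.

(** The tangent of the cube at the mean gives Jensen's inequality: the cube of
    the mean is at most the third moment. *)
Lemma abs3_le p n : is_law p n -> abs3 p n <= 2 * mom3 p n.
Proof.
move=> hl; have [p0 p1] := hl; set m := lmean p n.
have m0 : 0 <= m by exact: lmean_ge0.
have hm : m ^+ 3 <= mom3 p n.
  apply: (@le_trans _ _ (\sum_(k < n) p k * (m ^+ 3 + 3 * m ^+ 2 * (k%:R - m)))).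
    have -> : \sum_(k < n) p k * (m ^+ 3 + 3 * m ^+ 2 * (k%:R - m)) =
      (\sum_(k < n) p k) * m ^+ 3 + 3 * m ^+ 2 * \sum_(k < n) p k * (k%:R - m).
      rewrite mulr_suml mulr_sumr -big_split/=; apply: eq_bigr => k _; ring.
    by rewrite p1 mul1r sum_centered// mulr0 addr0.
  apply: ler_sum => k _; rewrite ler_wpM2l//.
  have k0 : 0 <= k%:R :> R by [].
  have h := sqr_ge0 (k%:R - m).
  have : 0 <= (k%:R - m) ^+ 2 * (k%:R + 2 * m) by rewrite mulr_ge0//; lra.
  have -> : (k%:R - m) ^+ 2 * (k%:R + 2 * m) = k%:R ^+ 3 - (m ^+ 3
    + 3 * m ^+ 2 * (k%:R - m)) by ring.
  by rewrite subr_ge0.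
apply: (@le_trans _ _ (\sum_(k < n) p k * (k%:R ^+ 3 + m ^+ 3))).
  apply: ler_sum => k _; rewrite ler_wpM2l//.
  have k0 : 0 <= k%:R :> R by [].
  have := exprn_ge0 3 k0; have := exprn_ge0 3 m0 => hm3 hk3.
  rewrite -/m; have [h|h] := leP (k%:R : R) m.
    rewrite ler0_norm ?subr_le0// opprB (@le_trans _ _ (m ^+ 3))//; last lra.
    by apply: lerXn2r; rewrite ?nnegrE -?/m; lra.
  rewrite ger0_norm; last by lra.
  rewrite (@le_trans _ _ (k%:R ^+ 3))//; last by lra.
  by apply: lerXn2r; rewrite ?nnegrE; lra.
under eq_bigr do rewrite mulrDr.
by rewrite big_split/= -mulr_suml p1 mul1r -/(mom3 p n); lra.
Qed.

(** Summing 3 t^2 s <= 2 t^3 + s^3 over the law, with s the standard deviation.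
    *)
Lemma lyapunov p n : is_law p n -> Num.sqrt (lvar p n) ^+ 3 <= abs3 p n.
Proof.
move=> hl; have [p0 p1] := hl; set m := lmean p n; set s := Num.sqrt _.
have s0 : 0 <= s by exact: sqrtr_ge0.
have hs : s ^+ 2 = lvar p n by rewrite sqr_sqrtr// lvar_ge0.
have : lvar p n * s <= \sum_(k < n) p k * ((2 * `|k%:R - m| ^+ 3 + s ^+ 3) / 3).
  rewrite /lvar mulr_suml; apply: ler_sum => k _; rewrite -mulrA ler_wpM2l//.
  set y := k%:R - m; rewrite -(real_normK (num_real y)); set t := `|y|.
  have t0 : 0 <= t by exact: normr_ge0.
  have : 0 <= (t - s) ^+ 2 * (2 * t + s) by rewrite mulr_ge0 ?sqr_ge0//; lra.
  have -> : (t - s) ^+ 2 * (2 * t + s) = 2 * t ^+ 3 + s ^+ 3 - 3 * (t ^+ 2 * s) by ring.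
  lra.
have -> : \sum_(k < n) p k * ((2 * `|k%:R - m| ^+ 3 + s ^+ 3) / 3) =
   2 / 3 * abs3 p n + s ^+ 3 / 3.
  have -> : s ^+ 3 / 3 = (\sum_(k < n) p k) * (s ^+ 3 / 3) by rewrite p1 mul1r.
  rewrite /abs3 mulr_sumr mulr_suml -big_split/=.
  by apply: eq_bigr => k _; rewrite -/m; field.
by rewrite -hs -exprSr; lra.
Qed.

(** After centring, the Taylor expansions agree up to second order. The
    remainders are cubic, with coefficients bounded by the third absolute moment
    and by the cube of the standard deviation. *)
Lemma charf_gauss p n t : is_law p n ->
  normc (charf p n t - (expR (- (lvar p n * t ^+ 2 / 2)))%:C%C * cis (lmean p n * t))
  <= 6 * mom3 p n * `|t| ^+ 3.
Proof.
move=> hl; have [p0 p1] := hl; set m := lmean p n; set g := expR _.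
have -> : charf p n t - g%:C%C * cis (m * t) =
   cis (m * t) * (\sum_(k < n) (p k)%:C%C * cis ((k%:R - m) * t) - g%:C%C).
  rewrite mulrBr [_ * g%:C%C]mulrC mulr_sumr; congr (_ - _); apply: eq_bigr => k _.
  by rewrite mulrCA -cisD; congr (_ * cis _); ring.
rewrite normcM normc_cis mul1r; apply: (le_trans (normc_le_ReIm _)).
set Z := _ - _.
have ReZ : complex.Re Z = \sum_(k < n) p k * cos ((k%:R - m) * t) - g.
  rewrite /Z raddfB/= raddf_sum/=; congr (_ - _); apply: eq_bigr => k _.
  by rewrite mul0r subr0.
have ImZ : complex.Im Z = \sum_(k < n) p k * sin ((k%:R - m) * t).
  rewrite /Z raddfB/= raddf_sum/= subr0; apply: eq_bigr => k _.
  by rewrite mul0r addr0.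
have sv : Num.sqrt (lvar p n) ^+ 2 = lvar p n by rewrite sqr_sqrtr// lvar_ge0.
have hR : `|complex.Re Z| <= abs3 p n * `|t| ^+ 3 + Num.sqrt (lvar p n) ^+ 3 * `|t| ^+ 3.
  rewrite ReZ.
  have -> : \sum_(k < n) p k * cos ((k%:R - m) * t) - g =
     \sum_(k < n) p k * (cos ((k%:R - m) * t) - 1 + ((k%:R - m) * t) ^+ 2 / 2)
     - (g - 1 + lvar p n * t ^+ 2 / 2).
    have -> : \sum_(k < n) p k * (cos ((k%:R - m) * t) - 1 + ((k%:R - m) * t) ^+ 2 / 2) =
       \sum_(k < n) p k * cos ((k%:R - m) * t) - \sum_(k < n) p k + lvar p n * t ^+ 2 / 2.
      rewrite /lvar -/m !mulr_suml -sumrB -big_split/=; by apply: eq_bigr => k _; field.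
    by rewrite p1; ring.
  apply: (le_trans (ler_normB _ _)); apply: lerD.
    rewrite /abs3 mulr_suml; apply: (le_trans (ler_norm_sum _ _ _)).
    apply: ler_sum => k _; rewrite normrM ger0_norm// -mulrA ler_wpM2l//.
    by rewrite -exprMn -normrM cos_taylor2.
  have -> : lvar p n * t ^+ 2 / 2 = (Num.sqrt (lvar p n) * `|t|) ^+ 2 / 2.
    by rewrite exprMn sv real_normK ?num_real.
  rewrite /g.
  have -> : lvar p n * t ^+ 2 / 2 = (Num.sqrt (lvar p n) * `|t|) ^+ 2 / 2.
    by rewrite exprMn sv real_normK ?num_real.
  by rewrite -exprMn expRN_taylor1// mulr_ge0// sqrtr_ge0.
have hI : `|complex.Im Z| <= abs3 p n * `|t| ^+ 3.
  rewrite ImZ.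
  have -> : \sum_(k < n) p k * sin ((k%:R - m) * t) =
     \sum_(k < n) p k * (sin ((k%:R - m) * t) - (k%:R - m) * t).
    under [RHS]eq_bigr do rewrite mulrBr mulrA.
    by rewrite sumrB -mulr_suml sum_centered// mul0r subr0.
  rewrite /abs3 mulr_suml; apply: (le_trans (ler_norm_sum _ _ _)).
  apply: ler_sum => k _; rewrite normrM ger0_norm// -mulrA ler_wpM2l//.
  by rewrite -exprMn -normrM sin_taylor1.
have h3 := lyapunov hl; have h4 := abs3_le hl.
have t3 : 0 <= `|t| ^+ 3 by rewrite exprn_ge0.
apply: (le_trans (lerD hR hI)).
rewrite -!mulrDl ler_wpM2r//; lra.
Qed.

End law.

(** * Sums of independent lattice vectors *)

Lemma Re_realM (R : realType) (a : R) (z : R[i]) :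
  complex.Re (a%:C%C * z) = a * complex.Re z.
Proof. by case: z => p q /=; rewrite mul0r subr0. Qed.

Section prodcmp.
Variables (R : realType) (T : Type).

Lemma normc_prod (X : seq T) (a : T -> R[i]) (c : T -> R) :
  (forall x, normc (a x) <= expR (- c x)) ->
  normc (\prod_(x <- X) a x) <= expR (- \sum_(x <- X) c x).
Proof.
move=> ha; elim: X => [|x X IH].
  by rewrite !big_nil oppr0 expR0 normc1.
rewrite !big_cons normcM opprD expRD ler_pM ?normc_ge0//.
Qed.

(** Telescoping: exchanging the factors one at a time leaves at each step a
    product that lacks one factor, and expR B pays for the missing one. *)
Lemma prod_compare (X : seq T) (a b : T -> R[i]) (c : T -> R) (B : R) :
  (forall x, normc (a x) <= expR (- c x)) ->
  (forall x, normc (b x) <= expR (- c x)) ->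
  (forall x, c x <= B) ->
  normc (\prod_(x <- X) a x - \prod_(x <- X) b x) <=
  expR B * (\sum_(x <- X) normc (a x - b x)) * expR (- \sum_(x <- X) c x).
Proof.
move=> ha hb hc; elim: X => [|x X IH].
  by rewrite !big_nil subrr normc0 mulr0 mul0r.
rewrite !big_cons; set A := \prod_(_ <- _) _; set A' := \prod_(_ <- _) _.
have -> : a x * A - b x * A' = (a x - b x) * A + b x * (A - A') by ring.
apply: (le_trans (normcD _ _)); rewrite !normcM.
rewrite mulrDr mulrDl; apply: lerD.
  rewrite opprD expRD mulrA ler_pM ?normc_ge0//; last exact: normc_prod.
  rewrite mulrAC -expRD ler_peMl ?normc_ge0// -expR0 ler_expR.
  by rewrite subr_ge0.
by rewrite opprD expRD mulrCA ler_pM ?normc_ge0.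
Qed.
End prodcmp.

Section finite_law.
Variables (R : realType) (T : Type) (x1 x2 : T -> nat) (v : T -> nat -> R).
Variable n : nat.
Implicit Types (X : seq T) (F G : nat -> nat -> R).

(** Expectation of F at the sum of independent vectors k_x (x1 x, x2 x), with
    k_x of law v x and x ranging over X. Peeling off one vector at a time avoids
    a product space. *)
Fixpoint Ex X F : R :=
  if X is x :: X' then
    \sum_(k < n) v x k * Ex X' (fun a b => F (a + k * x1 x)%N (b + k * x2 x)%N)
  else F 0%N 0%N.

Lemma eq_Ex X F G : (forall a b, F a b = G a b) -> Ex X F = Ex X G.
Proof.
elim: X F G => [|x X IH] F G h /=; first exact: h.
by apply: eq_bigr => k _; congr (_ * _); apply: IH => a b; exact: h.
Qed.

Lemma ExD X F G : Ex X (fun a b => F a b + G a b) = Ex X F + Ex X G.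
Proof.
elim: X F G => [//|x X IH] F G /=; rewrite -big_split/=.
by apply: eq_bigr => k _; rewrite IH mulrDr.
Qed.

Lemma ExZ X F (c : R) : Ex X (fun a b => c * F a b) = c * Ex X F.
Proof.
elim: X F => [//|x X IH] F /=; rewrite mulr_sumr.
by apply: eq_bigr => k _; rewrite IH mulrCA.
Qed.

Hypothesis hv : forall x, is_law (v x) n.

Lemma Ex_cst X (c : R) : Ex X (fun _ _ => c) = c.
Proof.
elim: X => [//|x X IH] /=; have [_ h] := hv x.
by under eq_bigr do rewrite IH; rewrite -mulr_suml h mul1r.
Qed.

Lemma le_Ex X F G : (forall a b, F a b <= G a b) -> Ex X F <= Ex X G.
Proof.
elim: X F G => [|x X IH] F G h /=; first exact: h.
have [h0 _] := hv x.
by apply: ler_sum => k _; rewrite ler_wpM2l//; apply: IH => a b; exact: h.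
Qed.

Definition dotx (u1 u2 : R) (x : T) : R := (x1 x)%:R * u1 + (x2 x)%:R * u2.
Definition lin (u1 u2 : R) (a b : nat) : R := a%:R * u1 + b%:R * u2.

Lemma lin_shift u1 u2 (a b k : nat) x :
  lin u1 u2 (a + k * x1 x) (b + k * x2 x) = lin u1 u2 a b + k%:R * dotx u1 u2 x.
Proof. by rewrite /lin /dotx !natrD !natrM; ring. Qed.

(** Independence turns the characteristic function of the sum into a product.
    The phase b carries the vectors already peeled off in the induction. *)
Lemma Ex_cis X (u1 u2 b : R) :
  Ex X (fun a c => cos (lin u1 u2 a c + b)) =
  complex.Re (cis b * \prod_(x <- X) charf (v x) n (dotx u1 u2 x)).
Proof.
elim: X b => [|x X IH] b /=.
  by rewrite big_nil mulr1 /lin !mul0r !add0r.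
rewrite big_cons {1}/charf mulr_suml mulr_sumr raddf_sum/=; apply: eq_bigr => k _.
have -> : Ex X (fun a c => cos (lin u1 u2 (a + k * x1 x) (c + k * x2 x) + b)) =
   Ex X (fun a c => cos (lin u1 u2 a c + (b + k%:R * dotx u1 u2 x))).
  by apply: eq_Ex => a c; rewrite lin_shift; congr cos; ring.
rewrite IH cisD; set P := \prod_(_ <- _) _.
have -> : cis b * ((v x k)%:C%C * cis (k%:R * dotx u1 u2 x) * P) =
   (v x k)%:C%C * (cis b * cis (k%:R * dotx u1 u2 x) * P) by ring.
by rewrite Re_realM.
Qed.

Lemma Ex_lin X (u1 u2 : R) :
  Ex X (lin u1 u2) = \sum_(x <- X) lmean (v x) n * dotx u1 u2 x.
Proof.
elim: X => [|x X IH] /=; first by rewrite big_nil /lin !mul0r addr0.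
have [_ h1] := hv x.
under eq_bigr => k _.
  have -> : Ex X (fun a b => lin u1 u2 (a + k * x1 x) (b + k * x2 x)) =
     Ex X (lin u1 u2) + k%:R * dotx u1 u2 x.
    by rewrite -[X in _ + X](Ex_cst X) -ExD; apply: eq_Ex => a b; exact: lin_shift.
  rewrite mulrDr mulrA. over.
by rewrite big_split/= -!mulr_suml h1 mul1r IH big_cons addrC.
Qed.

Lemma lvarE x : lvar (v x) n = \sum_(k < n) v x k * k%:R ^+ 2 - lmean (v x) n ^+ 2.
Proof.
have [_ h1] := hv x.
have E (m : R) : \sum_(k < n) v x k * (k%:R - m) ^+ 2 =
  \sum_(k < n) v x k * k%:R ^+ 2 - 2 * m * (\sum_(k < n) v x k * k%:R)
    + m ^+ 2 * (\sum_(k < n) v x k).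
  rewrite !mulr_sumr -sumrB -big_split/=; apply: eq_bigr => k _; by ring.
by rewrite /lvar E h1 -/(lmean (v x) n); ring.
Qed.

Lemma Ex_var X (u1 u2 : R) :
  Ex X (fun a b => lin u1 u2 a b ^+ 2) - Ex X (lin u1 u2) ^+ 2 =
  \sum_(x <- X) lvar (v x) n * dotx u1 u2 x ^+ 2.
Proof.
elim: X => [|x X IH]; first by rewrite big_nil /= subrr.
have [_ h1] := hv x.
rewrite big_cons -IH Ex_lin big_cons -Ex_lin /= lvarE.
set t := dotx u1 u2 x.
have -> : \sum_(k < n) v x k * Ex X (fun a b => lin u1 u2 (a + k * x1 x) (b + k * x2 x) ^+ 2) =
  \sum_(k < n) v x k * (Ex X (fun a b => lin u1 u2 a b ^+ 2)
    + (2 * (k%:R * t) * Ex X (lin u1 u2) + (k%:R * t) ^+ 2)).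
  apply: eq_bigr => k _; congr (_ * _).
  rewrite -[in RHS]ExZ -[X in _ = _ + (_ + X)](Ex_cst X) -!ExD; apply: eq_Ex => a b.
  by rewrite lin_shift -/t; ring.
set E2 := Ex X _; set E1 := Ex X _.
have -> : \sum_(k < n) v x k * (E2 + (2 * (k%:R * t) * E1 + (k%:R * t) ^+ 2)) =
  E2 * (\sum_(k < n) v x k) + 2 * t * E1 * lmean (v x) n
  + t ^+ 2 * \sum_(k < n) v x k * k%:R ^+ 2.
  rewrite /lmean !mulr_sumr -!big_split/=; apply: eq_bigr => k _; ring.
rewrite h1; ring.
Qed.

(** The entries of the covariance matrix are kept in the form E(ab) - E(a) E(b),
    whose terms pass separately to the limit. *)
Definition covA X : R := Ex X (fun a b => a%:R * a%:R) - Ex X (fun a b => a%:R)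
  * Ex X (fun a b => a%:R).
Definition covB X : R := Ex X (fun a b => a%:R * b%:R) - Ex X (fun a b => a%:R)
  * Ex X (fun a b => b%:R).
Definition covD X : R := Ex X (fun a b => b%:R * b%:R) - Ex X (fun a b => b%:R)
  * Ex X (fun a b => b%:R).

Lemma Ex_linE X u1 u2 :
  Ex X (lin u1 u2) = Ex X (fun a b => a%:R) * u1 + Ex X (fun a b => b%:R) * u2.
Proof.
rewrite [X in X + _]mulrC [X in _ + X]mulrC -!ExZ -ExD; apply: eq_Ex => a b.
by rewrite /lin; ring.
Qed.

(** The covariance form at u is the variance of the scalar product with u, and
    variances of independent summands add. *)
Lemma qform_cov X u1 u2 : qform (covA X) (covB X) (covD X) u1 u2 =
  \sum_(x <- X) lvar (v x) n * dotx u1 u2 x ^+ 2.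
Proof.
rewrite -Ex_var Ex_linE.
have -> : Ex X (fun a b => lin u1 u2 a b ^+ 2) =
  u1 ^+ 2 * Ex X (fun a b => a%:R * a%:R) + 2 * u1 * u2 * Ex X (fun a b => a%:R * b%:R)
  + u2 ^+ 2 * Ex X (fun a b => b%:R * b%:R).
  by rewrite -!ExZ -!ExD; apply: eq_Ex => a b; rewrite /lin; ring.
by rewrite /qform /covA /covB /covD; ring.
Qed.

End finite_law.

Section Ex_cos_gauss_le.
Variables (R : realType) (T : Type) (x1 x2 : T -> nat) (v : T -> nat -> R).
Variable n : nat.
Hypothesis hv : forall x, is_law (v x) n.+2.
Implicit Types (X : seq T).
Local Notation Ex := (Ex x1 x2 v n.+2).
Local Notation dotx := (dotx x1 x2).

(** Exponent of the decay that normc_charf_le guarantees for the characteristic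
    function of the sum at u. *)
Definition damp X (u1 u2 : R) : R :=
  \sum_(x <- X) v x 0%N * v x 1%N * (1 - cos (dotx u1 u2 x)).

(** Dominates the sum of the third absolute moments of the summands. *)
Definition rho3 X : R := \sum_(x <- X) mom3 (v x) n.+2 * (x1 x + x2 x)%:R ^+ 3.

Lemma v0v1_le1 x : v x 0%N * v x 1%N <= 1.
Proof.
have [h0 h1] := hv x.
have := @sum_ord2_le _ (v x) n (v x) h0; rewrite h1 => h.
have a0 := h0 0%N; have a1 := h0 1%N; nra.
Qed.

(** Besides giving the decay of the Gaussian, this bounds the covariance form
    from below by twice the decay exponent. *)
Lemma expR_qform_damp X u1 u2 :
  expR (- (qform (covA x1 x2 v n.+2 X) (covB x1 x2 v n.+2 X) (covD x1 x2 v n.+2 X) u1 u2 / 2))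
  <= expR (- damp X u1 u2).
Proof.
rewrite qform_cov// ler_expR lerN2 mulr_suml /damp; apply: ler_sum => x _.
by have := gauss_factor_le (dotx u1 u2 x) (hv x); rewrite ler_expR lerN2.
Qed.

(** Both terms are real parts of products over the summands: charf_gauss
    compares the factors and prod_compare the products. The constant 2 bounds a
    single decay exponent. *)
Lemma Ex_cos_gauss_le X (u1 u2 m1 m2 : R) :
  `|Ex X (fun a b => cos (u1 * (a%:R - m1) + u2 * (b%:R - m2)))
    - cos (u1 * (Ex X (fun a b => a%:R) - m1) + u2 * (Ex X (fun a b => b%:R) - m2)) *
      expR (- (qform (covA x1 x2 v n.+2 X) (covB x1 x2 v n.+2 X) (covD x1 x2 v n.+2 X) u1 u2
        / 2))|
  <= 6 * expR 2 * rho3 X * (`|u1| + `|u2|) ^+ 3 * expR (- damp X u1 u2).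
Proof.
set b := - (u1 * m1 + u2 * m2).
have -> : Ex X (fun a b => cos (u1 * (a%:R - m1) + u2 * (b%:R - m2))) =
   complex.Re (cis b * \prod_(x <- X) charf (v x) n.+2 (dotx u1 u2 x)).
  by rewrite -Ex_cis; apply: eq_Ex => p q; congr cos; rewrite /lin /b; ring.
pose g x : R[i] := (expR (- (lvar (v x) n.+2 * dotx u1 u2 x ^+ 2 / 2)))%:C%C
   * cis (lmean (v x) n.+2 * dotx u1 u2 x).
have -> : cos (u1 * (Ex X (fun a b => a%:R) - m1) + u2 * (Ex X (fun a b => b%:R) - m2)) *
      expR (- (qform (covA x1 x2 v n.+2 X) (covB x1 x2 v n.+2 X) (covD x1 x2 v n.+2 X) u1 u2
        / 2)) =
   complex.Re (cis b * \prod_(x <- X) g x).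
  have -> : \prod_(x <- X) g x =
     (expR (- (\sum_(x <- X) lvar (v x) n.+2 * dotx u1 u2 x ^+ 2 / 2)))%:C%C *
     cis (\sum_(x <- X) lmean (v x) n.+2 * dotx u1 u2 x).
    elim: X => [|x X IH]; first by rewrite !big_nil oppr0 expR0 cis0 mulr1.
    by rewrite !big_cons IH opprD expRD cisD /g rmorphM/=; ring.
  rewrite mulrCA -cisD Re_realM -Ex_lin// Ex_linE// qform_cov// -mulr_suml.
  by rewrite mulrC; congr (_ * cos _); rewrite /b; ring.
rewrite -raddfB -mulrBr; apply: (le_trans (Re_le_normc _)).
rewrite normcM normc_cis mul1r.
have h1 x : normc (charf (v x) n.+2 (dotx u1 u2 x)) <=
    expR (- (v x 0%N * v x 1%N * (1 - cos (dotx u1 u2 x)))) by exact: normc_charf_le.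
have h2 x : normc (g x) <= expR (- (v x 0%N * v x 1%N * (1 - cos (dotx u1 u2 x)))).
  rewrite normcM normc_cis mulr1 normc_real ger0_norm ?expR_ge0//.
  exact: gauss_factor_le.
have h3 x : v x 0%N * v x 1%N * (1 - cos (dotx u1 u2 x)) <= 2.
  have c1 := cos_geN1 (dotx u1 u2 x); have c2 := cos_le1 (dotx u1 u2 x).
  have := v0v1_le1 x; have [h0 _] := hv x.
  have : 0 <= v x 0%N * v x 1%N by rewrite mulr_ge0.
  set w := v x 0%N * v x 1%N; nra.
apply: (le_trans (prod_compare X h1 h2 h3)).
rewrite -/(damp X u1 u2) ler_wpM2r ?expR_ge0//.
have -> : 6 * expR 2 * rho3 X * (`|u1| + `|u2|) ^+ 3 = expR 2 * (6 * (rho3 X * (`|u1|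
  + `|u2|) ^+ 3)) by ring.
rewrite ler_wpM2l ?expR_ge0// /rho3 mulr_suml mulr_sumr; apply: ler_sum => x _.
apply: (le_trans (charf_gauss (dotx u1 u2 x) (hv x))).
rewrite -[leLHS]mulrA ler_wpM2l// -[leRHS]mulrA ler_wpM2l//.
  by apply: sumr_ge0 => k _; have [h0 _] := hv x; rewrite mulr_ge0// exprn_ge0.
rewrite -exprMn lerXn2r ?nnegrE ?mulr_ge0 ?addr_ge0//.
rewrite /dotx; apply: (le_trans (ler_normD _ _)); rewrite !normrM !normr_nat natrD.
have a1 := normr_ge0 u1; have a2 := normr_ge0 u2.
have b1 : 0 <= (x1 x)%:R :> R by []. have b2 : 0 <= (x2 x)%:R :> R by [].
have := mulr_ge0 b1 a2; have := mulr_ge0 b2 a1; lra.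
Qed.

End Ex_cos_gauss_le.

(** * Local limit theorem for finite sums *)

Section RintEx.
Variables (R : realType) (T : Type) (x1 x2 : T -> nat) (v : T -> nat -> R).
Variable n : nat.
Context d (Om : measurableType d) (mu : {measure set Om -> \bar R}).

Lemma Rintegral_weighted_sum N (f : nat -> Om -> R) (c g : nat -> R) :
  (forall k, mu.-integrable setT (EFin \o f k)) ->
  (forall k, \int[mu]_x f k x = g k) ->
  mu.-integrable setT (EFin \o (fun x => \sum_(k < N) c k * f k x)) /\
  \int[mu]_x (\sum_(k < N) c k * f k x) = \sum_(k < N) c k * g k.
Proof.
move=> fi fg; elim: N => [|N [IH1 IH2]].
  have -> : (fun x => \sum_(k < 0) c k * f k x) = cst (0 : R).
    by apply/funext => x; rewrite big_ord0.
  rewrite big_ord0; split; first exact: integrable0.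
  by rewrite /Rintegral integral0.
have i2 : mu.-integrable setT (EFin \o (fun x => c N * f N x)).
  exact: (integrableZl measurableT (c N) (fi N)).
have -> : (fun x => \sum_(k < N.+1) c k * f k x) =
  (fun x => \sum_(k < N) c k * f k x + c N * f N x).
  by apply/funext => x; rewrite big_ord_recr.
split; first exact: (integrableD measurableT IH1 i2).
by rewrite RintegralD// IH2 RintegralZl// fg big_ord_recr.
Qed.

Lemma Rintegral_Ex X (G : nat -> nat -> Om -> R) (g : nat -> nat -> R) :
  (forall a b, mu.-integrable setT (EFin \o G a b)) ->
  (forall a b, \int[mu]_x G a b x = g a b) ->
  mu.-integrable setT (EFin \o (fun x => Ex x1 x2 v n X (fun a b => G a b x))) /\
  \int[mu]_x Ex x1 x2 v n X (fun a b => G a b x) = Ex x1 x2 v n X g.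
Proof.
elim: X G g => [|x X IH] G g iG hG /=; first by split.
pose H (k : nat) (y : Om) := Ex x1 x2 v n X (fun a b => G (a + k * x1 x)%N (b + k * x2 x)%N y).
pose h (k : nat) := Ex x1 x2 v n X (fun a b => g (a + k * x1 x)%N (b + k * x2 x)%N).
have hH k := IH (fun a b => G (a + k * x1 x)%N (b + k * x2 x)%N)
   (fun a b => g (a + k * x1 x)%N (b + k * x2 x)%N) (fun _ _ => iG _ _) (fun _ _ => hG _ _).
exact: (@Rintegral_weighted_sum n H (v x) h (fun k => (hH k).1) (fun k => (hH k).2)).
Qed.
End RintEx.

Section bounds.
Variable R : realType.

(** Turns the decay exp(- c L^2) away from the origin into the power L^-10. *)
Lemma expRN_pow5 (c x : R) : 0 < c -> 0 < x ->
  expR (- (c * x)) <= 120 / c ^+ 5 / x ^+ 5.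
Proof.
move=> c0 x0; have cx : 0 <= c * x by rewrite mulr_ge0// ltW.
have := expR_ge1Dxn 4 cx; rewrite (_ : 5`! = 120)%N// => h.
rewrite expRN -mulrA -invfM -exprMn -[leRHS]invf_div lef_pV2 ?posrE ?expR_gt0//; last first.
  by rewrite divr_gt0// exprn_gt0// mulr_gt0.
lra.
Qed.

(** Trades the cubic factor of Ex_cos_gauss_le for half of the available
    Gaussian decay. *)
Lemma cube_le_expR (c y : R) : 0 < c -> 0 <= y ->
  y ^+ 3 <= (1 + 32 / c ^+ 2) * expR (c * y ^+ 2 / 4).
Proof.
move=> c0 y0.
have cy : 0 <= c * y ^+ 2 / 4 by rewrite divr_ge0// mulr_ge0 ?sqr_ge0// ltW.
have := expR_ge1Dxn 1 cy; rewrite (_ : 2`! = 2)%N// => h.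
have h1 : y ^+ 3 <= 1 + y ^+ 4.
  have [y1|y1] := leP y 1.
    have : y ^+ 3 <= 1 by rewrite exprn_ile1.
    have : 0 <= y ^+ 4 by rewrite exprn_ge0.
    lra.
  have : y ^+ 3 <= y ^+ 4 by rewrite ler_weXn2l// ltW.
  lra.
have h2 : y ^+ 4 = 32 / c ^+ 2 * ((c * y ^+ 2 / 4) ^+ 2 / 2) by field; lra.
have h3 : 0 < 32 / c ^+ 2 by rewrite divr_gt0// exprn_gt0.
have h4 : 1 <= expR (c * y ^+ 2 / 4) by rewrite -[leLHS]expR0 ler_expR.
have h5 : y ^+ 4 <= 32 / c ^+ 2 * expR (c * y ^+ 2 / 4).
  by rewrite h2 ler_wpM2l ?ltW//; lra.
lra.
Qed.
End bounds.

Section core.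
Variables (R : realType) (T : Type) (x1 x2 : T -> nat) (v : T -> nat -> R).
Variables (n : nat) (X : seq T) (c C L : R).
Local Notation mu := (@lebesgue_measure R).
Local Notation mu2 := (mu \x mu)%E.
Hypothesis hv : forall x, is_law (v x) n.+2.
Hypotheses (c0 : 0 < c) (C0 : 0 <= C) (L1 : 1 <= L).
Hypothesis hdamp : forall u1 u2, `|u1| <= pi -> `|u2| <= pi ->
  c * L ^+ 2 * Num.min 1 (L ^+ 2 * (u1 ^+ 2 + u2 ^+ 2)) <= damp x1 x2 v X u1 u2.
Hypothesis hrho : rho3 x1 x2 v n X <= C * L ^+ 5.
Local Notation E := (Ex x1 x2 v n.+2 X).
Local Notation A := (covA x1 x2 v n.+2 X).
Local Notation B := (covB x1 x2 v n.+2 X).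
Local Notation D := (covD x1 x2 v n.+2 X).

Let L0 : 0 < L. Proof. by rewrite (lt_le_trans ltr01). Qed.

(** The form is at least twice the decay exponent by expR_qform_damp; being
    homogeneous, it may be evaluated at a multiple of u so small that the
    minimum in the hypothesis is its quadratic entry. *)
Lemma qform_ge u1 u2 : 2 * c * L ^+ 4 * (u1 ^+ 2 + u2 ^+ 2) <= qform A B D u1 u2.
Proof.
set r := u1 ^+ 2 + u2 ^+ 2.
have r0 : 0 <= r by rewrite addr_ge0 ?sqr_ge0.
(* scaling the direction into the range where the minimum is the quadratic term *)
pose t := (L * (1 + r))^-1.
have Lr : 0 < L * (1 + r) by rewrite mulr_gt0//; lra.
have t0 : 0 < t by rewrite invr_gt0.
have t1 : L * t * (1 + r) = 1 by rewrite mulrAC divff ?gt_eqF.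
have tu (u w : R) : r = u ^+ 2 + w ^+ 2 -> `|t * u| <= pi.
  move=> rE; have p2 := pi_ge2 R; have w0 := sqr_ge0 w.
  have hu : `|u| <= 1 + r.
    rewrite rE -(real_normK (num_real u)); have := sqr_ge0 (`|u| - 1); have := sqr_ge0 `|u|;
      lra.
  have ht : t * (1 + r) <= 1.
    rewrite -[leRHS]t1 -[leRHS]mulrA ler_peMl//; by rewrite mulr_ge0 ?ltW//; lra.
  rewrite normrM gtr0_norm//; have := ler_wpM2l (ltW t0) hu; lra.
have := hdamp (tu u1 u2 erefl) (tu u2 u1 (addrC _ _)).
have hr2 : L ^+ 2 * ((t * u1) ^+ 2 + (t * u2) ^+ 2) = (L * t) ^+ 2 * r by rewrite /r; ring.
have lt0 : 0 < L * t by rewrite mulr_gt0.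
have hle : (L * t) ^+ 2 * r <= 1.
  have -> : (1 : R) = (L * t * (1 + r)) ^+ 2 by rewrite t1 expr1n.
  rewrite [leRHS]exprMn ler_wpM2l ?sqr_ge0//; nra.
rewrite hr2 (min_idPr hle) => h1.
have := expR_qform_damp x1 x2 hv X (t * u1) (t * u2).
rewrite ler_expR lerN2 => h2.
have h3 : qform A B D (t * u1) (t * u2) = t ^+ 2 * qform A B D u1 u2 by rewrite /qform; ring.
rewrite h3 in h2.
have tt : 0 < t ^+ 2 by rewrite exprn_gt0.
rewrite -(ler_pM2l tt).
have -> : t ^+ 2 * (2 * c * L ^+ 4 * r) = 2 * (c * L ^+ 2 * ((L * t) ^+ 2 * r)) by ring.
lra.
Qed.

Lemma covA_ge : 2 * c * L ^+ 4 <= A.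
Proof. by have := qform_ge 1 0; rewrite /qform expr1n expr0n/= !mulr0 !addr0 !mulr1. Qed.

Let cL : 0 < 2 * c * L ^+ 4. Proof. by rewrite !mulr_gt0// exprn_gt0. Qed.

Lemma covA_gt0 : 0 < A.
Proof. exact: lt_le_trans covA_ge. Qed.

(** At the vector (- B, A) the form equals A times the determinant, and the
    square of the length of that vector is at least A^2. *)
Lemma det_ge : (2 * c * L ^+ 4) ^+ 2 <= A * D - B ^+ 2.
Proof.
have h := qform_ge (- B) A; have hA := covA_ge.
have hq : qform A B D (- B) A = A * (A * D - B ^+ 2) by rewrite /qform; ring.
have h1 : A * (2 * c * L ^+ 4 * A) <= A * (A * D - B ^+ 2).
  rewrite -hq (le_trans _ h)//.
  have -> : A * (2 * c * L ^+ 4 * A) = 2 * c * L ^+ 4 * A ^+ 2 by ring.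
  by rewrite ler_wpM2l ?(ltW cL)// lerDr sqr_ge0.
rewrite (ler_pM2l covA_gt0) in h1; apply: le_trans h1.
by rewrite expr2 ler_wpM2l// ltW.
Qed.

Lemma det_gt0 : 0 < A * D - B ^+ 2.
Proof. by apply: lt_le_trans det_ge; rewrite exprn_gt0. Qed.

(** One term for each part of the majorant of the integrand: the Gaussian part,
    which also covers the tail outside the square, and the constant part on the
    square. *)
Definition llt_const : R :=
  (6 * expR 2 * C * (1 + 32 / c ^+ 2) + 2 / c) * (2 * pi / c) +
  6 * expR 2 * C * 512 * (120 / c ^+ 5) * (2 * pi) ^+ 2.

(** Density of the centred normal law with covariance matrix ((A, B), (B, D)),
    the inverse of the matrix being written out. *)
Definition gauss2 (A B D y1 y2 : R) : R :=
  (2 * pi)^-1 * (Num.sqrt (A * D - B ^+ 2))^-1 *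
  expR (- (qform D (- B) A y1 y2 / (A * D - B ^+ 2) / 2)).

Variables m1 m2 : nat.

(** Difference of the two inversion integrands. *)
Let F (l : R * R) : R :=
  box l * E (fun a b => cos (l.1 * (a%:R - m1%:R) + l.2 * (b%:R - m2%:R)))
  - cos (l.1 * (E (fun a b => a%:R) - m1%:R) + l.2 * (E (fun a b => b%:R) - m2%:R)) *
    expR (- (qform A B D l.1 l.2 / 2)).

Let s := c * L ^+ 4.
Let s0 : 0 < s. Proof. by rewrite mulr_gt0// exprn_gt0. Qed.

Let gauss_split (l : R * R) : expR (- (c * L ^+ 4 * (l.1 ^+ 2 + l.2 ^+ 2))) =
   expR (- (c * L ^+ 4 * (l.1 ^+ 2 + l.2 ^+ 2) / 2)) * (gaussw s 0 l.1 * gaussw s 0 l.2).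
Proof.
by rewrite /gaussw -!expRD /s; congr expR; field.
Qed.

(** Inside the square the minimum in the lower bound on damp decides. Near the
    origin L^5 |u|^3 exp(- c L^4 |u|^2) is at most a multiple of 1 / L times a
    Gaussian of width L^-2; elsewhere L^5 exp(- c L^2) is O(L^-5). Outside the
    square only the Gaussian term is left, and |u| >= 1. *)
Let F_bound l : `|F l| <=
  (6 * expR 2 * C * (1 + 32 / c ^+ 2) + 2 / c) / L * (gaussw s 0 l.1 * gaussw s 0 l.2)
  + 6 * expR 2 * C * 512 * (120 / c ^+ 5) / L ^+ 5 * box l.
Proof.
have W0 : 0 <= gaussw s 0 l.1 * gaussw s 0 l.2 by rewrite mulr_ge0 ?expR_ge0.
set W := gaussw s 0 l.1 * gaussw s 0 l.2 in W0 *.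
have K1 : 0 <= 6 * expR 2 * C * (1 + 32 / c ^+ 2).
  by rewrite !mulr_ge0 ?expR_ge0// addr_ge0// divr_ge0// exprn_ge0 ?ltW.
have K2 : 0 <= 2 / c by rewrite divr_ge0// ltW.
set r := l.1 ^+ 2 + l.2 ^+ 2.
have r0 : 0 <= r by rewrite addr_ge0 ?sqr_ge0.
have L20 : 0 < L ^+ 2 by rewrite exprn_gt0.
have L40 : 0 < L ^+ 4 by rewrite exprn_gt0.
have L50 : 0 < L ^+ 5 by rewrite exprn_gt0.
have [hb|hb] := boolP ((`|l.1| <= pi) && (`|l.2| <= pi)).
  have bl : box l = 1.
    move/andP: hb => [hb1 hb2]; rewrite /box /box1 !indicE !mem_set ?mulr1//=.
    - by rewrite in_itv/= -ler_norml.
    - by rewrite in_itv/= -ler_norml.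
  move/andP: hb => [hb1 hb2].
  rewrite /F bl mul1r mulr1.
  apply: (le_trans (Ex_cos_gauss_le x1 x2 hv X l.1 l.2 m1%:R m2%:R)).
  set S := `|l.1| + `|l.2|.
  have S0 : 0 <= S by rewrite addr_ge0.
  have S8 : S <= 8.
    have := pihalf_lt2 R; rewrite /S; lra.
  have Sr : S ^+ 2 <= 2 * r.
    rewrite /S /r -(real_normK (num_real l.1)) -(real_normK (num_real l.2)).
    have := sqr_ge0 (`|l.1| - `|l.2|); lra.
  have hexp : expR (- damp x1 x2 v X l.1 l.2) <=
     120 / c ^+ 5 / (L ^+ 2) ^+ 5 + expR (- (c * L ^+ 4 * r)).
    have := hdamp hb1 hb2; rewrite -/r; case: (leP 1 (L ^+ 2 * r)) => _ h.
      rewrite -[leLHS]addr0; apply: lerD; last exact: expR_ge0.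
      rewrite mulr1 in h; apply: (le_trans _ (expRN_pow5 c0 L20)).
      by rewrite ler_expR lerN2.
    rewrite -[leLHS]add0r; apply: lerD.
      by rewrite !divr_ge0// exprn_ge0// ltW.
    rewrite ler_expR lerN2; apply: le_trans h.
    by have -> : c * L ^+ 2 * (L ^+ 2 * r) = c * L ^+ 4 * r by ring.
  have S3 : 0 <= S ^+ 3 by rewrite exprn_ge0.
  have hS3 : S ^+ 3 <= 512.
    have -> : (512 : R) = 8 ^+ 3 by ring.
    by rewrite lerXn2r ?nnegrE.
  apply: (@le_trans _ _ (6 * expR 2 * (C * L ^+ 5) * S ^+ 3 *
     (120 / c ^+ 5 / (L ^+ 2) ^+ 5 + expR (- (c * L ^+ 4 * r))))).
    apply: ler_pM => //.
    - rewrite !mulr_ge0 ?expR_ge0//; apply: sumr_ge0 => x _.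
      rewrite mulr_ge0 ?exprn_ge0//; apply: sumr_ge0 => k _.
      by have [h0 _] := hv x; rewrite mulr_ge0 ?exprn_ge0.
    - by rewrite ler_wpM2r// ler_wpM2l// mulr_ge0 ?expR_ge0.
  rewrite mulrDr addrC; apply: lerD.
    have hy : (L ^+ 2 * S) ^+ 3 * expR (- (c * L ^+ 4 * r / 2)) <= 1 + 32 / c ^+ 2.
      have Y0 : 0 <= L ^+ 2 * S by rewrite mulr_ge0 ?(ltW L20).
      rewrite expRN ler_pdivrMr ?expR_gt0//.
      apply: (le_trans (cube_le_expR c0 Y0)); rewrite ler_wpM2l//.
        by rewrite addr_ge0// divr_ge0// exprn_ge0 ?ltW.
      rewrite ler_expR.
      have -> : c * (L ^+ 2 * S) ^+ 2 / 4 = c * L ^+ 4 / 4 * S ^+ 2 by field.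
      have -> : c * L ^+ 4 * r / 2 = c * L ^+ 4 / 4 * (2 * r) by field.
      by rewrite ler_wpM2l// divr_ge0// mulr_ge0 ?ltW.
    have -> : 6 * expR 2 * (C * L ^+ 5) * S ^+ 3 * expR (- (c * L ^+ 4 * r)) =
      6 * expR 2 * C * ((L ^+ 2 * S) ^+ 3 * expR (- (c * L ^+ 4 * r / 2))) / L * W.
      by rewrite gauss_split -/r -/W; field; rewrite gt_eqF.
    apply: ler_wpM2r => //; apply: ler_wpM2r; first by rewrite invr_ge0 ltW.
    apply: (@le_trans _ _ (6 * expR 2 * C * (1 + 32 / c ^+ 2))); last by rewrite lerDl.
    by apply: ler_wpM2l => //; rewrite !mulr_ge0 ?expR_ge0.
  have -> : 6 * expR 2 * (C * L ^+ 5) * S ^+ 3 * (120 / c ^+ 5 / (L ^+ 2) ^+ 5) =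
    6 * expR 2 * C * S ^+ 3 * (120 / c ^+ 5) / L ^+ 5.
    by field; rewrite !gt_eqF.
  apply: ler_wpM2r; first by rewrite invr_ge0 ltW.
  apply: ler_wpM2r; first by rewrite divr_ge0// exprn_ge0// ltW.
  by apply: ler_wpM2l => //; rewrite !mulr_ge0 ?expR_ge0.
have bl : box l = 0.
  move: hb; rewrite negb_and /box /box1 !indicE.
  case/orP => h.
    have -> : (l.1 \in `[(- pi)%R, pi]%classic) = false.
      by apply/negbTE/negP; rewrite inE/= in_itv/= -ler_norml (negbTE h).
    by rewrite mul0r.
  have -> : (l.2 \in `[(- pi)%R, pi]%classic) = false.
    by apply/negbTE/negP; rewrite inE/= in_itv/= -ler_norml (negbTE h).
  by rewrite mulr0.
rewrite /F bl mul0r sub0r normrN mulr0 addr0 normrM.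
have r1 : 1 <= r.
  have p1 : 1 <= pi :> R by have := pi_ge2 R; lra.
  have h (u : R) : ~~ (`|u| <= pi) -> 1 <= u ^+ 2.
    rewrite -ltNge => hu; rewrite -(real_normK (num_real u)) -[leLHS](expr1n _ 2).
    by rewrite lerXn2r ?nnegrE// ltW// (le_lt_trans p1).
  have := sqr_ge0 l.1; have := sqr_ge0 l.2.
  by move: hb; rewrite negb_and => /orP[/h|/h]; rewrite /r; lra.
apply: (@le_trans _ _ (expR (- (c * L ^+ 4 * r)))).
  rewrite -[leRHS]mul1r ler_pM ?cos_max// [leLHS]ger0_norm ?expR_ge0//.
  rewrite ler_expR lerN2; have := qform_ge l.1 l.2; rewrite -/r; lra.
rewrite gauss_split -/r -/W ler_wpM2r//.
apply: (@le_trans _ _ (2 / c / L)); last first.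
  by apply: ler_wpM2r; [rewrite invr_ge0 ltW|rewrite lerDr].
have hL : L <= L ^+ 4 * r.
  rewrite -[leLHS]mulr1; apply: ler_pM => //; first exact: ltW.
  by rewrite -[leLHS]expr1 ler_weXn2l.
have hz : c * L / 2 <= c * L ^+ 4 * r / 2.
  by rewrite ler_wpM2r// -mulrA ler_wpM2l// ltW.
have -> : 2 / c / L = (c * L / 2)^-1 by field; rewrite !gt_eqF.
rewrite expRN lef_pV2 ?posrE ?expR_gt0//; last first.
  by rewrite divr_gt0// mulr_gt0.
have := expR_ge1Dx (c * L ^+ 4 * r / 2); lra.
Qed.

(** Integrating F_bound: a Gaussian of width L^-2 has total mass of order L^-4,
    which turns the factor 1 / L into L^-5. *)
Lemma finite_local_limit :
  `|E (fun a b => ((a == m1) && (b == m2))%:R)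
   - gauss2 A B D (m1%:R - E (fun a b => a%:R)) (m2%:R - E (fun a b => b%:R))|
  <= llt_const / (2 * pi) ^+ 2 / L ^+ 5.
Proof.
have p0 : 0 < (pi : R) by exact: pi_gt0.
pose G (a b : nat) (l : R * R) := box l * cos (l.1 * (a%:R - m1%:R) + l.2 * (b%:R - m2%:R)).
pose g (a b : nat) : R := (2 * pi) ^+ 2 * ((a == m1) && (b == m2))%:R.
have iG a b : mu2.-integrable setT (EFin \o G a b) by exact: integrable_box_cos.
have hG a b : \int[mu2]_l G a b l = g a b.
  have := fourier_box R (a%:Z - m1%:Z) (b%:Z - m2%:Z).
  rewrite !rmorphB/= -!pmulrn !subr_eq0 !eqz_nat /G /g => ->.
  by case: (_ && _); rewrite ?mulr1 ?mulr0.
have [iE hE] := Rintegral_Ex x1 x2 v n.+2 X iG hG.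
have iQ := integrable_cos_qform (E (fun a b => a%:R) - m1%:R) (E (fun a b => b%:R) - m2%:R)
  covA_gt0 det_gt0.
have hQ := gauss_fourier2 (E (fun a b => a%:R) - m1%:R) (E (fun a b => b%:R) - m2%:R)
  covA_gt0 det_gt0.
have FE : F = (fun l => E (fun a b => G a b l) -
   cos (l.1 * (E (fun a b => a%:R) - m1%:R) + l.2 * (E (fun a b => b%:R) - m2%:R)) *
    expR (- (qform A B D l.1 l.2 / 2))).
  by apply/funext => l; rewrite /F -ExZ.
have iF : mu2.-integrable setT (EFin \o F).
  by rewrite FE; exact: (integrableB measurableT iE iQ).
have := le_Rintegral_gauss_box s0 iF F_bound.
rewrite {1}FE RintegralB// hE hQ ExZ => h.
have pp : 0 < (2 * pi) ^+ 2 :> R by rewrite exprn_gt0// mulr_gt0.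
have hK : (6 * expR 2 * C * (1 + 32 / c ^+ 2) + 2 / c) / L * (2 * pi / s) +
   6 * expR 2 * C * 512 * (120 / c ^+ 5) / L ^+ 5 * (2 * pi) ^+ 2 = llt_const / L ^+ 5.
  by rewrite /llt_const /s; field; rewrite !gt_eqF.
rewrite hK in h.
rewrite -(ler_pM2l pp).
have -> : (2 * pi) ^+ 2 * (llt_const / (2 * pi) ^+ 2 / L ^+ 5) = llt_const / L ^+ 5.
  by rewrite [llt_const / _ / _]mulrAC [LHS]mulrCA divff ?mulr1// gt_eqF.
apply: le_trans h.
rewrite -{1}(gtr0_norm pp) -normrM mulrBr /gauss2.
have dd : 0 < Num.sqrt (A * D - B ^+ 2) by rewrite sqrtr_gt0 det_gt0.
have -> : qform D (- B) A (m1%:R - E (fun a b => a%:R)) (m2%:R - E (fun a b => b%:R)) =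
  qform D (- B) A (E (fun a b => a%:R) - m1%:R) (E (fun a b => b%:R) - m2%:R).
  by rewrite /qform; ring.
rewrite le_eqVlt; apply/orP; left; apply/eqP; congr (`| _ - _|).
have cancel (P S e : R) : P != 0 -> P * S * e = P ^+ 2 * (P^-1 * S * e) by move=> P0; field.
by apply: esym; apply: cancel; rewrite gt_eqF// mulr_gt0.

Qed.

End core.

(** * Pairs of points along a row *)

Section rows.
Variable R : realType.

(** Two angles close to 0 modulo 2 pi have a difference close to 0 modulo 2 pi.
    *)
Lemma one_sub_cos_pair (p q : R) :
  (1 - cos (p - q)) / 2 <= (1 - cos p) + (1 - cos q).
Proof.
rewrite cosB; have hp := cos2Dsin2 p; have hq := cos2Dsin2 q.
have h1 := sqr_ge0 (sin p + sin q); have h2 := sqr_ge0 (cos p + cos q - 2).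
nra.
Qed.

Lemma sum_ord_le_widen (m N : nat) (F : nat -> R) : (m <= N)%N ->
  (forall i, 0 <= F i) -> \sum_(i < m) F i <= \sum_(i < N) F i.
Proof.
move=> mN F0; rewrite -(subnKC mN) big_split_ord/= lerDl.
by apply: sumr_ge0.
Qed.

Lemma sum_ord_shift_le (k N : nat) (F : nat -> R) :
  (forall i, 0 <= F i) -> \sum_(i < N) F (k + i)%N <= \sum_(i < k + N) F i.
Proof.
by move=> F0; rewrite big_split_ord/= lerDr; apply: sumr_ge0.
Qed.

(** A set s that fills more than half of a row contains many pairs (i, k + i),
    and by one_sub_cos_pair each of them contributes an amount that does not
    depend on the phase b. *)
Lemma row_pairing (L k : nat) (s : nat -> bool) (t b : R) : (k <= L)%N ->
  (1 - cos (k%:R * t)) / 4 * (2 * (\sum_(i < L) (s i)%:R) - L%:R - k%:R) <=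
  \sum_(i < L) (s i)%:R * (1 - cos (i%:R * t + b)).
Proof.
move=> kL; set S := \sum_(i < L) _; set d := 1 - cos _.
have d0 : 0 <= d by rewrite subr_ge0 cos_le1.
pose f i : R := (s i)%:R * (1 - cos (i%:R * t + b)).
have f0 i : 0 <= f i by rewrite mulr_ge0// subr_ge0 cos_le1.
have h1 : \sum_(i < L - k) f i <= \sum_(i < L) f i.
  by apply: sum_ord_le_widen => //; exact: leq_subr.
have h2 : \sum_(i < L - k) f (k + i)%N <= \sum_(i < L) f i.
  by have := sum_ord_shift_le k (L - k) f0; rewrite subnKC.
have h3 : \sum_(i < L - k) ((s i)%:R + (s (k + i)%N)%:R - 1) * (d / 2) <=
    \sum_(i < L - k) f i + \sum_(i < L - k) f (k + i)%N.
  rewrite -big_split/=; apply: ler_sum => i _; rewrite /f.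
  have := one_sub_cos_pair ((k + i)%:R * t + b) (i%:R * t + b).
  have -> : (k + i)%:R * t + b - (i%:R * t + b) = k%:R * t by rewrite natrD; ring.
  rewrite -/d.
  have := cos_le1 ((k + i)%:R * t + b); have := cos_le1 (i%:R * t + b).
  by case: (s i); case: (s (k + i)%N) => /=; lra.
have h4 : 2 * S - L%:R - k%:R <= \sum_(i < L - k) ((s i)%:R + (s (k + i)%N)%:R - 1).
  rewrite sumrB big_split/= sumr_const card_ord natrB//.
  have g1 : S - k%:R <= \sum_(i < L - k) (s i)%:R.
    rewrite lerBlDr /S -[in X in X <= _](subnK kL) big_split_ord/= lerD2l.
    apply: (@le_trans _ _ (\sum_(i < k) 1)); last by rewrite sumr_const card_ord.
    by apply: ler_sum => i _; case: (s _).
  have g2 : S - k%:R <= \sum_(i < L - k) (s (k + i)%N)%:R.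
    rewrite lerBlDr /S -[in X in X <= _](subnKC kL) big_split_ord/= addrC lerD2l.
    apply: (@le_trans _ _ (\sum_(i < k) 1)); last by rewrite sumr_const card_ord.
    by apply: ler_sum => i _; case: (s _).
  lra.
rewrite -mulr_suml in h3.
have h5 := ler_wpM2r (divr_ge0 d0 (ler0n R 2)) h4.
rewrite -/(f _); lra.
Qed.

Lemma one_sub_cos_ge (t : R) : `|t| <= 1 / 4 -> t ^+ 2 / 4 <= 1 - cos t.
Proof.
move=> t1; have := cos_taylor2 t; rewrite ler_norml => /andP[_ h].
have e : t ^+ 2 = `|t| ^+ 2 by rewrite real_normK// num_real.
have : `|t| ^+ 3 <= t ^+ 2 / 4.
  rewrite exprS e mulrC; have := sqr_ge0 `|t|; nra.
lra.
Qed.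

(** If K |t| <= 1 / 4 for the largest admissible K, then K works by the
    quadratic lower bound for 1 - cos. Otherwise |t| itself is at least 1 / 8,
    or some multiple k |t| with k <= K falls into [1 / 8, 1 / 4]. *)
Lemma exists_multiplier (L : nat) (t : R) : (96 <= L)%N -> `|t| <= pi ->
  exists k : nat, [/\ (96 * k <= L)%N &
    Num.min 1 (L%:R ^+ 2 * t ^+ 2) / 384 ^+ 2 <= 1 - cos (k%:R * t)].
Proof.
move=> L96 tpi; set K := (L %/ 96)%N.
have K1 : (1 <= K)%N by rewrite divn_gt0.
have KL : (96 * K <= L)%N by rewrite mulnC leq_trunc_div.
have KL2 : L%:R <= 192 * K%:R :> R.
  have : (L <= 192 * K)%N.
    have := ltn_ceil L (isT : (0 < 96)%N); rewrite -/K; lia.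
  by rewrite -(ler_nat R) natrM.
have cosn (k : nat) : cos (k%:R * t) = cos (k%:R * `|t|) :> R.
  by rewrite -[LHS]cos_norm normrM normr_nat.
have t0 := normr_ge0 t.
have mid (x : R) : 1 / 8 <= x <= pi -> 1 / 256 <= 1 - cos x.
  move=> /andP[x1 x2].
  have h8 : (1 / 8 : R) ^+ 2 / 4 <= 1 - cos (1 / 8) by apply: one_sub_cos_ge;
    rewrite ger0_norm; lra.
  have : cos x <= cos (1 / 8).
    move: x1; rewrite le_eqVlt => /predU1P[->//|x1].
    have p2 := pi_ge2 R.
    have i1 : (1 / 8 : R) \in `[0, pi] by rewrite in_itv/=; apply/andP; split; lra.
    have i2 : x \in `[0, pi] by rewrite in_itv/=; apply/andP; split; lra.
    by rewrite ltW// ltr_cos.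
  lra.
have minle1 : Num.min 1 (L%:R ^+ 2 * t ^+ 2) <= 1 by rewrite ge_min lexx.
have minle2 : Num.min 1 (L%:R ^+ 2 * t ^+ 2) <= L%:R ^+ 2 * t ^+ 2 by rewrite ge_min lexx orbT.
have [h|h] := leP (K%:R * `|t|) (1 / 4).
  exists K; split => //.
  have hK : `|K%:R * t| <= 1 / 4 by rewrite normrM normr_nat.
  apply: le_trans (one_sub_cos_ge hK).
  have : L%:R ^+ 2 * t ^+ 2 <= 192 ^+ 2 * (K%:R * t) ^+ 2.
    have -> : 192 ^+ 2 * (K%:R * t) ^+ 2 = (192 * K%:R) ^+ 2 * t ^+ 2 by ring.
    by rewrite ler_wpM2r ?sqr_ge0// lerXn2r ?nnegrE.
  lra.
have [h8|h8] := leP (1 / 8) `|t|.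
  exists 1%N; split; first by lia.
  rewrite cosn mul1r; have := mid `|t|; rewrite h8 tpi => /(_ isT); lra.
have tpos : 0 < `|t|.
  rewrite lt_neqAle t0 andbT eq_sym; apply/eqP => tE; move: h; rewrite tE mulr0; lra.
have e0 : 0 <= 1 / 8 / `|t| by rewrite !divr_ge0.
set k := (Num.trunc (1 / 8 / `|t|)).+1.
have /andP[k1 k2] := truncn_itv e0.
rewrite -/k in k2.
have hk1 : 1 / 8 <= k%:R * `|t| by rewrite -ler_pdivrMr// ltW.
have hk2 : k%:R * `|t| <= 1 / 4.
  have : (Num.trunc (1 / 8 / `|t|))%:R * `|t| <= 1 / 8 by rewrite -ler_pdivlMr.
  have kE : k%:R = (Num.trunc (1 / 8 / `|t|))%:R + 1 :> R by rewrite natr1.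
  by rewrite kE mulrDl mul1r; lra.
exists k; split.
  apply: leq_trans KL; rewrite leq_mul2l/=.
  rewrite -(ler_nat R) -(ler_pM2r tpos); lra.
rewrite cosn; have p2 := pi_ge2 R.
have /mid : 1 / 8 <= k%:R * `|t| <= pi by apply/andP; split => //; lra.
lra.
Qed.
End rows.

(** * Density of the coprime points in a square *)

Section count.
Variable R : realType.

Lemma sum_dvdn_le (L d : nat) : (0 < d)%N ->
  \sum_(i < L) (d %| i.+1)%N%:R <= L%:R / d%:R :> R.
Proof.
move=> d0; rewrite -natr_sum.
have -> : (\sum_(i < L) (d %| i.+1)%N = L %/ d)%N.
  by rewrite divn_count_dvd big_add1 big_mkord.
by rewrite ler_pdivlMr ?ltr0n// -natrM ler_nat leq_trunc_div.
Qed.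

Lemma sum_dvdn2_le (L d : nat) : (0 < d)%N ->
  \sum_(i < L) \sum_(j < L) ((d %| i.+1)%N && (d %| j.+1)%N)%:R <= L%:R ^+ 2 / d%:R ^+ 2 :> R.
Proof.
move=> d0; have h := sum_dvdn_le L d0.
have -> : \sum_(i < L) \sum_(j < L) ((d %| i.+1)%N && (d %| j.+1)%N)%:R =
  (\sum_(i < L) (d %| i.+1)%N%:R) * (\sum_(i < L) (d %| i.+1)%N%:R) :> R.
  rewrite mulr_suml; apply: eq_bigr => i _; rewrite mulr_sumr; apply: eq_bigr => j _.
  by case: (d %| i.+1)%N; case: (d %| j.+1)%N; rewrite ?mulr1 ?mulr0.
rewrite -expr_div_n expr2; apply: ler_pM => //; by apply: sumr_ge0.
Qed.

(** Telescoping: 1 / (2 e + 5)^2 is below 1 / ((2 e + 4) (2 e + 6)) = (1 / (e +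
    2) - 1 / (e + 3)) / 4. *)
Lemma sum_odd_inv_sqr (N : nat) :
  \sum_(e < N) ((e.*2 + 5)%N%:R ^+ 2)^-1 <= 1 / 8 :> R.
Proof.
suff h : \sum_(e < N) ((e.*2 + 5)%N%:R ^+ 2)^-1 <= 1 / 8 - (4 * (N%:R + 2))^-1 :> R.
  apply: (le_trans h); rewrite lerBlDr lerDl invr_ge0 mulr_ge0//.
elim: N => [|N IH]; first by rewrite big_ord0 add0r; lra.
rewrite big_ord_recr/=; apply: (le_trans (lerD IH (lexx _))).
rewrite -addrA lerD2l -muln2 natrD natrM -[N.+1%:R]natr1.
have N0 : 0 <= N%:R :> R by [].
have e1 : (4 * (N%:R + 2))^-1 - (4 * (N%:R + 1 + 2))^-1 = (4 * (N%:R + 2) * (N%:R + 3))^-1 :> R.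
  by field; apply/andP; split; lra.
have e2 : ((N%:R * 2 + 5) ^+ 2)^-1 <= (4 * (N%:R + 2) * (N%:R + 3))^-1 :> R.
  rewrite lef_pV2 ?posrE; first by nra.
    by rewrite exprn_gt0//; lra.
  by rewrite !mulr_gt0//; lra.
lra.
Qed.

(** A common prime divisor is 2, 3 or an odd number from 5 on. Counting all odd
    numbers instead of the odd primes keeps the total below 1 / 2. *)
Lemma not_coprime_le (L a b : nat) : (0 < a <= L)%N -> (0 < b)%N ->
  (~~ coprime a b)%:R <= ((2 %| a)%N && (2 %| b)%N)%:R + ((3 %| a)%N && (3 %| b)%N)%:R +
    \sum_(e < L) ((e.*2 + 5 %| a)%N && (e.*2 + 5 %| b)%N)%:R :> R.
Proof.
move=> /andP[a0 aL] b0.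
have S0 : 0 <= \sum_(e < L) ((e.*2 + 5 %| a)%N && (e.*2 + 5 %| b)%N)%:R :> R by apply: sumr_ge0.
have [h|h] := boolP (coprime a b); first by rewrite !addr_ge0.
have g1 : (1 < gcdn a b)%N.
  by rewrite ltn_neqAle gcdn_gt0 a0 andbT eq_sym; exact: h.
set p := pdiv (gcdn a b).
have pp : prime p by exact: pdiv_prime.
have pa : (p %| a)%N := dvdn_trans (pdiv_dvd _) (dvdn_gcdl a b).
have pb : (p %| b)%N := dvdn_trans (pdiv_dvd _) (dvdn_gcdr a b).
have [p2|p2] := eqVneq p 2%N.
  by rewrite p2 in pa pb; rewrite pa pb /= -addrA lerDl addr_ge0.
have [p3|p3] := eqVneq p 3%N.
  by rewrite p3 in pa pb; rewrite pa pb /= addrAC lerDr addr_ge0.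
have p1 := prime_gt1 pp.
have po : odd p.
  by case: (even_prime pp) => // pE; rewrite pE eqxx in p2.
have p4 : p != 4%N by apply/eqP => pE; rewrite pE in po.
have p5 : (5 <= p)%N by lia.
have pE : (((p - 5)./2).*2 + 5 = p)%N.
  have := odd_double_half (p - 5); rewrite oddB// po/= add0n => ->; lia.
have eL : ((p - 5)./2 < L)%N.
  have := dvdn_leq a0 pa; lia.
rewrite (bigD1 (Ordinal eL))//= pE pa pb /=.
rewrite addrCA lerDl !addr_ge0//; by apply: sumr_ge0.
Qed.

(** Union bound over the common divisors: 1 / 4 + 1 / 9 + 1 / 8 = 35 / 72. That
    more than half of the square is left is what row_pairing needs. *)
Lemma coprime_count (L : nat) :
  37 / 72 * L%:R ^+ 2 <= \sum_(i < L) \sum_(j < L) (coprime i.+1 j.+1)%:R :> R.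
Proof.
have h : \sum_(i < L) \sum_(j < L) (~~ coprime i.+1 j.+1)%:R <= 35 / 72 * L%:R ^+ 2 :> R.
  apply: (@le_trans _ _ (\sum_(i < L) \sum_(j < L)
     ((((2 %| i.+1)%N && (2 %| j.+1)%N)%:R + ((3 %| i.+1)%N && (3 %| j.+1)%N)%:R +
    \sum_(e < L) ((e.*2 + 5 %| i.+1)%N && (e.*2 + 5 %| j.+1)%N)%:R)))).
    by apply: ler_sum => i _; apply: ler_sum => j _; apply: not_coprime_le => //=.
  under eq_bigr do rewrite !big_split/=.
  rewrite !big_split/=.
  have h2 := @sum_dvdn2_le L 2 isT; have h3 := @sum_dvdn2_le L 3 isT.
  have h5 : \sum_(i < L) \sum_(j < L) \sum_(e < L) ((e.*2 + 5 %| i.+1)%N && (e.*2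
    + 5 %| j.+1)%N)%:R
     <= L%:R ^+ 2 * (1 / 8) :> R.
    under eq_bigr do rewrite exchange_big/=.
    rewrite exchange_big/=.
    apply: (@le_trans _ _ (\sum_(e < L) L%:R ^+ 2 * ((e.*2 + 5)%N%:R ^+ 2)^-1)).
      by apply: ler_sum => e _; apply: sum_dvdn2_le; rewrite addn_gt0 orbT.
    by rewrite -mulr_sumr ler_wpM2l ?sum_odd_inv_sqr.
  have L2 := sqr_ge0 (L%:R : R).
  lra.
have : \sum_(i < L) \sum_(j < L) (coprime i.+1 j.+1)%:R +
  \sum_(i < L) \sum_(j < L) (~~ coprime i.+1 j.+1)%:R = L%:R ^+ 2 :> R.
  rewrite -big_split/=.
  rewrite (eq_bigr (fun=> L%:R)); last first.
    move=> i _; rewrite -big_split/= (eq_bigr (fun=> 1)).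
      by rewrite sumr_const card_ord.
    by move=> j _; case: (coprime _ _); rewrite ?addr0 ?add0r.
  by rewrite sumr_const card_ord expr2 mulr_natr.
lra.
Qed.

(** The lower bound on the first coordinate keeps z^x away from 1, so that the
    masses of nu(x) at 0 and 1 are bounded below. *)
Definition good_point (L a b : nat) : bool := coprime a b && (L <= 288 * a)%N.

(** The restriction on the first coordinate removes at most a fraction 1 / 288
    of the square, and 37 / 72 - 1 / 288 = 1 / 2 + 1 / 96. *)
Lemma good_point_count (L : nat) :
  (1 / 2 + 1 / 96) * L%:R ^+ 2 <= \sum_(i < L) \sum_(j < L) (good_point L i.+1 j.+1)%:R :> R.
Proof.
have h : \sum_(i < L) \sum_(j < L) (~~ (L <= 288 * i.+1)%N)%:R <= 1 / 288 * L%:R ^+ 2 :> R.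
  have h1 : \sum_(i < L) (~~ (L <= 288 * i.+1)%N)%:R <= L%:R / 288%:R :> R.
    rewrite -natr_sum ler_pdivlMr; last by rewrite ltr0n.
    rewrite -natrM ler_nat.
    have : (\sum_(i < L) ~~ (L <= 288 * i.+1) <= L %/ 288)%N.
      have kL : (L %/ 288 <= L)%N by exact: leq_div.
      suff H N r : N = (L %/ 288 + r)%N ->
          (\sum_(i < N) ~~ (L <= 288 * i.+1) <= L %/ 288)%N.
        by apply: (H L (L - L %/ 288)%N); rewrite subnKC.
      move=> ->; rewrite big_split_ord/= [X in (_ + X)%N]big1 ?addn0.
        apply: (@leq_trans (\sum_(i < L %/ 288) 1)%N); last by rewrite sum1_card card_ord.
        by apply: leq_sum => i _; exact: leq_b1.
      move=> i _; apply/eqP; rewrite eqb0 negbK.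
      have := ltn_ceil L (isT : (0 < 288)%N); nia.
    by move=> hq; apply: leq_trans (leq_trunc_div L 288); rewrite leq_mul2r hq orbT.
  have -> : \sum_(i < L) \sum_(j < L) (~~ (L <= 288 * i.+1)%N)%:R =
     (\sum_(i < L) (~~ (L <= 288 * i.+1)%N)%:R) * L%:R :> R.
    by rewrite mulr_suml; apply: eq_bigr => i _; rewrite sumr_const card_ord mulr_natr.
  have := ler_wpM2r (ler0n R L) h1; lra.
have h2 := coprime_count L.
have : \sum_(i < L) \sum_(j < L) (coprime i.+1 j.+1)%:R <=
  \sum_(i < L) \sum_(j < L) (good_point L i.+1 j.+1)%:R + \sum_(i < L) \sum_(j < L) (~~ (L <=
    288 * i.+1)%N)%:R :> R.
  rewrite -big_split/=; apply: ler_sum => i _; rewrite -big_split/=; apply: ler_sum => j _.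
  rewrite /good_point; case: (coprime _ _) => /=; case: (_ <= _)%N => /=; lra.
lra.
Qed.

(** Apply row_pairing to every row with the multiplier k of exists_multiplier.
    As k <= L / 96, the excess 2 (1 / 2 + 1 / 96) L^2 - L^2 - k L is at least
    L^2 / 96. *)
Lemma dense_set_damp (L : nat) (s : nat -> nat -> bool) (u1 u2 : R) : (96 <= L)%N ->
  (1 / 2 + 1 / 96) * L%:R ^+ 2 <= \sum_(i < L) \sum_(j < L) (s i.+1 j.+1)%:R :> R ->
  `|u1| <= pi ->
  L%:R ^+ 2 / 384 ^+ 3 * Num.min 1 (L%:R ^+ 2 * u1 ^+ 2) <=
  \sum_(i < L) \sum_(j < L) (s i.+1 j.+1)%:R * (1 - cos (i.+1%:R * u1 + j.+1%:R * u2)).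
Proof.
move=> L96 hs hu; have [k [kL hk]] := exists_multiplier L96 hu.
set mn := Num.min _ _ in hk *.
have mn0 : 0 <= mn by rewrite le_min ler01/= mulr_ge0// sqr_ge0.
rewrite exchange_big/=.
have hrow (j : nat) : (1 - cos (k%:R * u1)) / 4 * (2
  * (\sum_(i < L) (s i.+1 j.+1)%:R) - L%:R - k%:R) <=
   \sum_(i < L) (s i.+1 j.+1)%:R * (1 - cos (i.+1%:R * u1 + j.+1%:R * u2)).
  have kL' : (k <= L)%N by lia.
  have := row_pairing (fun i => s i.+1 j.+1) u1 (u1 + j.+1%:R * u2) kL'.
  move=> /le_trans; apply; apply: ler_sum => i _.
  rewrite -[i.+1%:R]natr1 mulrDl mul1r addrA//.
apply: (@le_trans _ _ (\sum_(j < L) (1 - cos (k%:R * u1)) / 4 *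
    (2 * (\sum_(i < L) (s i.+1 j.+1)%:R) - L%:R - k%:R))); last first.
  by apply: ler_sum => j _; exact: hrow.
rewrite -mulr_sumr !sumrB -mulr_sumr exchange_big/= !sumr_const card_ord.
set S := \sum_(_ < _) _ in hs *.
have hk2 : 96 * k%:R <= L%:R :> R by rewrite -natrM ler_nat.
have L0 : 0 <= L%:R :> R by [].
have hA : L%:R ^+ 2 / 96 <= 2 * S - L%:R *+ L - k%:R *+ L.
  rewrite -(mulr_natr L%:R L) -(mulr_natr k%:R L); have := ler_wpM2r L0 hk2; lra.
have mn4 : 0 <= mn / 384 ^+ 2 / 4.
  by apply: divr_ge0; [apply: divr_ge0; [exact: mn0|exact: sqr_ge0]|exact: ler0n].
apply: (@le_trans _ _ (mn / 384 ^+ 2 / 4 * (L%:R ^+ 2 / 96))).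
  by rewrite le_eqVlt; apply/orP; left; apply/eqP; field.
apply: ler_pM => //.
lra.
Qed.

Lemma min1D_le (p q : R) : 0 <= p -> 0 <= q ->
  Num.min 1 (p + q) <= Num.min 1 p + Num.min 1 q.
Proof.
move=> p0 q0.
by case: (leP 1 p) => hp; case: (leP 1 q) => hq; case: (leP 1 (p + q)) => hpq; lra.
Qed.

(** Pairs along rows see only u_1 and pairs along columns only u_2; the two
    bounds are averaged. *)
Lemma good_point_damp (L : nat) (u1 u2 : R) : (96 <= L)%N -> `|u1| <= pi -> `|u2| <= pi ->
  L%:R ^+ 2 / (2 * 384 ^+ 3) * Num.min 1 (L%:R ^+ 2 * (u1 ^+ 2 + u2 ^+ 2)) <=
  \sum_(i < L) \sum_(j < L) (good_point L i.+1 j.+1)%:R * (1 - cos (i.+1%:R * u1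
    + j.+1%:R * u2)).
Proof.
move=> L96 h1 h2; have hc := good_point_count L.
have d1 := dense_set_damp u2 L96 hc h1.
have hc' : (1 / 2 + 1 / 96) * L%:R ^+ 2 <=
  \sum_(i < L) \sum_(j < L) (good_point L j.+1 i.+1)%:R :> R.
  by rewrite exchange_big.
have d2 := @dense_set_damp L (fun i j => good_point L j i) u2 u1 L96 hc' h2.
rewrite exchange_big/= in d2.
have e2 : \sum_(j < L) \sum_(i < L) (good_point L j.+1 i.+1)%:R * (1 - cos (i.+1%:R * u2
  + j.+1%:R * u1)) =
  \sum_(i < L) \sum_(j < L) (good_point L i.+1 j.+1)%:R * (1 - cos (i.+1%:R * u1
    + j.+1%:R * u2)).
  by apply: eq_bigr => i _; apply: eq_bigr => j _; rewrite [X in cos X]addrC.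
rewrite e2 in d2.
set S := \sum_(i < L) _ in d1 d2 *.
set p := L%:R ^+ 2 * u1 ^+ 2 in d1; set q := L%:R ^+ 2 * u2 ^+ 2 in d2.
have p0 : 0 <= p by rewrite mulr_ge0 ?sqr_ge0.
have q0 : 0 <= q by rewrite mulr_ge0 ?sqr_ge0.
have pq : L%:R ^+ 2 * (u1 ^+ 2 + u2 ^+ 2) = p + q by rewrite mulrDr.
rewrite pq.
have hm : Num.min 1 (p + q) <= Num.min 1 p + Num.min 1 q.
  exact: min1D_le.
have c0 : 0 <= L%:R ^+ 2 / (2 * 384 ^+ 3) :> R.
  apply: divr_ge0; first exact: sqr_ge0.
  by apply: mulr_ge0; [exact: ler0n|apply: exprn_ge0; exact: ler0n].
have := ler_wpM2l c0 hm; lra.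
Qed.

End count.

(** * Moments of negative binomial laws *)

Section negbin.
Variable R : realType.
Implicit Types (r z : R) (k K : nat).

Lemma gbinom0 r : gbinom r 0 = 1.
Proof. by rewrite /gbinom big_ord0 fact0 divr1. Qed.

Lemma gbinomS r k : k.+1%:R * gbinom r k.+1 = (r + k%:R) * gbinom r k.
Proof.
rewrite /gbinom big_ord_recr/= factS natrM.
have k0 : k.+1%:R != 0 :> R by rewrite pnatr_eq0.
have f0 : k`!%:R != 0 :> R by rewrite pnatr_eq0 -lt0n fact_gt0.
by field; rewrite f0 /= addrC natr1.
Qed.

Lemma gbinom_ge0 r k : 0 < r -> 0 <= gbinom r k.
Proof.
by move=> r0; rewrite /gbinom divr_ge0// prodr_ge0// => i _; rewrite addr_ge0// ltW.
Qed.

Lemma gbinom_shift r k : r * gbinom (r + 1) k = (r + k%:R) * gbinom r k.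
Proof.
rewrite /gbinom !mulrA; congr (_ / _).
have h : r * \prod_(i < k) (r + 1 + i%:R) = \prod_(i < k.+1) (r + i%:R).
  rewrite big_ord_recl/= addr0; congr (_ * _); apply: eq_bigr => i _.
  by rewrite /bump/= add1n -natr1; ring.
by rewrite h big_ord_recr/= mulrC.
Qed.

Lemma gbinom_pascal r k : 0 < r ->
  gbinom (r + 1) k.+1 = gbinom (r + 1) k + gbinom r k.+1.
Proof.
move=> r0; have rn := lt0r_neq0 r0.
have kn : k.+1%:R != 0 :> R by rewrite pnatr_eq0.
apply: (mulfI rn); rewrite mulrDr !gbinom_shift.
have h := gbinomS r k; apply: (mulfI kn).
rewrite mulrDr mulrCA h !(mulrCA _ r) h -[k.+1%:R]natr1; ring.
Qed.

(** Partial sums of the binomial series of (1 - z)^(- r). *)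
Definition negbin_psum r z K : R := \sum_(k < K) gbinom r k * z ^+ k.

Lemma negbin_psum_ge0 r z K : 0 < r -> 0 <= z -> 0 <= negbin_psum r z K.
Proof.
by move=> r0 z0; apply: sumr_ge0 => k _; rewrite mulr_ge0 ?gbinom_ge0 ?exprn_ge0.
Qed.

(** Multiplication by 1 - z lowers the parameter by one, up to a boundary term
    of constant sign; this is Pascal's rule. *)
Lemma negbin_psum_shift r z K : 0 < r -> 0 <= z ->
  (1 - z) * negbin_psum (r + 1) z K <= negbin_psum r z K.
Proof.
move=> r0 z0; case: K => [|K]; first by rewrite /negbin_psum !big_ord0 mulr0.
have h : (1 - z) * negbin_psum (r + 1) z K.+1 + gbinom (r
  + 1) K * z ^+ K.+1 = negbin_psum r z K.+1.
  elim: K => [|K IH]; first by rewrite /negbin_psum !big_ord_recr !big_ord0 /= !gbinom0 expr0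
    expr1; ring.
  rewrite /negbin_psum big_ord_recr/= -/(negbin_psum _ _ _) [RHS]big_ord_recr/=
    -/(negbin_psum _ _ _) -IH.
  by rewrite gbinom_pascal// [z ^+ K.+2]exprS; ring.
rewrite -h lerDl mulr_ge0 ?exprn_ge0// gbinom_ge0//; lra.
Qed.

Lemma negbin_psum_mono r z K : 0 < r -> 0 <= z -> negbin_psum r z K <= negbin_psum r z K.+1.
Proof.
by move=> r0 z0; rewrite /negbin_psum big_ord_recr/= lerDl mulr_ge0 ?gbinom_ge0 ?exprn_ge0.
Qed.

(** Falling factorials, unlike powers, combine with the binomial coefficients
    into the same kind of sum with parameter r + 1. *)
Definition fact_psum j r z K : R := \sum_(k < K) (k ^_ j)%:R * (gbinom r k * z ^+ k).

Lemma fact_psumS j r z K : fact_psum j.+1 r z K.+1 = r * z * fact_psum j (r + 1) z K.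
Proof.
rewrite /fact_psum big_ord_recl/= ffact0n mul0r add0r mulr_sumr; apply: eq_bigr => k _.
rewrite /bump/= add1n ffactSS natrM.
have -> : k.+1%:R * (k ^_ j)%:R * (gbinom r k.+1 * z ^+ k.+1) =
  (k ^_ j)%:R * z ^+ k.+1 * (k.+1%:R * gbinom r k.+1) by ring.
by rewrite gbinomS -gbinom_shift exprS; ring.
Qed.

(** Each step of fact_psumS raises the parameter by one, and negbin_psum_shift
    brings it back at the price of a factor 1 / (1 - z). *)
Lemma fact_psum_le j r z K : 0 < r -> 0 < z < 1 ->
  fact_psum j r z K <= (\prod_(i < j) (r + i%:R)) * (z / (1 - z)) ^+ j * negbin_psum r z K.
Proof.
move=> + /andP[z0 z1]; have y0 : 0 <= z / (1 - z) by rewrite divr_ge0 ?ltW// subr_gt0.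
elim: j r K => [|j IH] r K r0.
  rewrite big_ord0 expr0 !mul1r /fact_psum /negbin_psum le_eqVlt; apply/orP; left; apply/eqP.
  by apply: eq_bigr => k _; rewrite ffactn0 mul1r.
have P0 : 0 <= \prod_(i < j.+1) (r + i%:R) by rewrite prodr_ge0// => i _;
  rewrite addr_ge0// ltW.
case: K => [|K].
  by rewrite /fact_psum big_ord0 !mulr_ge0 ?exprn_ge0// negbin_psum_ge0// ltW.
have r1 : 0 < r + 1 by lra.
rewrite fact_psumS; apply: (@le_trans _ _ (r * z * ((\prod_(i < j) (r + 1
  + i%:R)) * (z / (1 - z)) ^+ j * negbin_psum (r + 1) z K))).
  by rewrite ler_wpM2l ?IH// mulr_ge0 ?ltW.
have hp : r * \prod_(i < j) (r + 1 + i%:R) = \prod_(i < j.+1) (r + i%:R).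
  rewrite big_ord_recl/= addr0; congr (_ * _); apply: eq_bigr => i _.
  by rewrite /bump/= add1n -natr1; ring.
have hg : negbin_psum (r + 1) z K <= negbin_psum r z K.+1 / (1 - z).
  rewrite ler_pdivlMr ?subr_gt0// mulrC.
  apply: le_trans (negbin_psum_shift K.+1 r0 (ltW z0)).
  by rewrite ler_wpM2l ?subr_ge0 ?(ltW z1)// negbin_psum_mono// ltW.
have -> : r * z * ((\prod_(i < j) (r + 1 + i%:R)) * (z / (1 - z)) ^+ j * negbin_psum (r
  + 1) z K) =
  (\prod_(i < j.+1) (r + i%:R)) * (z / (1 - z)) ^+ j * z * negbin_psum (r + 1) z K.
  by rewrite -hp; ring.
have -> : (\prod_(i < j.+1) (r + i%:R)) * (z / (1 - z)) ^+ j.+1 * negbin_psum r z K.+1 =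
  (\prod_(i < j.+1) (r + i%:R)) * (z / (1 - z)) ^+ j * z * (negbin_psum r z K.+1 / (1 - z)).
  by rewrite exprSr; field; rewrite subr_eq0 eq_sym lt_eqF.
by rewrite ler_wpM2l// !mulr_ge0 ?exprn_ge0// ltW.
Qed.

Lemma cube_ffact k : (k%:R : R) ^+ 3 = (k ^_ 3)%:R + 3 * (k ^_ 2)%:R + (k ^_ 1)%:R.
Proof.
case: k => [|[|[|k]]].
- by rewrite !ffact0n /=; ring.
- have [-> -> ->] : [/\ 1 ^_ 3 = 0, 1 ^_ 2 = 0 & 1 ^_ 1 = 1]%N by [].
  by ring.
- have [-> -> ->] : [/\ 2 ^_ 3 = 0, 2 ^_ 2 = 2 & 2 ^_ 1 = 2]%N by [].
  by ring.
rewrite !ffactSS !ffactn0 !muln1 !natrM.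
have e1 : k.+1%:R = k%:R + 1 :> R by rewrite natr1.
have e2 : k.+2%:R = k%:R + 2 :> R by rewrite -addn2 natrD.
have e3 : k.+3%:R = k%:R + 3 :> R by rewrite -addn3 natrD.
by rewrite e1 e2 e3; ring.
Qed.

(** Coefficients of the cube in the basis of falling factorials, times the
    rising factorials of r. One constant suffices because z^j / (1 - z)^j <= z /
    (1 - z)^3 for j = 1, 2, 3. *)
Definition mom3_ratio r : R := r + 3 * (r * (r + 1)) + r * (r + 1) * (r + 2).

Definition negbin r z k : R := gbinom r k * z ^+ k * (1 - z) `^ r.

Lemma negbin_ge0 r z k : 0 < r -> 0 <= z -> 0 <= negbin r z k.
Proof.
move=> r0 z0; rewrite /negbin; apply: mulr_ge0; last exact: powR_ge0.
by apply: mulr_ge0; [exact: gbinom_ge0|exact: exprn_ge0].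
Qed.

Lemma negbin_mom3_le r z K : 0 < r -> 0 < z < 1 ->
  \sum_(k < K) negbin r z k * k%:R ^+ 3 <=
    mom3_ratio r * (z / (1 - z) ^+ 3) * \sum_(k < K) negbin r z k.
Proof.
move=> r0 z01; have [z0 z1] := andP z01.
have -> : \sum_(k < K) negbin r z k = negbin_psum r z K * (1 - z) `^ r
  by rewrite /negbin_psum mulr_suml.
have -> : \sum_(k < K) negbin r z k * k%:R ^+ 3 =
   (fact_psum 3 r z K + 3 * fact_psum 2 r z K + fact_psum 1 r z K) * (1 - z) `^ r.
  rewrite /fact_psum mulr_sumr -!big_split/= mulr_suml; apply: eq_bigr => k _.
  by rewrite cube_ffact /negbin; ring.
rewrite mulrA ler_wpM2r ?powR_ge0//.
have w0 : 0 < 1 - z by lra.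
have y0 : 0 <= z / (1 - z) by rewrite divr_ge0 ?ltW.
have G0 := negbin_psum_ge0 K r0 (ltW z0).
have f1 := fact_psum_le 1 K r0 z01; have f2 := fact_psum_le 2 K r0 z01;
  have f3 := fact_psum_le 3 K r0 z01.
rewrite !big_ord_recr !big_ord0 /= mul1r addr0 expr1 in f1.
rewrite !big_ord_recr !big_ord0 /= mul1r addr0 in f2.
rewrite !big_ord_recr !big_ord0 /= mul1r addr0 in f3.
set q := z / (1 - z) ^+ 3; set y := z / (1 - z) in y0 f1 f2 f3.
have e3 : y ^+ 3 = q * z ^+ 2 by rewrite /y /q; field; rewrite gt_eqF.
have e2 : y ^+ 2 = q * (z * (1 - z)) by rewrite /y /q; field; rewrite gt_eqF.
have e1 : y = q * (1 - z) ^+ 2 by rewrite /y /q; field; rewrite gt_eqF.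
have q0 : 0 <= q by rewrite divr_ge0 ?exprn_ge0// ltW.
have b3 : y ^+ 3 <= q by rewrite e3 ler_piMr// exprn_ile1// ltW.
have b2 : y ^+ 2 <= q by rewrite e2 ler_piMr//; nra.
have b1 : y <= q by rewrite e1 ler_piMr// exprn_ile1//; lra.
have a1 : fact_psum 1 r z K <= r * q * negbin_psum r z K.
  by apply: (le_trans f1); rewrite ler_wpM2r// ler_wpM2l// ltW.
have a2 : fact_psum 2 r z K <= r * (r + 1) * q * negbin_psum r z K.
  by apply: (le_trans f2); rewrite ler_wpM2r// ler_wpM2l// mulr_ge0//; lra.
have a3 : fact_psum 3 r z K <= r * (r + 1) * (r + 2) * q * negbin_psum r z K.
  by apply: (le_trans f3); rewrite ler_wpM2r// ler_wpM2l// !mulr_ge0//; lra.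
have -> : mom3_ratio r * q * negbin_psum r z K = r * (r + 1) * (r + 2) * q * negbin_psum r z K +
  3 * (r * (r + 1) * q * negbin_psum r z K) + r * q * negbin_psum r z K
    by rewrite /mom3_ratio; ring.
lra.
Qed.

(** The law of the minimum with M: the mass of the tail is moved to M. *)
Definition trunc_law (w : nat -> R) (M k : nat) : R :=
  if (k < M)%N then w k else if k == M then 1 - \sum_(j < M) w j else 0.

Lemma sum_trunc_law (w F : nat -> R) (M : nat) :
  \sum_(k < M.+1) trunc_law w M k * F k =
  \sum_(k < M) w k * F k + (1 - \sum_(j < M) w j) * F M.
Proof.
rewrite big_ord_recr/=; congr (_ + _).
  by apply: eq_bigr => k _; rewrite /trunc_law ltn_ord.
by rewrite /trunc_law ltnn eqxx.
Qed.

Lemma trunc_law_is_law (w : nat -> R) (M : nat) : (forall k, 0 <= w k) ->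
  \sum_(j < M) w j <= 1 -> is_law (trunc_law w M) M.+1.
Proof.
move=> w0 w1; split.
  by move=> k; rewrite /trunc_law; case: ifP => // _; case: ifP => // _; rewrite subr_ge0.
have := sum_trunc_law w (fun=> 1) M; rewrite mulr1.
under eq_bigr do rewrite mulr1.
by under [X in _ = X + _ -> _]eq_bigr do rewrite mulr1; move=> ->; ring.
Qed.

(** Truncation lowers moments: the mass at M comes from a tail that sits at
    integers at least M. *)
Lemma mom3_trunc_law (w : nat -> R) (M : nat) (B : R) : (forall k, 0 <= w k) ->
  series w @ \oo --> (1 : R) ->
  (forall K, \sum_(k < K) w k * k%:R ^+ 3 <= B) ->
  mom3 (trunc_law w M) M.+1 <= B.
Proof.
move=> w0 wc wB; rewrite /mom3 (sum_trunc_law w (fun k => k%:R ^+ 3) M).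
pose u (K : nat) := \sum_(k < M) w k * k%:R ^+ 3 + (series w K - \sum_(j < M) w j) * M%:R ^+ 3.
have uc : u K @[K --> \oo] -->
  \sum_(k < M) w k * k%:R ^+ 3 + (1 - \sum_(j < M) w j) * M%:R ^+ 3.
  apply: cvgD; first exact: cvg_cst.
  by apply: cvgMl; apply: cvgB => //; exact: cvg_cst.
rewrite -(cvg_lim (@Rhausdorff R) uc); apply: limr_le.
  by apply/cvg_ex; eexists; exact: uc.
near=> K; apply: le_trans (wB K); rewrite /u.
have MK : (M <= K)%N by near: K; exact: nbhs_infty_ge.
rewrite /series/= big_mkord -(subnKC MK) !big_split_ord/= lerD2l.
rewrite [X in (X - _) * _]addrC addrK mulr_suml.
apply: ler_sum => k _; rewrite ler_wpM2l// lerXn2r ?nnegrE// ler_nat.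
exact: leq_addr.
Unshelve. all: end_near. Qed.

End negbin.

(** * Coprime points in a box and lattice sums *)

Definition cx (x : coprime_point) : nat := val x 0 0.
Definition cy (x : coprime_point) : nat := val x 0 1.
Definition mkvec (a b : nat) : 'rV[nat]_2 := \row_(j < 2) (if j == 0 then a else b).

Lemma mkvecK (x : 'rV[nat]_2) : mkvec (x 0 0) (x 0 1) = x.
Proof.
apply/rowP => j; rewrite mxE; have [->//|] := eqVneq j 0.
by case: j => [[|[|j]] hj] // _; congr (x _ _); exact: val_inj.
Qed.

Lemma mkvec0 a b : mkvec a b 0 0 = a. Proof. by rewrite mxE. Qed.
Lemma mkvec1 a b : mkvec a b 0 1 = b. Proof. by rewrite mxE. Qed.

Definition box_points (M : nat) : seq coprime_point :=
  pmap insub [seq mkvec a b | a <- iota 0 M, b <- iota 0 M].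

Lemma mem_box_points M x : (x \in box_points M) = (cx x < M)%N && (cy x < M)%N.
Proof.
rewrite mem_pmap_sub; apply/allpairsP/idP.
  move=> [[a b] /= [+ + xE]]; rewrite !mem_iota !add0n /= /cx /cy /= xE mkvec0 mkvec1.
  by move=> -> ->.
move=> /andP[h1 h2]; exists (cx x, cy x); rewrite !mem_iota !add0n /=; split => //.
by rewrite /cx /cy mkvecK.
Qed.

Lemma uniq_box_points M : uniq (box_points M).
Proof.
apply: pmap_sub_uniq; apply: allpairs_uniq; rewrite ?iota_uniq//.
move=> [a b] [c d] _ _ /= h.
by rewrite -(mkvec0 a b) h mkvec0 -{1}(mkvec1 a b) h mkvec1.
Qed.

Lemma sum_box_points (R : realType) M (F : nat -> nat -> R) :
  \sum_(x <- box_points M) F (cx x) (cy x) =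
  \sum_(a < M) \sum_(b < M) (coprime a b)%:R * F a b.
Proof.
have E : iota 0 M = index_iota 0 M by rewrite /index_iota subn0.
rewrite /box_points big_pmap big_allpairs_dep E big_mkord.
apply: eq_bigr => a _; rewrite big_mkord.
apply: eq_bigr => b _; case: insubP => /= [u + uE|].
  by rewrite mkvec0 mkvec1 => ->; rewrite /cx /cy /= uE mkvec0 mkvec1 mul1r.
by rewrite mkvec0 mkvec1 => /negbTE ->; rewrite mul0r.
Qed.

Section bounds.
Variable R : realType.

Lemma one_sub_expRN_ge (s : R) : 0 < s -> s / (1 + s) <= 1 - expR (- s).
Proof.
move=> s0; have h : expR (- s) <= (1 + s)^-1.
  by rewrite expRN lef_pV2 ?posrE ?expR_gt0 ?expR_ge1Dx//; lra.
have -> : s / (1 + s) = 1 - (1 + s)^-1 by field; lra.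
lra.
Qed.

(** Half of the exponential is kept, to make the sum over the lattice converge;
    216 = 6^3 comes from 1 + s <= 6 exp(s / 6). *)
Lemma thermal_le (s : R) : 0 < s ->
  expR (- s) / (1 - expR (- s)) ^+ 3 <= 216 * expR (- (s / 2)) / s ^+ 3.
Proof.
move=> s0; have h := one_sub_expRN_ge s0.
have s10 : 0 < s / (1 + s) by rewrite divr_gt0//; lra.
have e0 := expR_gt0 (- s).
have h1 : (s / (1 + s)) ^+ 3 <= (1 - expR (- s)) ^+ 3.
  by rewrite lerXn2r ?nnegrE//; lra.
apply: (@le_trans _ _ (expR (- s) / (s / (1 + s)) ^+ 3)).
  rewrite ler_wpM2l ?expR_ge0// lef_pV2 ?posrE ?exprn_gt0//; lra.
have h2 : (1 + s) ^+ 3 <= 216 * expR (s / 2).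
  have -> : expR (s / 2) = expR (s / 6) ^+ 3 by rewrite -expRM_natl; congr expR; field.
  have -> : (216 : R) = 6 ^+ 3 by ring.
  have g1 : 0 <= 1 + s by lra.
  have g2 : 0 <= 6 * expR (s / 6) by rewrite mulr_ge0 ?expR_ge0.
  rewrite -exprMn lerXn2r ?nnegrE//.
  have := expR_ge1Dx (s / 6); lra.
have -> : expR (- s) / (s / (1 + s)) ^+ 3 = expR (- s) * (1 + s) ^+ 3 / s ^+ 3.
  by field; apply/andP; split; lra.
have -> : expR (- (s / 2)) = expR (- s) * expR (s / 2) by rewrite -expRD; congr expR; field.
apply: ler_wpM2r; first by rewrite invr_ge0 exprn_ge0// ltW.
by rewrite [leRHS]mulrCA ler_wpM2l ?expR_ge0.
Qed.

Lemma geom_sum_le (h : R) (M : nat) : 0 < h ->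
  \sum_(a < M) expR (- (h * a%:R)) <= (1 + h) / h.
Proof.
move=> h0; have hh := one_sub_expRN_ge h0.
have q0 := expR_gt0 (- h).
have h10 : 0 < h / (1 + h) by rewrite divr_gt0//; lra.
have -> : \sum_(a < M) expR (- (h * a%:R)) = \sum_(a < M) expR (- h) ^+ a.
  by apply: eq_bigr => a _; rewrite -expRM_natl; congr expR; ring.
have hs : (1 - expR (- h)) * \sum_(a < M) expR (- h) ^+ a = 1 - expR (- h) ^+ M.
  by have := subrX1 (expR (- h)) M; lra.
have qM : 0 <= expR (- h) ^+ M by rewrite exprn_ge0 ?expR_ge0.
rewrite -[leRHS]invf_div.
have i0 : 0 < 1 - expR (- h) by lra.
apply: (@le_trans _ _ (1 - expR (- h))^-1).
  rewrite -[leRHS]mul1r ler_pdivlMr// mulrC hs; lra.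
by rewrite lef_pV2 ?posrE.
Qed.

Definition rho3_const (r c : R) : R := mom3_ratio r * 216 / (c ^+ 3) * (1 + 2 / c) ^+ 2.

Lemma mom3_ratio_ge0 (r : R) : 0 < r -> 0 <= mom3_ratio r.
Proof. by move=> r0; rewrite /mom3_ratio !addr_ge0 ?mulr_ge0//; lra. Qed.

(** Each term is at most a multiple of L^3 exp(- h a) exp(- h b) with h of order
    1 / L, and each of the two geometric sums is O(L). *)
Lemma thermal_sum_le (r c L al1 al2 : R) (z : nat -> nat -> R) (M : nat) :
  (forall a b, z a b = expR (- (al1 * a%:R + al2 * b%:R))) ->
  0 < r -> 0 < c -> 1 <= L -> c / L <= al1 -> c / L <= al2 ->
  \sum_(a < M) \sum_(b < M) (coprime a b)%:R *
     (mom3_ratio r * (z a b / (1 - z a b) ^+ 3) * (a + b)%:R ^+ 3) <= rho3_const r c * L ^+ 5.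
Proof.
move=> zE r0 c0 L1 h1 h2.
have L0 : 0 < L by lra.
have cL : 0 < c / L by rewrite divr_gt0.
pose h := c / L / 2.
have h0 : 0 < h by rewrite divr_gt0.
have C30 := mom3_ratio_ge0 r0.
have p0 : 0 <= mom3_ratio r * 216 by apply: mulr_ge0; [exact: C30|exact: ler0n].
have K0 : 0 <= mom3_ratio r * 216 / (c / L) ^+ 3.
  by apply: divr_ge0; [exact: p0|apply: exprn_ge0; exact: ltW].
have term (a b : nat) : (coprime a b)%:R * (mom3_ratio r * (z a b / (1 - z a b) ^+ 3) * (a
  + b)%:R ^+ 3) <=
   mom3_ratio r * 216 / (c / L) ^+ 3 * (expR (- (h * a%:R)) * expR (- (h * b%:R))).
  have rhs0 : 0 <= mom3_ratio r * 216 / (c / L) ^+ 3 * (expR (- (h * a%:R)) * expR (- (h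
    * b%:R))).
    by apply: mulr_ge0; [exact: K0|apply: mulr_ge0; exact: expR_ge0].
  have [cab|] := boolP (coprime a b); last by rewrite mul0r.
  rewrite mul1r; set t : R := (a + b)%:R.
  have t0 : 0 < t.
    by rewrite ltr0n; case: (a) (b) cab => [|?] [|?].
  have a0 : 0 <= a%:R :> R by []. have b0 : 0 <= b%:R :> R by [].
  have tE : t = a%:R + b%:R by rewrite /t natrD.
  set s := al1 * a%:R + al2 * b%:R.
  have st : c / L * t <= s.
    by rewrite tE mulrDr; apply: lerD; rewrite ler_wpM2r.
  have s0 : 0 < s by apply: lt_le_trans st; rewrite mulr_gt0.
  have := thermal_le s0; rewrite -zE => hth.
  apply: (@le_trans _ _ (mom3_ratio r * (216 * expR (- (s / 2)) / s ^+ 3) * t ^+ 3)).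
    by apply: ler_wpM2r; [rewrite exprn_ge0// ltW|apply: ler_wpM2l].
  have hs3 : t ^+ 3 / s ^+ 3 <= ((c / L) ^+ 3)^-1.
    rewrite ler_pdivrMr ?exprn_gt0// mulrC ler_pdivlMr ?exprn_gt0//.
    rewrite -exprMn; apply: lerXn2r; rewrite ?nnegrE;
      [by rewrite mulr_ge0 ?ltW|exact: ltW|by rewrite mulrC].
  have he : expR (- (s / 2)) <= expR (- (h * a%:R)) * expR (- (h * b%:R)).
    rewrite -expRD ler_expR -opprD -mulrDr -tE lerN2 /h; lra.
  have -> : mom3_ratio r * (216 * expR (- (s / 2)) / s ^+ 3) * t ^+ 3 =
     mom3_ratio r * 216 * ((t ^+ 3 / s ^+ 3) * expR (- (s / 2))) by ring.
  rewrite -[leRHS]mulrA; apply: ler_wpM2l; first exact: p0.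
  by apply: ler_pM => //; rewrite ?expR_ge0// divr_ge0// exprn_ge0// ltW.
apply: (@le_trans _ _ (\sum_(a < M) \sum_(b < M)
   mom3_ratio r * 216 / (c / L) ^+ 3 * (expR (- (h * a%:R)) * expR (- (h * b%:R))))).
  by apply: ler_sum => a _; apply: ler_sum => b _; exact: term.
have -> : \sum_(a < M) \sum_(b < M) mom3_ratio r * 216 / (c / L) ^+ 3 * (expR (- (h * a%:R))
  * expR (- (h * b%:R))) =
  mom3_ratio r * 216 / (c / L) ^+ 3 * ((\sum_(a < M) expR (- (h * a%:R)))
    * (\sum_(a < M) expR (- (h * a%:R)))).
  rewrite mulr_suml mulr_sumr; apply: eq_bigr => a _.
  by rewrite mulr_sumr mulr_sumr.
have hg := geom_sum_le M h0.
have hg2 : (1 + h) / h <= (1 + 2 / c) * L.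
  have -> : (1 + h) / h = 1 + 2 / c * L by rewrite /h; field; apply/andP; split; lra.
  lra.
have S0 : 0 <= \sum_(a < M) expR (- (h * a%:R)) by apply: sumr_ge0 => a _; exact: expR_ge0.
have -> : rho3_const r c * L ^+ 5 = mom3_ratio r * 216 / (c / L) ^+ 3 * (((1
  + 2 / c) * L) * ((1 + 2 / c) * L)).
  by rewrite /rho3_const; field; apply/andP; split; lra.
apply: ler_wpM2l; first exact: K0.
by apply: ler_pM => //; apply: le_trans hg2.
Qed.

End bounds.

(** * Truncated coordinates and independence *)

Lemma measurable_coord (x : coprime_point) :
  measurable_fun setT (fun nu : config_space => nu x).
Proof.
move=> _ Y _; rewrite setTI.
by apply: sub_sigma_algebra; exists x, Y.
Qed.

Lemma measurable_nat_fun d (T : measurableType d) (f : T -> nat) (g : nat -> nat) :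
  measurable_fun setT f -> measurable_fun setT (fun x => g (f x)).
Proof.
by move=> mf; apply: (@measurableT_comp _ _ _ _ _ _ g _ f).
Qed.

Lemma measurable_nat_fun2 d d' (T : measurableType d) (V : measurableType d')
    (f g : T -> nat) (F : nat -> nat -> V) :
  measurable_fun setT f -> measurable_fun setT g ->
  measurable_fun setT (fun x => F (f x) (g x)).
Proof.
move=> mf mg _ Y _; rewrite setTI.
have -> : (fun x => F (f x) (g x)) @^-1` Y =
   \bigcup_i \bigcup_j ([set x | Y (F i j)] `&` ((f @^-1` [set i]) `&` (g @^-1` [set j]))).
  apply/seteqP; split => x /=.
    by move=> h; exists (f x) => //; exists (g x) => //.
  by move=> [i _ [j _ [/= h [fx gx]]]]; rewrite fx gx.
apply: bigcupT_measurable => i; apply: bigcupT_measurable => j.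
apply: measurableI; last first.
  by apply: measurableI; rewrite -[X in measurable X]setTI; [exact: mf|exact: mg].
have [h|h] := pselect (Y (F i j)).
  have -> : [set x : T | Y (F i j)] = setT by apply/seteqP; split.
  exact: measurableT.
have -> : [set x : T | Y (F i j)] = set0 by apply/seteqP; split.
exact: measurable0.
Qed.

Lemma measurable_natr d (T : measurableType d) (R : realType) (f : T -> nat) (F : nat -> R) :
  measurable_fun setT f -> measurable_fun setT (fun x => F (f x)).
Proof. by move=> mf; exact: (measurable_nat_fun2 (fun a _ => F a) mf mf). Qed.

Definition trunc_sum (c : coprime_point -> nat) (M : nat) (X : seq coprime_point)
    (nu : config_space) : nat := (\sum_(x <- X) minn (nu x) M * c x)%N.

Lemma measurable_trunc_sum c M X : measurable_fun setT (trunc_sum c M X).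
Proof.
elim: X => [|x X IH].
  have -> : trunc_sum c M [::] = (fun=> 0%N) by apply/funext => nu; rewrite /trunc_sum big_nil.
  exact: measurable_cst.
have -> : trunc_sum c M (x :: X) = (fun nu => minn (nu x) M * c x + trunc_sum c M X nu)%N.
  by apply/funext => nu; rewrite /trunc_sum big_cons.
apply: measurable_fun_addn => //.
exact: (measurable_nat_fun (fun k => minn k M * c x)%N (measurable_coord x)).
Qed.

Definition cyl_set (J : seq coprime_point) (A : coprime_point -> set nat) : set config_space :=
  [set nu : config_space | forall x, x \in J -> A x (nu x)].

Lemma measurable_cyl_set J A : measurable (cyl_set J A).
Proof.
elim: J => [|x J IH].
  have -> : cyl_set [::] A = setT by apply/seteqP; split.
  exact: measurableT.
have -> : cyl_set (x :: J) A = ((fun nu : config_space => nu x) @^-1` (A x)) `&` cyl_set J A.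
  apply/seteqP; split => nu /=.
    move=> h; split; first by apply: h; rewrite mem_head.
    by move=> y yJ; apply: h; rewrite in_cons yJ orbT.
  move=> [h1 h2] y; rewrite in_cons => /predU1P[->//|]; exact: h2.
apply: measurableI => //; rewrite -[X in measurable X]setTI.
exact: measurable_coord.
Qed.

Section Q.
Variables (R : realType) (r : R) (z : 'rV[R]_2) (Q : probability config_space R).
Hypothesis hQ : is_Q r z Q.

Definition coord_weight (x : coprime_point) (k : nat) : R := negbin r (zpow z (val x)) k.

Lemma Q_coord x k : Q [set nu : config_space | nu x = k] = (coord_weight x k)%:E.
Proof. exact: hQ.2. Qed.

Lemma coord_weight_ge0 x k : 0 <= coord_weight x k.
Proof. by rewrite -lee_fin -Q_coord. Qed.

Lemma measurable_coord_set x (A : set nat) :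
  measurable [set nu : config_space | A (nu x)].
Proof. by have := measurable_coord x measurableT (Y := A) I; rewrite setTI. Qed.

Lemma Q_lt x M : Q [set nu : config_space | (nu x < M)%N] = (\sum_(j < M) coord_weight x j)%:E.
Proof.
elim: M => [|M IH].
  rewrite big_ord0; have -> : [set nu : config_space | (nu x < 0)%N] = set0.
    by apply/seteqP; split.
  by rewrite measure0.
rewrite big_ord_recr/= EFinD -IH -Q_coord.
have -> : [set nu : config_space | (nu x < M.+1)%N] =
   [set nu : config_space | (nu x < M)%N] `|` [set nu : config_space | nu x = M].
  apply/seteqP; split => nu /=.
    by rewrite ltnS leq_eqVlt => /predU1P[->|h]; [right|left].
  by move=> [h|->]; [rewrite ltnS ltnW|].
rewrite measureU//.
- exact: (measurable_coord_set x [set k | (k < M)%N]).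
- exact: (measurable_coord_set x [set k | k = M]).
- by apply/seteqP; split => // nu [/= h1 h2]; rewrite h2 ltnn in h1.
Qed.

Lemma sum_coord_weight_le1 x M : \sum_(j < M) coord_weight x j <= 1.
Proof. by rewrite -lee_fin -Q_lt probability_le1//;
  exact: (measurable_coord_set x [set k | (k < M)%N]). Qed.

(** The partial sums are the probabilities of the events nu x < M, which
    increase to the whole space. *)
Lemma sum_coord_weight_cvg x : series (coord_weight x) @ \oo --> (1 : R).
Proof.
pose F (M : nat) := [set nu : config_space | (nu x < M)%N].
have mF M : measurable (F M) by exact: (measurable_coord_set x [set k | (k < M)%N]).
have FU : \bigcup_M F M = setT.
  by apply/seteqP; split => // nu _; exists (nu x).+1 => //=; rewrite /F/=.
have h : Q (F M) @[M --> \oo] --> Q (\bigcup_M F M).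
  apply: nondecreasing_cvg_mu => //; first exact: bigcupT_measurable.
  move=> M N MN; apply/subsetPset => nu /=; rewrite /F/= => h.
  exact: leq_trans MN.
rewrite FU probability_setT in h.
have -> : series (coord_weight x) = fine \o (fun M => Q (F M)).
  by apply/funext => M /=; rewrite /F Q_lt /series/= big_mkord.
exact: fine_cvg.
Qed.

Definition trunc_coord_law (M : nat) (x : coprime_point) : nat -> R
  := trunc_law (coord_weight x) M.

Lemma trunc_coord_law_is_law M x : is_law (trunc_coord_law M x) M.+1.
Proof. by apply: trunc_law_is_law; [exact: coord_weight_ge0|exact: sum_coord_weight_le1]. Qed.

Lemma Q_minn M x (k : 'I_M.+1) :
  Q [set nu : config_space | minn (nu x) M = k] = (trunc_coord_law M x k)%:E.
Proof.
rewrite /trunc_coord_law /trunc_law; case: ltnP => kM.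
  rewrite -Q_coord; congr (Q _); apply/seteqP; split => nu /=; rewrite /minn; case: ifP; lia.
have -> : (k : nat) = M by apply/eqP; rewrite eqn_leq kM -ltnS ltn_ord.
rewrite eqxx.
have -> : [set nu : config_space | minn (nu x) M = M] =
  ~` [set nu : config_space | (nu x < M)%N].
  by apply/seteqP; split => nu /=; rewrite /minn; case: ifP; lia.
rewrite probability_setC ?Q_lt//.
exact: (measurable_coord_set x [set k | (k < M)%N]).
Qed.

(** Induction on X. The cylinder over J records the coordinates whose values are
    fixed: splitting along the value of minn (nu x) M moves x from X to J, and
    independence factors the probability of the cylinder over x :: J. *)
Lemma integral_trunc_sum M X J A (F : nat -> nat -> R) :
  (forall a b, 0 <= F a b) -> uniq (X ++ J) ->
  (\int[Q]_nu (F (trunc_sum cx M X nu) (trunc_sum cy M X nu) * \1_(cyl_set J A) nu)%:E =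
   (Ex cx cy (trunc_coord_law M) M.+1 X F)%:E * Q (cyl_set J A))%E.
Proof.
elim: X J A F => [|x X IH] J A F F0 uXJ.
  under eq_integral do rewrite /trunc_sum !big_nil EFinM.
  have mI : measurable_fun setT (fun nu => (\1_(cyl_set J A) nu)%:E : \bar R).
    by apply/measurable_EFinP; apply: measurable_indic; exact: measurable_cyl_set.
  have I0 (nu : config_space) : [set: config_space] nu
    -> (0 <= (\1_(cyl_set J A) nu)%:E :> \bar R)%E.
    by move=> _; rewrite lee_fin indicE.
  rewrite (ge0_integralZl Q measurableT mI I0) ?lee_fin//.
  by rewrite integral_indic ?setIT//; exact: measurable_cyl_set.
have uXJ' : uniq (X ++ x :: J).
  by have := uXJ; rewrite (perm_uniq (_ : perm_eq _ (X ++ x :: J)))//= (perm_catCA [:: x] X J).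
have xJ : x \notin J by move: uXJ; rewrite /= mem_cat negb_or => /andP[/andP[_ ->]].
have uJ : uniq J by move: uXJ; rewrite /= cat_uniq => /andP[_ /and3P[_ _ ->]].
pose Ak (k : nat) := fun y : coprime_point => if y == x then [set j | minn j M = k] else A y.
have AkJ k : cyl_set (x :: J) (Ak k) = [set nu | minn (nu x) M = k] `&` cyl_set J A.
  apply/seteqP; split => nu /=.
    move=> h; split; first by have := h x; rewrite mem_head /Ak eqxx; apply.
    move=> y yJ; have := h y; rewrite in_cons yJ orbT => /(_ isT).
    by rewrite /Ak; case: eqP => // yx; rewrite yx (negbTE xJ) in yJ.
  move=> [h1 h2] y; rewrite in_cons /Ak; case: eqP => [->//|_] /=; exact: h2.
have QAk (k : 'I_M.+1) : Q (cyl_set (x :: J) (Ak k)) =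
  ((trunc_coord_law M x k)%:E * Q (cyl_set J A))%E.
  have hind := hQ.1; rewrite {1}/cyl_set hind/=; last by rewrite xJ uJ.
  rewrite big_cons {1}/Ak eqxx Q_minn; congr (_ * _)%E.
  rewrite /cyl_set hind//; rewrite !big_seq; apply: eq_bigr => y yJ.
  by rewrite /Ak; case: eqP => // yx; rewrite -yx yJ in xJ.
pose Fk (k : nat) (a b : nat) := F (a + k * cx x)%N (b + k * cy x)%N.
have split_k nu : F (trunc_sum cx M (x :: X) nu) (trunc_sum cy M (x :: X) nu)
  * \1_(cyl_set J A) nu =
   \sum_(k < M.+1) Fk k (trunc_sum cx M X nu) (trunc_sum cy M X nu)
     * \1_(cyl_set (x :: J) (Ak k)) nu.
  have km : (minn (nu x) M < M.+1)%N by rewrite ltnS geq_minr.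
  rewrite (bigD1 (Ordinal km))//= [X in _ + X]big1 ?addr0.
    rewrite /Fk /trunc_sum !big_cons ![(minn _ _ * _ + _)%N]addnC; congr (_ * _).
    rewrite !indicE; congr (nat_of_bool _)%:R; apply/idP/idP; rewrite !inE AkJ /=.
      by move=> h; split.
    by case.
  move=> k /eqP kn; rewrite indicE memNset ?mulr0// AkJ => -[/= h _].
  by apply: kn; apply: val_inj.
under eq_integral do rewrite split_k -sumEFin.
have Fk0 k nu : (0 <= (Fk k (trunc_sum cx M X nu) (trunc_sum cy M X nu)
  * \1_(cyl_set (x :: J) (Ak k)) nu)%:E)%E.
  by rewrite lee_fin; apply: mulr_ge0; [exact: F0|rewrite indicE].
rewrite ge0_integral_sum//; last first.
  move=> k; apply/measurable_EFinP; apply: measurable_funM.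
    by apply: measurable_nat_fun2; exact: measurable_trunc_sum.
  by apply: measurable_indic; exact: measurable_cyl_set.
rewrite /= -sumEFin ge0_sume_distrl; last first.
  move=> k _; rewrite lee_fin mulr_ge0//; first by have [h _] := trunc_coord_law_is_law M x;
    exact: h.
  rewrite -(Ex_cst cx cy (trunc_coord_law_is_law M) X 0); apply: le_Ex;
    first exact: trunc_coord_law_is_law.
  by move=> a b; exact: F0.
apply: eq_bigr => k _.
rewrite (IH (x :: J) (Ak k) (Fk k))//; last by move=> a b; exact: F0.
by rewrite QAk EFinM muleCA muleA.
Qed.

Lemma integral_trunc_sumT M X (F : nat -> nat -> R) :
  (forall a b, 0 <= F a b) -> uniq X ->
  (\int[Q]_nu (F (trunc_sum cx M X nu) (trunc_sum cy M X nu))%:E =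
   (Ex cx cy (trunc_coord_law M) M.+1 X F)%:E)%E.
Proof.
move=> F0 uX; have := @integral_trunc_sum M X [::] (fun=> setT) F F0.
rewrite cats0 => /(_ uX).
have -> : cyl_set [::] (fun=> setT) = setT by apply/seteqP; split.
rewrite probability_setT mule1 => <-; apply: eq_integral => nu _.
by rewrite indicT mulr1.
Qed.

End Q.

(** * Finite support and measurability of the sum *)

Definition trunc_xi1 (N : nat) (nu : config_space) : nat := trunc_sum cx N.+1 (box_points N) nu.
Definition trunc_xi2 (N : nat) (nu : config_space) : nat := trunc_sum cy N.+1 (box_points N) nu.

Lemma sub_box_points M N : (M <= N)%N -> {subset box_points M <= box_points N}.
Proof. by move=> MN x; rewrite !mem_box_points => /andP[h1 h2]; apply/andP; split; lia. Qed.

Lemma leq_sum_subset (T : eqType) (s t : seq T) (F G : T -> nat) :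
  uniq s -> uniq t -> {subset s <= t} -> (forall x, x \in s -> (F x <= G x)%N) ->
  (\sum_(x <- s) F x <= \sum_(x <- t) G x)%N.
Proof.
move=> us ut st FG.
have pe : perm_eq s [seq x <- t | x \in s].
  apply: uniq_perm => //; first exact: filter_uniq.
  move=> x; rewrite mem_filter; case: (boolP (x \in s)) => //= xs.
  by rewrite (st x xs).
rewrite (perm_big _ pe)/= big_filter [leqRHS](bigID (mem s))/=.
apply: leq_trans (leq_addr _ _).
by apply: leq_sum => x xs; exact: FG.
Qed.

Lemma trunc_sum_mono c M N nu : (M <= N)%N ->
  (trunc_sum c M.+1 (box_points M) nu <= trunc_sum c N.+1 (box_points N) nu)%N.
Proof.
move=> MN; apply: leq_sum_subset;
  [exact: uniq_box_points|exact: uniq_box_points|exact: sub_box_points|].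
by move=> x _; rewrite leq_mul2r leq_min geq_minl/= (leq_trans (geq_minr _ _))// orbT.
Qed.

Lemma seq_sub_box_points (s : seq coprime_point) : exists N, {subset s <= box_points N}.
Proof.
exists (\sum_(x <- s) (cx x + cy x)).+1 => x xs; rewrite mem_box_points !ltnS.
have h : (cx x + cy x <= \sum_(x <- s) (cx x + cy x))%N.
  by rewrite (big_rem x)//= leq_addr.
by apply/andP; split; apply: leq_trans h; [exact: leq_addr|exact: leq_addl].
Qed.

Lemma cxy_gt0 x : (0 < cx x + cy x)%N.
Proof.
case: x => x hx; rewrite /cx /cy /=; move: hx.
by case: (x 0 0) => [|a]; case: (x 0 1) => [|b].
Qed.

Lemma mulrn_nat (a b : nat) : (a *+ b)%R = (b * a)%N.
Proof. by elim: b => [|b IH]; rewrite ?mulr0n// mulrS IH mulSn. Qed.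

(** The configurations of finite support, described through truncated sums, each
    of which depends on finitely many coordinates; in this form measurability is
    clear. *)
Definition bounded_xi : set config_space :=
  [set nu | exists m, forall N, (trunc_xi1 N nu + trunc_xi2 N nu <= m)%N].

Definition finitely_supported (nu : config_space) : Prop :=
  exists N, forall x, x \notin box_points N -> nu x = 0%N.

(** Each point of the support adds at least 1 to all later truncated sums. *)
Lemma bounded_xi_finitely_supported nu : bounded_xi nu -> finitely_supported nu.
Proof.
move=> [m hm].
have fin : finite_set [set x | nu x <> 0%N].
  apply: contrapT => /(@infinite_set_fset _ _ m.+1)[B Bs Bm].
  have [N hN] := seq_sub_box_points (finmap.enum_fset B).
  have := hm N.
  have : (m < trunc_xi1 N nu + trunc_xi2 N nu)%N.
    apply: (leq_trans Bm).
    rewrite /trunc_xi1 /trunc_xi2 /trunc_sum -big_split/= -sum1_size.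
    apply: leq_sum_subset => //; [exact: finmap.fset_uniq|exact: uniq_box_points|].
    move=> x xB; rewrite -mulnDr muln_gt0 cxy_gt0 andbT leq_min andbT.
    by rewrite lt0n; apply/eqP; apply: (Bs x).
  by rewrite ltnNge => /negP.
have /finite_seqP[s hs] := fin.
have [N hN] := seq_sub_box_points s.
exists N => x xN; apply: contrapT => nx.
have : x \in s by have : [set x | nu x <> 0%N] x by []; rewrite hs.
by move=> /hN; rewrite (negbTE xN).
Qed.

Lemma finitely_supported_stable nu : finitely_supported nu
  -> exists N0, forall N, (N0 <= N)%N ->
  trunc_xi1 N nu = xi nu 0 0 /\ trunc_xi2 N nu = xi nu 0 1.
Proof.
move=> [M hM]; exists (M + \sum_(x <- box_points M) nu x)%N => N hN.
have le_nu x : (nu x <= N.+1)%N.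
  have [xM|/hM -> //] := boolP (x \in box_points M).
  have : (nu x <= \sum_(x <- box_points M) nu x)%N by rewrite (big_rem x)//= leq_addr.
  lia.
have xiE : xi nu = \sum_(x <- box_points N) val x *+ nu x.
  rewrite /xi (fsbigE (box_points N))//.
  - by apply: eq_bigl => x; rewrite in_setT.
  - exact: uniq_box_points.
  - move=> x _ xN; rewrite hM ?mulr0n//; apply: contra xN; apply: sub_box_points; lia.
by split; rewrite xiE summxE /trunc_xi1 /trunc_xi2 /trunc_sum; apply: eq_bigr => x _;
  rewrite mulmxnE mulrn_nat (minn_idPl (le_nu x)).
Qed.

Lemma bounded_xiP nu : bounded_xi nu <-> finitely_supported nu.
Proof.
split; first exact: bounded_xi_finitely_supported.
move=> /finitely_supported_stable[N0 h]; exists (xi nu 0%R 0%R + xi nu 0%R 1%R)%N => N.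
have [h1 h2] := h (maxn N0 N) (leq_maxl _ _).
by rewrite -h1 -h2; apply: leq_add; apply: trunc_sum_mono; exact: leq_maxr.
Qed.

Lemma bounded_xi_stable nu : bounded_xi nu -> exists N0, forall N, (N0 <= N)%N ->
  trunc_xi1 N nu = xi nu 0 0 /\ trunc_xi2 N nu = xi nu 0 1.
Proof. by move=> /bounded_xi_finitely_supported /finitely_supported_stable. Qed.

(** The support is infinite there, so the sum that defines xi takes its default
    value 0. *)
Lemma not_bounded_xi_xi nu : ~ bounded_xi nu -> xi nu = 0.
Proof.
move=> nb; rewrite /xi fsbig_dflt// => fin; apply: nb; apply/bounded_xiP.
have /finite_seqP[s hs] := fin; have [N hN] := seq_sub_box_points s.
exists N => x xN; apply: contrapT => nx.
have : x \in s.
  have : (setT `&` (fun x : coprime_point => val x *+ nu x) @^-1` [set~ 0]) x.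
    split => //= h.
    have : (cx x + cy x = 0)%N.
      have h0 : (val x *+ nu x) 0 0 = 0%N by rewrite h mxE.
      have h1 : (val x *+ nu x) 0 1 = 0%N by rewrite h mxE.
      move: h0 h1; rewrite !mulmxnE !mulrn_nat /cx /cy.
      move=> /eqP + /eqP; rewrite !muln_eq0.
      by move/eqP/negbTE: nx => -> /= /eqP -> /eqP ->.
    by have := cxy_gt0 x; case: (_ + _)%N.
  by rewrite hs.
by move=> /hN; rewrite (negbTE xN).
Qed.

Lemma measurable_trunc_xi1 N : measurable_fun setT (trunc_xi1 N). Proof. exact:
  measurable_trunc_sum. Qed.
Lemma measurable_trunc_xi2 N : measurable_fun setT (trunc_xi2 N). Proof. exact:
  measurable_trunc_sum. Qed.

Lemma measurable_bounded_xi : measurable bounded_xi.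
Proof.
have -> : bounded_xi = \bigcup_m \bigcap_N [set nu | (trunc_xi1 N nu + trunc_xi2 N nu <= m)%N].
  apply/seteqP; split => nu /=.
    by move=> [m hm]; exists m => // N _; exact: hm.
  by move=> [m _ hm]; exists m => N; exact: hm.
apply: bigcupT_measurable => m; apply: bigcapT_measurable => N.
have := measurable_fun_addn (measurable_trunc_xi1 N) (measurable_trunc_xi2 N).
by move=> /(_ measurableT [set k | (k <= m)%N] I); rewrite setTI.
Qed.

(** xi is the pointwise limit of the truncated sums multiplied by the indicator
    of bounded_xi. *)
Lemma measurable_xi (R : realType) (j : 'I_2) : measurable_fun setT (xi_coord R j).
Proof.
pose S N nu := if j == 0 then trunc_xi1 N nu else trunc_xi2 N nu.
have mS N : measurable_fun setT (S N).
  by rewrite /S; case: (j == 0); [exact: measurable_trunc_xi1|exact: measurable_trunc_xi2].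
pose h N (nu : config_space) : R := (S N nu)%:R * \1_bounded_xi nu.
apply: (@measurable_fun_cvg _ _ R setT h).
  move=> N; apply: measurable_funM.
    exact: (measurable_natr (fun k => k%:R) (mS N)).
  by apply: measurable_indic; exact: measurable_bounded_xi.
move=> nu _; rewrite /h indicE.
have [b|b] := pselect (bounded_xi nu).
  have [N0 hN] := bounded_xi_stable b.
  rewrite mem_set//; apply: cvg_near_cst; near=> N.
  rewrite mulr1 /xi_coord /natvec mxE /S.
  have NN : (N0 <= N)%N by near: N; exact: nbhs_infty_ge.
  have [h1 h2] := hN N NN.
  have [->|jn] := eqVneq j 0; first by rewrite h1.
  rewrite h2; congr ((xi nu 0 _)%:R).
  by case: j {S mS h} jn => [[|[|j]] hj] // _; apply: val_inj.
rewrite memNset// /xi_coord /natvec mxE not_bounded_xi_xi// mxE.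
by under eq_fun do rewrite mulr0; exact: cvg_cst.
Unshelve. all: end_near. Qed.

Lemma measurable_xi_eq (R : realType) (m : 'rV[nat]_2) : measurable [set nu | xi nu = m].
Proof.
have hm (j : 'I_2) : measurable [set nu | xi nu 0 j = m 0 j].
  have := @measurable_xi R j measurableT _ (measurable_set1 (m 0 j)%:R).
  rewrite setTI; congr measurable; apply/seteqP; split => nu /=;
    rewrite /xi_coord /natvec mxE; last by move=> ->.
  by move/eqP; rewrite eqr_nat => /eqP.
have -> : [set nu | xi nu = m] = [set nu | xi nu 0 0 = m 0 0] `&` [set nu | xi nu 0 1 = m 0 1].
  apply/seteqP; split => nu /=; first by move=> ->.
  by move=> [h1 h2]; rewrite -(mkvecK (xi nu)) h1 h2 mkvecK.
exact: measurableI.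
Qed.

(** * Limits of truncated expectations *)

Section moment_bounds.
Variables (R : realType) (T : Type) (x1 x2 : T -> nat) (v : T -> nat -> R).
Variable n : nat.
Hypothesis hv : forall x, is_law (v x) n.+2.

Lemma lmean_le_mom3 x : lmean (v x) n.+2 <= mom3 (v x) n.+2.
Proof.
have [h0 _] := hv x; apply: ler_sum => k _; rewrite ler_wpM2l// -natrX ler_nat.
by case: (nat_of_ord k) => // j; rewrite -{1}[j.+1]expn1 leq_pexp2l.
Qed.

Lemma lvar_le_mom3 x : lvar (v x) n.+2 <= mom3 (v x) n.+2.
Proof.
rewrite (lvarE hv) lerBlDr -[leLHS]addr0; apply: lerD; last exact: sqr_ge0.
have [h0 _] := hv x; apply: ler_sum => k _; rewrite ler_wpM2l// -!natrX ler_nat.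
by case: (nat_of_ord k) => // j; rewrite leq_pexp2l.
Qed.

(** An integer is at most its cube. This crude bound, and the next one, only
    serve to make the limits of the moments finite. *)
Lemma Ex_sum_le (X : seq T) : Ex x1 x2 v n.+2 X (fun a b => (a + b)%:R) <= rho3 x1 x2 v n X.
Proof.
have -> : Ex x1 x2 v n.+2 X (fun a b => (a + b)%:R) = Ex x1 x2 v n.+2 X (lin 1 1).
  by apply: eq_Ex => a b; rewrite /lin !mulr1 natrD.
rewrite Ex_lin//; apply: ler_sum => x _; rewrite /dotx !mulr1 -natrD.
apply: ler_pM => //; [exact: lmean_ge0|exact: lmean_le_mom3|].
by rewrite -natrX ler_nat; case: (_ + _)%N => // j; rewrite -{1}[j.+1]expn1 leq_pexp2l.
Qed.

Lemma Ex_sum_sqr_le (X : seq T) : Ex x1 x2 v n.+2 X (fun a b => (a + b)%:R ^+ 2) <=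
  rho3 x1 x2 v n X + rho3 x1 x2 v n X ^+ 2.
Proof.
have e1 : Ex x1 x2 v n.+2 X (fun a b => (a + b)%:R) = Ex x1 x2 v n.+2 X (lin 1 1).
  by apply: eq_Ex => a b; rewrite /lin !mulr1 natrD.
have -> : Ex x1 x2 v n.+2 X (fun a b => (a
  + b)%:R ^+ 2) = Ex x1 x2 v n.+2 X (fun a b => lin 1 1 a b ^+ 2).
  by apply: eq_Ex => a b; rewrite /lin !mulr1 natrD.
have := Ex_var x1 x2 hv X 1 1; move/eqP; rewrite subr_eq => /eqP ->.
apply: lerD.
  apply: ler_sum => x _; rewrite /dotx !mulr1 -natrD.
  apply: ler_pM; [exact: lvar_ge0|exact: sqr_ge0|exact: lvar_le_mom3|].
  by rewrite -!natrX ler_nat; case: (_ + _)%N => // j; rewrite leq_pexp2l.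
rewrite -e1 lerXn2r ?nnegrE ?Ex_sum_le//.
  by rewrite -(Ex_cst x1 x2 hv X 0); apply: le_Ex.
apply: sumr_ge0 => x _; rewrite mulr_ge0 ?exprn_ge0//.
by have [h0 _] := hv x; apply: sumr_ge0 => k _; rewrite mulr_ge0 ?exprn_ge0.
Qed.
End moment_bounds.

Section limits.
Variables (R : realType) (r : R) (z : 'rV[R]_2) (Q : probability config_space R).
Hypothesis hQ : is_Q r z Q.
Definition Etrunc (N : nat) (F : nat -> nat -> R) : R :=
  Ex cx cy (trunc_coord_law r z N.+1) N.+2 (box_points N) F.
Variable B : R.
Hypothesis hB : forall N, rho3 cx cy (trunc_coord_law r z N.+1) N (box_points N) <= B.

Let law N x : is_law (trunc_coord_law r z N.+1 x) N.+2. Proof. exact: (trunc_coord_law_is_law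
  hQ). Qed.

Lemma integral_trunc N (F : nat -> nat -> R) : (forall a b, 0 <= F a b) ->
  (\int[Q]_nu (F (trunc_xi1 N nu) (trunc_xi2 N nu))%:E = (Etrunc N F)%:E)%E.
Proof. by move=> F0; apply: integral_trunc_sumT => //; exact: uniq_box_points. Qed.

Lemma measurable_trunc (F : nat -> nat -> R) N :
  measurable_fun setT (fun nu => (F (trunc_xi1 N nu) (trunc_xi2 N nu))%:E).
Proof.
apply/measurable_EFinP; apply: measurable_nat_fun2;
  [exact: measurable_trunc_xi1|exact: measurable_trunc_xi2].
Qed.

(** The functions F to which monotone convergence applies along the truncations.
    *)
Definition nonneg_mono (F : nat -> nat -> R) :=
  (forall a b, 0 <= F a b) /\
  (forall a b a' b', (a <= a')%N -> (b <= b')%N -> F a b <= F a' b').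

Lemma nonneg_mono_trunc F nu : nonneg_mono F ->
  {homo (fun N => (F (trunc_xi1 N nu) (trunc_xi2 N nu))%:E) : m n / (m <= n)%N >-> (m <= n)%E}.
Proof. by move=> [_ h] M N MN; rewrite lee_fin; apply: h; exact: trunc_sum_mono. Qed.

(** This limit exists at every configuration, possibly infinite, while the
    truncations of F converge to F at xi only on bounded_xi. *)
Definition lim_trunc (F : nat -> nat -> R) (nu : config_space) : \bar R :=
  limn (fun N => (F (trunc_xi1 N nu) (trunc_xi2 N nu))%:E).

Lemma measurable_lim_trunc F : nonneg_mono F -> measurable_fun setT (lim_trunc F).
Proof.
move=> hF; apply: (emeasurable_fun_cvg (fun N nu => (F (trunc_xi1 N nu) (trunc_xi2 N nu))%:E)).
  by move=> N; exact: measurable_trunc.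
by move=> nu _; apply: ereal_nondecreasing_is_cvgn; exact: nonneg_mono_trunc.
Qed.

Lemma lim_trunc_ge0 F nu : nonneg_mono F -> (0 <= lim_trunc F nu)%E.
Proof.
move=> hF; apply: lime_ge; first by apply: ereal_nondecreasing_is_cvgn;
  exact: nonneg_mono_trunc.
by apply: nearW => N; rewrite lee_fin; exact: hF.1.
Qed.

Lemma cvg_lim_trunc F : nonneg_mono F ->
  (Etrunc N F)%:E @[N --> \oo] --> (\int[Q]_nu lim_trunc F nu)%E.
Proof.
move=> hF.
have h0 N nu : [set: config_space] nu -> (0 <= (F (trunc_xi1 N nu) (trunc_xi2 N nu))%:E)%E.
  by move=> _; rewrite lee_fin; exact: hF.1.
have := @cvg_monotone_convergence _ _ R Q setT measurableT
  (fun N nu => (F (trunc_xi1 N nu) (trunc_xi2 N nu))%:E) (fun N => @measurable_trunc F N)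
  h0 (fun nu _ => nonneg_mono_trunc nu hF).
by under eq_fun do rewrite (integral_trunc _ hF.1).
Qed.

Lemma integral_lim_trunc_le F (C : R) : nonneg_mono F -> (forall N, Etrunc N F <= C) ->
  (\int[Q]_nu lim_trunc F nu <= C%:E)%E.
Proof.
move=> hF hC; have h := cvg_lim_trunc hF.
rewrite -(cvg_lim (@ereal_hausdorff R) h); apply: lime_le.
  by apply/cvg_ex; eexists; exact: h.
by apply: nearW => N; rewrite lee_fin.
Qed.

Lemma integrable_lim_trunc F (C : R) : nonneg_mono F -> (forall N, Etrunc N F <= C) ->
  Q.-integrable setT (lim_trunc F).
Proof.
move=> hF hC; apply/integrableP; split; first exact: measurable_lim_trunc.
under eq_integral do rewrite gee0_abs ?lim_trunc_ge0//.
by apply: le_lt_trans (integral_lim_trunc_le hF hC) _; rewrite ltry.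
Qed.

Lemma nonneg_mono_sum : nonneg_mono (fun a b => (a + b)%:R).
Proof. by split => // a b a' b' h1 h2; rewrite ler_nat leq_add. Qed.

(** By monotone convergence the limit of the truncated sums has a finite
    integral, hence is finite almost surely. *)
Lemma ae_bounded_xi : {ae Q, forall nu, bounded_xi nu}.
Proof.
have hC N : Etrunc N (fun a b => (a + b)%:R) <= B.
  by apply: le_trans (hB N); apply: Ex_sum_le; exact: law.
have := integrable_ae measurableT (integrable_lim_trunc nonneg_mono_sum hC).
apply: filterS => nu /(_ I) fi.
have hle N : ((trunc_xi1 N nu + trunc_xi2 N nu)%:R%:E <=
  lim_trunc (fun a b => (a + b)%:R) nu)%E.
  rewrite /lim_trunc (cvg_lim (@ereal_hausdorff R) (ereal_nondecreasing_cvgn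
    (nonneg_mono_trunc nu nonneg_mono_sum))).
  by apply: ereal_sup_ubound; exists N.
exists (Num.trunc (fine (lim_trunc (fun a b => (a + b)%:R) nu))).+1 => N.
have := hle N; rewrite -(fineK fi) lee_fin => h.
rewrite -(ler_nat R); apply: (le_trans h); apply: ltW.
have l0 : 0 <= fine (lim_trunc (fun a b => (a + b)%:R) nu) by apply: le_trans h.
by have /andP[] := truncn_itv l0.
Qed.

Definition xi1 (nu : config_space) : nat := xi nu 0%R 0%R.
Definition xi2 (nu : config_space) : nat := xi nu 0%R 1%R.

Lemma measurable_fun_xi (F : R -> R -> R) :
  measurable_fun setT (fun p : R * R => F p.1 p.2) ->
  measurable_fun setT (fun nu => F (xi1 nu)%:R (xi2 nu)%:R).
Proof.
move=> mF.
have m1 : measurable_fun setT (fun nu => (xi1 nu)%:R : R).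
  have := @measurable_xi R 0; congr measurable_fun.
  by apply/funext => nu; rewrite /xi_coord /natvec mxE.
have m2 : measurable_fun setT (fun nu => (xi2 nu)%:R : R).
  have := @measurable_xi R 1; congr measurable_fun.
  by apply/funext => nu; rewrite /xi_coord /natvec mxE.
exact: (measurableT_comp mF (measurable_fun_pair m1 m2)).
Qed.

(** Monotone convergence; almost surely the truncated sums are eventually equal
    to xi. *)
Lemma cvg_Etrunc (F : nat -> nat -> R) (C : R) : nonneg_mono F -> (forall N, Etrunc N F <= C) ->
  measurable_fun setT (fun nu => F (xi1 nu) (xi2 nu)) ->
  Q.-integrable setT (fun nu => (F (xi1 nu) (xi2 nu))%:E) /\
  Etrunc N F @[N --> \oo] --> fine (\int[Q]_nu (F (xi1 nu) (xi2 nu))%:E).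
Proof.
move=> hF hC mF.
have mF' : measurable_fun setT (fun nu => (F (xi1 nu) (xi2 nu))%:E) by exact/measurable_EFinP.
have ae : ae_eq Q setT (lim_trunc F) (fun nu => (F (xi1 nu) (xi2 nu))%:E).
  have := ae_bounded_xi; apply: filterS => nu b _.
  have [N0 hN] := bounded_xi_stable b; rewrite /lim_trunc.
  apply: (cvg_lim (@ereal_hausdorff R)); apply: cvg_near_cst; near=> N.
  have NN : (N0 <= N)%N by near: N; exact: nbhs_infty_ge.
  by have [-> ->] := hN N NN.
have eI : (\int[Q]_nu lim_trunc F nu = \int[Q]_nu (F (xi1 nu) (xi2 nu))%:E)%E.
  by apply: ae_eq_integral => //; exact: measurable_lim_trunc.
have I0 : (0 <= \int[Q]_nu (F (xi1 nu) (xi2 nu))%:E)%E.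
  by apply: integral_ge0 => nu _; rewrite lee_fin; exact: hF.1.
have fi : (\int[Q]_nu (F (xi1 nu) (xi2 nu))%:E)%E \is a fin_num.
  rewrite ge0_fin_numE// -eI.
  by apply: le_lt_trans (integral_lim_trunc_le hF hC) _; rewrite ltry.
split.
  apply/integrableP; split => //.
  under eq_integral do rewrite gee0_abs ?lee_fin ?(hF.1)//.
  by rewrite -ge0_fin_numE.
have h := cvg_lim_trunc hF; rewrite eI -(fineK fi) in h.
exact: (fine_cvg h).
Unshelve. all: end_near. Qed.

(** Indicators of points are not monotone along the truncations, so dominated
    convergence is used, with the constant 1 as majorant. *)
Lemma cvg_Etrunc_ind (m : 'rV[nat]_2) :
  Etrunc N (fun a b => ((a == m 0 0) && (b == m 0 1))%:R) @[N --> \oo] -->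
  fine (Q [set nu | xi nu = m]).
Proof.
pose G (a b : nat) : R := ((a == m 0 0) && (b == m 0 1))%:R.
have mE := measurable_xi_eq R m.
have [] := @dominated_convergence _ _ R Q setT measurableT
  (fun N nu => (G (trunc_xi1 N nu) (trunc_xi2 N nu))%:E) (fun nu => (\1_[set nu | xi nu =
    m] nu)%:E) (cst 1%E).
- by move=> N; exact: measurable_trunc.
- by apply/measurable_EFinP; apply: measurable_indic.
- have := ae_bounded_xi; apply: filterS => nu b _.
  have [N0 hN] := bounded_xi_stable b.
  apply: cvg_near_cst; near=> N.
  have NN : (N0 <= N)%N by near: N; exact: nbhs_infty_ge.
  have [-> ->] := hN N NN.
  rewrite /G indicE; congr ((nat_of_bool _)%:R)%:E; apply/idP/idP.
    by move=> /andP[/eqP h1 /eqP h2]; rewrite inE/= -(mkvecK (xi nu)) h1 h2 mkvecK.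
  by rewrite inE/= => ->; rewrite !eqxx.
- exact: finite_measure_integrable_cst.
- apply: aeW => nu N _ /=; rewrite lee_fin /G ger0_norm//.
  by case: (_ && _).
move=> _ _; rewrite integral_indic// setIT => h.
have {}h : (Etrunc N G)%:E @[N --> \oo] --> Q [set nu | xi nu = m].
  by move: h; under eq_fun do rewrite integral_trunc//.
apply: (@fine_cvg _ _ _ _ (fun N => (Etrunc N G)%:E)).
by rewrite fineK//; exact: fin_num_measure.
Unshelve. all: end_near. Qed.

End limits.

(** * The normal density in coordinates *)

Lemma ord2P (i : 'I_2) : i = 0 \/ i = 1.
Proof.
by case: i => [[|[|i]] hi] //; [left|right]; exact: val_inj.
Qed.

Section mx2.
Variable R : realType.
Implicit Types (a b c d : R) (M : 'M[R]_2).

Lemma sum_ord2 (V : nmodType) (F : 'I_2 -> V) : \sum_(j < 2) F j = F 0 + F 1.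
Proof.
by rewrite !big_ord_recl big_ord0 addr0; congr (_ + F _); exact: val_inj.
Qed.

Definition symmx2 a b d : 'M[R]_2 :=
  \matrix_(i, j) (if i == j then (if i == 0 then a else d) else b).

Lemma symmx2_eqP M a b d : M 0 0 = a -> M 0 1 = b -> M 1 0 = b -> M 1 1 = d -> M = symmx2 a b d.
Proof.
by move=> h1 h2 h3 h4; apply/matrixP => i j; rewrite mxE;
  case: (ord2P i) => ->; case: (ord2P j) => ->.
Qed.

Lemma symmx2E a b d : (symmx2 a b d 0 0 = a) * (symmx2 a b d 0 1 = b) *
  (symmx2 a b d 1 0 = b) * (symmx2 a b d 1 1 = d).
Proof. by rewrite !mxE. Qed.

Lemma mulsymmx2 a b d a' b' d' : a * b' + b * d' = b * a' + d * b' ->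
  symmx2 a b d *m symmx2 a' b' d' = symmx2 (a * a' + b * b') (a * b' + b * d') (b * b'
    + d * d').
Proof.
by move=> h; apply: symmx2_eqP; rewrite mxE sum_ord2 !symmx2E.
Qed.

Lemma det_symmx2 a b d : \det (symmx2 a b d) = a * d - b ^+ 2.
Proof.
rewrite (expand_det_row _ 0) sum_ord2 !symmx2E /cofactor !det_mx11 !mxE /=.
by rewrite expr0 expr1; ring.
Qed.

Lemma trsymmx2 a b d : (symmx2 a b d)^T = symmx2 a b d.
Proof. by apply: symmx2_eqP; rewrite mxE symmx2E. Qed.

Lemma symmx2_1 : symmx2 1 0 1 = 1%:M.
Proof. by apply: esym; apply: symmx2_eqP; rewrite mxE. Qed.

Lemma quad_symmx2 a b d (u : 'rV[R]_2) :
  (u *m symmx2 a b d *m u^T) 0 0 = qform a b d (u 0 0) (u 0 1).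
Proof.
by rewrite mxE sum_ord2 !mxE !sum_ord2 !symmx2E /qform; ring.
Qed.

Lemma invmx_symmx2 a b d : a * d - b ^+ 2 != 0 ->
  invmx (symmx2 a b d) = symmx2 (d / (a * d - b ^+ 2)) (- b / (a * d - b ^+ 2)) (a / (a
    * d - b ^+ 2)).
Proof.
move=> D0; set D := a * d - b ^+ 2 in D0 *.
have h : symmx2 a b d *m symmx2 (d / D) (- b / D) (a / D) = 1%:M.
  rewrite mulsymmx2; last by field.
  by rewrite -symmx2_1; congr symmx2; rewrite /D; field.
have u : symmx2 a b d \in unitmx by rewrite unitmxE det_symmx2 unitfE.
by rewrite -[RHS]mul1mx -(mulVmx u) -mulmxA h mulmx1.
Qed.

Lemma qform_gt0 a b d x y : 0 < a -> 0 < a * d - b ^+ 2 -> (x != 0) || (y != 0) ->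
  0 < qform a b d x y.
Proof.
move=> a0 D0 xy.
rewrite -(pmulr_rgt0 _ a0).
have -> : a * qform a b d x y = (a * x + b * y) ^+ 2 + (a * d - b ^+ 2) * y ^+ 2.
  by rewrite /qform; ring.
have [y0|y0] := eqVneq y 0.
  rewrite y0 eqxx orbF in xy; rewrite y0 mulr0 addr0 expr0n/= mulr0 addr0.
  by rewrite exprn_even_gt0//= mulf_neq0// gt_eqF.
by rewrite ltr_wpDl ?sqr_ge0// mulr_gt0// exprn_even_gt0.
Qed.

(** By the Cayley-Hamilton identity, (M + s I) / t is a square root of M when
    s^2 = det M and t^2 = tr M + 2 s. *)
Lemma sqrt_symmx2 a b d : 0 < a -> 0 < d -> 0 < a * d - b ^+ 2 ->
  exists V : 'M[R]_2, sym_posdef V /\ V *m V = symmx2 a b d.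
Proof.
move=> a0 d0 D0; set s := Num.sqrt (a * d - b ^+ 2).
have s0 : 0 < s by rewrite sqrtr_gt0.
have ss : s ^+ 2 = a * d - b ^+ 2 by rewrite sqr_sqrtr// ltW.
have t0' : 0 < a + d + 2 * s by lra.
set t := Num.sqrt (a + d + 2 * s).
have t0 : 0 < t by rewrite sqrtr_gt0.
have tt : t ^+ 2 = a + d + 2 * s by rewrite sqr_sqrtr// ltW.
have tn : t != 0 by rewrite gt_eqF.
exists (symmx2 ((a + s) / t) (b / t) ((d + s) / t)); split.
  split; first exact: trsymmx2.
  move=> u u0; rewrite quad_symmx2; apply: qform_gt0.
  - by rewrite divr_gt0//; lra.
  - have -> : (a + s) / t * ((d + s) / t) - (b / t) ^+ 2 = ((a + s) * (d
    + s) - b ^+ 2) / t ^+ 2 by field.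
    by rewrite divr_gt0 ?exprn_gt0//; nra.
  - apply: contraNT u0; rewrite negb_or !negbK => /andP[/eqP h1 /eqP h2].
    apply/eqP/rowP => j; rewrite [RHS]mxE.
    by case: (ord2P j) => ->.
rewrite mulsymmx2; last by field.
congr symmx2.
- have -> : (a + s) / t * ((a + s) / t) + b / t * (b / t) = ((a + s) ^+ 2
  + b ^+ 2) / t ^+ 2 by field.
  rewrite tt; apply: (mulIf (lt0r_neq0 t0')); rewrite divfK ?gt_eqF//.
  have -> : b ^+ 2 = a * d - s ^+ 2 by rewrite ss; ring.
  ring.
- have -> : (a + s) / t * (b / t) + b / t * ((d + s) / t) = b * (a + d + 2 * s) / t ^+ 2
  by field.
  by rewrite tt mulfK ?gt_eqF.
- have -> : b / t * (b / t) + (d + s) / t * ((d + s) / t) = ((d + s) ^+ 2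
  + b ^+ 2) / t ^+ 2 by field.
  rewrite tt; apply: (mulIf (lt0r_neq0 t0')); rewrite divfK ?gt_eqF//.
  have -> : b ^+ 2 = a * d - s ^+ 2 by rewrite ss; ring.
  ring.
Qed.

(** The density depends on the square root V of the inverse matrix only through
    V V^T, so the existence of a symmetric root is enough. *)
Lemma normal_density_gauss2 (mn : 'rV[R]_2) (K : 'M[R]_2) (x : 'rV[R]_2) a b d :
  K = symmx2 a b d -> 0 < a -> 0 < a * d - b ^+ 2 ->
  normal_density mn K x = gauss2 a b d (x 0 0 - mn 0 0) (x 0 1 - mn 0 1).
Proof.
move=> -> a0 D0; rewrite /normal_density /gauss2.
have d0 : 0 < d.
  have : 0 < a * d by have := sqr_ge0 b; lra.
  by rewrite pmulr_rgt0.
rewrite det_symmx2 powRN (_ : 1 / 2 = 2^-1) ?powR12_sqrt ?ltW//; last by rewrite mul1r.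
congr (_ * expR (- (_ / 2))).
rewrite invmx_symmx2 ?gt_eqF//; set D := a * d - b ^+ 2 in D0 *.
have Dn : D != 0 by rewrite gt_eqF.
have [] := @sqrt_symmx2 (d / D) (- b / D) (a / D).
- by rewrite divr_gt0.
- by rewrite divr_gt0.
- have -> : d / D * (a / D) - (- b / D) ^+ 2 = D^-1 by rewrite /D; field.
  by rewrite invr_gt0.
move=> V0 hV0.
have [[Vs _] VV] := @xgetPex _ 0 [set V | sym_posdef V /\ V *m V =
  symmx2 (d / D) (- b / D) (a / D)]
   (ex_intro _ V0 hV0).
rewrite /sqrtmx; set V := xget _ _ in Vs VV *.
set y := x - mn.
have -> : enorm (y *m V) ^+ 2 = (y *m V *m V^T *m y^T) 0 0.
  rewrite /enorm sqr_sqrtr; last by apply: sumr_ge0 => j _; exact: sqr_ge0.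
  rewrite -mulmxA -trmx_mul mxE; apply: eq_bigr => j _.
  by rewrite [(y *m V)^T _ _]mxE expr2.
rewrite Vs -(mulmxA y) VV quad_symmx2 /y !mxE /qform.
by field.
Qed.

End mx2.

(** * Size of the parameters *)

Section kappa.
Variable R : realType.

Lemma powR_le (e x y : R) : 0 <= e -> 0 <= x -> x <= y -> x `^ e <= y `^ e.
Proof.
by move=> e0 x0 xy; apply: ge0_ler_powR; rewrite ?nnegrE//; exact: le_trans xy.
Qed.

(** A telescoping majorant bounds the partial sums; once the series converges,
    its limit is at least the first term. *)
Lemma zeta_gt0 (s : R) : 2 <= s -> 0 < zeta s.
Proof.
move=> s2.
pose u (k : nat) : R := k.+1%:R `^ (- s).
have u0 k : 0 <= u k by exact: powR_ge0.
have nd : {homo series u : n m / (n <= m)%N >-> n <= m}.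
  by apply/nondecreasing_seqP => n; rewrite /series/= big_nat_recr//= lerDl.
have ub n : series u n.+1 <= 2 - n.+1%:R^-1.
  elim: n => [|n IH]; first by rewrite /series/= big_nat1 /u powR1 invr1; lra.
  have -> : series u n.+2 = series u n.+1 + u n.+1 by rewrite /series/= big_nat_recr.
  have hu : u n.+1 <= (n.+2%:R ^+ 2)^-1.
    rewrite /u -[n.+2%:R ^+ 2]powR_mulrn// -powRN ler_powR//.
      by rewrite ler1n.
    by lra.
  have t1 : 1 <= n.+1%:R :> R by rewrite ler1n.
  have e2 : n.+2%:R = n.+1%:R + 1 :> R by rewrite natr1.
  rewrite e2 in hu *; set t : R := n.+1%:R in hu IH t1 *.
  have h : ((t + 1) ^+ 2)^-1 <= t^-1 - (t + 1)^-1.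
    have -> : t^-1 - (t + 1)^-1 = (t * (t + 1))^-1 by field; apply/andP; split; lra.
    rewrite lef_pV2 ?posrE; first by nra.
      by rewrite exprn_gt0//; lra.
    by rewrite mulr_gt0//; lra.
  by apply: (le_trans (lerD IH (le_trans hu h))); rewrite addrA subrK.
have cu : cvgn (series u).
  apply: nondecreasing_is_cvgn => //; exists 2 => _ [n _ <-].
  by apply: (le_trans (nd _ _ (leqnSn n))); apply: (le_trans (ub n)); rewrite gerBl invr_ge0.
have := nondecreasing_cvgn_le nd cu 1%N.
rewrite /series/= big_nat1 {1}/u powR1 => h.
by rewrite /zeta (lt_le_trans ltr01).
Qed.

Lemma kappa_gt0 : 0 < kappa R.
Proof. by rewrite /kappa powR_gt0// divr_gt0// zeta_gt0//; lra. Qed.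

Lemma enorm_le (n : 'rV[nat]_2) : enorm (natvec R n) <= (n 0 0)%:R + (n 0 1)%:R.
Proof.
rewrite /enorm sum_ord2 !mxE -ler_sqr ?nnegrE ?sqrtr_ge0 ?addr_ge0//.
rewrite sqr_sqrtr ?addr_ge0 ?sqr_ge0// sqrrD.
have := mulr_ge0 (ler0n R (n 0 0)) (ler0n R (n 0 1)); lra.
Qed.

(** For x the cube root of n_1, the products alpha_j x depend only on the
    bounded ratio n_1 / n_2, and L is the integer just above x. The bound N on
    the n_j makes x >= 96. *)
Lemma alpha_scaling (r c1 c2 : R) : 0 < r -> 0 < c1 -> c1 <= c2 ->
  exists c C K : R, exists N : nat, [/\ 0 < c, 0 < C, 0 <= K &
   forall n : 'rV[nat]_2, (forall j : 'I_2, (N <= n 0%R j)%N) ->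
    c1 <= (n 0 0)%:R / (n 0 1)%:R <= c2 ->
    exists L : nat, [/\ (96 <= L)%N,
      forall j, c / L%:R <= alpha r n j <= C / L%:R &
      (L%:R ^+ 5)^-1 <= K * enorm (natvec R n) `^ (- (5 / 3))]].
Proof.
move=> r0 c10 c12; have c20 : 0 < c2 by apply: lt_le_trans c12.
pose k := kappa R * r `^ (1 / 3).
have k0 : 0 < k by rewrite mulr_gt0 ?kappa_gt0 ?powR_gt0.
pose p1 := c1 `^ (1 / 3); pose p2 := c2 `^ (1 / 3).
have p10 : 0 < p1 by exact: powR_gt0. have p20 : 0 < p2 by exact: powR_gt0.
pose c := Num.min (k / p2) (k * p1 ^+ 2).
pose C := Num.max (k / p1) (k * p2 ^+ 2).
have c0 : 0 < c by rewrite lt_min divr_gt0// mulr_gt0// exprn_gt0.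
have C0 : 0 < C by rewrite lt_max divr_gt0.
have E0 : 0 < 1 + c1^-1 by have : 0 < c1^-1; [rewrite invr_gt0|lra].
have [N hN] : exists N : nat, (96 : R) ^+ 3 + 1 <= N%:R.
  exists (Num.trunc ((96 : R) ^+ 3 + 1)).+1.
  have q0 : 0 <= (96 : R) ^+ 3 + 1 by rewrite addr_ge0 ?exprn_ge0.
  by apply: ltW; have /andP[] := truncn_itv q0.
exists c, (2 * C), ((1 + c1^-1) `^ (5 / 3)), N; split => //; first by rewrite mulr_gt0.
  exact: powR_ge0.
move=> n nN /andP[r1 r2].
set a : R := (n 0 0)%:R in r1 r2; set b : R := (n 0 1)%:R in r1 r2.
have aN : (96 : R) ^+ 3 + 1 <= a by apply: (le_trans hN); rewrite ler_nat.
have bN : (96 : R) ^+ 3 + 1 <= b by apply: (le_trans hN); rewrite ler_nat.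
have q96 : 0 <= (96 : R) ^+ 3 by rewrite exprn_ge0.
have a0 : 0 < a by lra. have b0 : 0 < b by lra.
pose x := a `^ (1 / 3).
have x0 : 0 < x by exact: powR_gt0.
have x3 : x ^+ 3 = a by rewrite -powR_mulrn ?ltW// -powRrM divfK// powRr1 ?ltW.
have x96 : 96 <= x.
  by rewrite -(@ler_pXn2r _ 3) ?nnegrE ?ltW// x3; lra.
have xx : 0 <= x by exact: ltW.
set L := (Num.trunc x).+1.
have /andP[L1 L2] := truncn_itv xx.
have LE : L%:R = (Num.trunc x)%:R + 1 :> R by rewrite natr1.
have xL : x <= L%:R by exact: ltW.
have Lx : L%:R <= 2 * x by lra.
have L0 : 0 < L%:R :> R by rewrite ltr0n.
exists L; split.
- by rewrite -(ler_nat R); exact: le_trans xL.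
- pose p := (a / b) `^ (1 / 3).
  have ab0 : 0 < a / b by rewrite divr_gt0.
  have p0 : 0 < p by exact: powR_gt0.
  have pp1 : p1 <= p by apply: powR_le => //; exact: ltW.
  have pp2 : p <= p2 by apply: powR_le => //; exact: ltW.
  have hba : (b / a) `^ (1 / 3) = p^-1.
    apply: (mulIf (lt0r_neq0 p0)); rewrite mulVf ?gt_eqF// /p -powRM ?ltW//.
      by rewrite mulrA divfK ?gt_eqF// divff ?gt_eqF// powR1.
    by rewrite divr_gt0.
  have hb : b `^ (- (1 / 3)) = p / x.
    rewrite powRN; have -> : x = p * b `^ (1 / 3).
      by rewrite /p /x -powRM ?ltW// divfK ?gt_eqF.
    rewrite invfM mulrA divff ?mul1r ?gt_eqF//.
  have key y : c <= y <= C -> c / L%:R <= y / x <= 2 * C / L%:R.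
    move=> /andP[y1 y2]; apply/andP; split.
      by apply: ler_pM => //; [exact: ltW|rewrite lef_pV2 ?posrE].
    have y0 : 0 <= y by apply: le_trans y1; exact: ltW.
    rewrite ler_pdivlMr// mulrAC ler_pdivrMr//.
    have := ler_pM y0 (ltW L0) y2 Lx; lra.
  move=> j; have [->|->] := ord2P j.
    have -> : alpha r n 0 = k / p / x.
      rewrite /alpha /delta (_ : rev_ord 0 = 1); last exact: val_inj.
      by rewrite -/a -/b hba powRN -/x -/k.
    apply: key; rewrite ge_min le_max; apply/andP; split; apply/orP; left.
      by apply: ler_wpM2l; [exact: ltW|rewrite lef_pV2 ?posrE].
    by apply: ler_wpM2l; [exact: ltW|rewrite lef_pV2 ?posrE].
  have -> : alpha r n 1 = k * p ^+ 2 / x.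
    rewrite /alpha /delta (_ : rev_ord 1 = 0); last exact: val_inj.
    by rewrite -/a -/b hb -/p -/k; ring.
  apply: key; rewrite ge_min le_max; apply/andP; split; apply/orP; right.
    by apply: ler_wpM2l; [exact: ltW|apply: lerXn2r; rewrite ?nnegrE//; exact: ltW].
  by apply: ler_wpM2l; [exact: ltW|apply: lerXn2r; rewrite ?nnegrE//; exact: ltW].
set e := enorm (natvec R n).
have e0 : 0 < e.
  rewrite /e /enorm sqrtr_gt0 sum_ord2 !mxE; apply: ltr_pwDl; last exact: sqr_ge0.
  by rewrite exprn_gt0.
have he : e <= (1 + c1^-1) * a.
  apply: (le_trans (enorm_le n)); rewrite -/a -/b mulrDl mul1r lerD2l.
  by rewrite mulrC ler_pdivlMr// mulrC -ler_pdivlMr.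
have x5 : x ^+ 5 = a `^ (5 / 3).
  rewrite -powR_mulrn ?ltW// -powRrM; congr (_ `^ _); lra.
apply: (@le_trans _ _ (a `^ (5 / 3))^-1).
  rewrite lef_pV2 ?posrE ?powR_gt0 ?exprn_gt0// -x5 lerXn2r ?nnegrE//.
rewrite powRN ler_pdivlMr ?powR_gt0// mulrC ler_pdivrMr ?powR_gt0//.
rewrite -powRM; [|exact: ltW|exact: ltW].
by apply: powR_le => //; exact: ltW.
Qed.
End kappa.

(** * Uniform estimates for the truncated sums *)

Section assembly.
Variables (R : realType) (r : R) (n : 'rV[nat]_2) (Q : probability config_space R).
Variables (L : nat) (c C : R).
Hypotheses (r0 : 0 < r) (c0 : 0 < c) (C0 : 0 < C) (L96 : (96 <= L)%N).
Hypothesis hal : forall j, c / L%:R <= alpha r n j <= C / L%:R.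
Local Notation z := (zparam r n).
Hypothesis hQ : is_Q r z Q.

Let L0 : 0 < L%:R :> R. Proof. by rewrite ltr0n; lia. Qed.
Let L1 : 1 <= L%:R :> R. Proof. by rewrite ler1n; lia. Qed.

Let zf (a b : nat) : R := expR (- (alpha r n 0 * a%:R + alpha r n 1 * b%:R)).

Lemma zpow_zparam (x : coprime_point) : zpow z (val x) = zf (cx x) (cy x).
Proof.
have prod2 (F : 'I_2 -> R) : \prod_(j < 2) F j = F 0 * F 1.
  by rewrite !big_ord_recl big_ord0 mulr1; congr (_ * F _); exact: val_inj.
have e j : z 0 j ^+ val x 0 j = expR (- (alpha r n j * (val x 0 j)%:R)).
  by rewrite mxE -expRM_natl mulrC mulNr.
by rewrite /zpow prod2 !e -expRD -opprD.
Qed.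

Let al_gt0 j : 0 < alpha r n j.
Proof. by have /andP[h _] := hal j; apply: lt_le_trans h; rewrite divr_gt0. Qed.

Lemma zf_itv a b : (0 < a + b)%N -> 0 < zf a b < 1.
Proof.
move=> ab; rewrite expR_gt0/= expR_lt1 oppr_lt0.
have a0 := al_gt0 0; have b0 := al_gt0 1.
case: a ab => [|a] ab; last by apply: ltr_pwDl;
  [rewrite mulr_gt0 ?ltr0n|rewrite mulr_ge0// ltW].
by case: b ab => [|b] // _; rewrite mulr0 add0r mulr_gt0.
Qed.

(** By negbin_mom3_le the third moment of nu(x) is of order z^x / (1 - z^x)^3,
    and thermal_sum_le sums these. *)
Lemma rho3_le N : rho3 cx cy (trunc_coord_law r z N.+1) N (box_points N) <=
  rho3_const r c * L%:R ^+ 5.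
Proof.
have h x : mom3 (trunc_coord_law r z N.+1 x) N.+2 <=
  mom3_ratio r * (zf (cx x) (cy x) / (1 - zf (cx x) (cy x)) ^+ 3).
  have z01 := zf_itv (cxy_gt0 x); have [z0 z1] := andP z01.
  apply: mom3_trunc_law; [exact: (coord_weight_ge0 hQ)|exact: (sum_coord_weight_cvg hQ)|].
  move=> K; rewrite /coord_weight zpow_zparam; apply: (le_trans (negbin_mom3_le K r0 z01)).
  rewrite -[leRHS]mulr1; apply: ler_pM => //.
  - rewrite mulr_ge0 ?mom3_ratio_ge0// divr_ge0 ?exprn_ge0 ?subr_ge0//; exact: ltW.
  - by apply: sumr_ge0 => k _; apply: negbin_ge0 => //; exact: ltW.
  - by have := sum_coord_weight_le1 hQ x K; rewrite /coord_weight zpow_zparam.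
apply: (@le_trans _ _ (\sum_(x <- box_points N) mom3_ratio r
  * (zf (cx x) (cy x) / (1 - zf (cx x) (cy x)) ^+ 3)
   * (cx x + cy x)%:R ^+ 3)).
  by apply: ler_sum => x _; rewrite ler_wpM2r// exprn_ge0.
rewrite (sum_box_points N (fun a b => mom3_ratio r * (zf a b / (1 - zf a b) ^+ 3) * (a
  + b)%:R ^+ 3)).
have /andP[h1 _] := hal 0; have /andP[h2 _] := hal 1.
exact: (@thermal_sum_le R r c L%:R (alpha r n 0) (alpha r n 1) zf N (fun _ _ => erefl) r0 c0
  L1 h1 h2).
Qed.

Let p288 : 0 < 288 :> R. Proof. by rewrite ltr0n. Qed.
Let p384 : 0 < 384 :> R. Proof. by rewrite ltr0n. Qed.
Let c288 : 0 < c / 288 := divr_gt0 c0 p288.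

(** A lower bound for P(nu(x) = 0) P(nu(x) = 1) that holds as soon as the scalar
    product of alpha and x lies between c / 288 and 2 C. *)
Definition mass01_lb : R := r * expR (- (2 * C)) * ((1 - expR (- (c / 288))) `^ r) ^+ 2.

Lemma mass01_lb_gt0 : 0 < mass01_lb.
Proof.
apply: mulr_gt0; first by rewrite mulr_gt0 ?expR_gt0.
apply: exprn_gt0; apply: powR_gt0; rewrite subr_gt0.
by rewrite expR_lt1 oppr_lt0; exact: c288.
Qed.

Lemma negbin01 (zz : R) : negbin r zz 0 * negbin r zz 1 = r * zz * ((1 - zz) `^ r) ^+ 2.
Proof.
have g1 : gbinom r 1 = r by rewrite /gbinom big_ord_recl big_ord0 /= addr0 mulr1 divr1.
by rewrite /negbin gbinom0 g1 expr0 expr1; ring.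
Qed.

(** At a good point of [1, L]^2 the scalar product of alpha and x lies in the
    range [c / 288, 2 C] for which mass01_lb is meant. *)
Lemma negbin01_good_ge a b : (0 < a)%N -> (a <= L)%N -> (b <= L)%N -> (L <= 288 * a)%N ->
  mass01_lb <= negbin r (zf a b) 0 * negbin r (zf a b) 1.
Proof.
move=> a0 aL bL La; rewrite negbin01 /mass01_lb.
have /andP[h1 h2] := hal 0; have /andP[h3 h4] := hal 1.
have b0 : 0 <= b%:R :> R by [].
have aR : 0 < a%:R :> R by rewrite ltr0n.
have aL' : a%:R <= L%:R :> R by rewrite ler_nat.
have bL' : b%:R <= L%:R :> R by rewrite ler_nat.
have La' : L%:R <= 288 * a%:R :> R by rewrite -natrM ler_nat.
set s := alpha r n 0 * a%:R + alpha r n 1 * b%:R.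
have cl : 0 < C / L%:R by rewrite divr_gt0.
have s1 : s <= 2 * C.
  have e1 : alpha r n 0 * a%:R <= C / L%:R * L%:R by apply: ler_pM => //; exact: ltW.
  have e2 : alpha r n 1 * b%:R <= C / L%:R * L%:R by apply: ler_pM => //; exact: ltW.
  by rewrite divfK ?gt_eqF// in e1 e2; rewrite /s; lra.
have s2 : c / 288 <= s.
  have e1 : c / L%:R * a%:R <= alpha r n 0 * a%:R by rewrite ler_wpM2r// ltW.
  have e2 : 0 <= alpha r n 1 * b%:R by rewrite mulr_ge0// ltW.
  have e3 : c / 288 <= c / L%:R * a%:R.
    rewrite -[leRHS]mulrA; apply: ler_wpM2l; first exact: ltW.
    have gen (k l a' : R) : 0 < k -> 0 < l -> l <= k * a' -> k^-1 <= l^-1 * a'.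
      move=> k0 l0 h; rewrite [leRHS]mulrC ler_pdivlMr// [leLHS]mulrC ler_pdivrMr//.
      by rewrite [leRHS]mulrC.
    exact: (gen _ _ _ p288 L0 La').
  by rewrite /s; lra.
apply: ler_pM.
- by rewrite mulr_ge0 ?expR_ge0// ltW.
- exact: sqr_ge0.
- by apply: ler_wpM2l; [exact: ltW|rewrite /zf -/s ler_expR lerN2].
- apply: lerXn2r; [exact: powR_ge0|exact: powR_ge0|apply: powR_le; first exact: ltW].
    rewrite subr_ge0 expR_le1 oppr_le0; exact: ltW c288.
  by rewrite lerB// /zf -/s ler_expR lerN2.
Qed.

Lemma trunc_coord_law01 N x : (0 < N)%N ->
  (trunc_coord_law r z N.+1 x 0 =
    negbin r (zf (cx x) (cy x)) 0) * (trunc_coord_law r z N.+1 x 1 =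
      negbin r (zf (cx x) (cy x)) 1).
Proof. by move=> N0; rewrite /trunc_coord_law /trunc_law /coord_weight zpow_zparam /= ltnS
  N0. Qed.

Definition damp_const : R := mass01_lb / (2 * 384 ^+ 3).

Lemma damp_const_gt0 : 0 < damp_const.
Proof. exact: (divr_gt0 mass01_lb_gt0 (mulr_gt0 (ltr0Sn R 1) (exprn_gt0 3 p384))). Qed.

(** Only the good points of [1, L]^2 are kept; L < N makes the box contain this
    square, and each of these points has weight at least mass01_lb. *)
Lemma damp_ge N u1 u2 : (L < N)%N -> `|u1| <= pi -> `|u2| <= pi ->
  damp_const * L%:R ^+ 2 * Num.min 1 (L%:R ^+ 2 * (u1 ^+ 2 + u2 ^+ 2)) <=
  damp cx cy (trunc_coord_law r z N.+1) (box_points N) u1 u2.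
Proof.
move=> LN hu1 hu2; have N0 : (0 < N)%N := leq_ltn_trans (leq0n L) LN.
pose F (a b : nat) := negbin r (zf a b) 0 * negbin r (zf a b) 1 * (1 - cos (a%:R * u1
  + b%:R * u2)).
have nb0 a b k : 0 <= negbin r (zf a b) k by apply: negbin_ge0 => //; exact: expR_ge0.
have F0 a b : 0 <= F a b by apply: mulr_ge0; [apply: mulr_ge0;
  exact: nb0|rewrite subr_ge0 cos_le1].
have -> : damp cx cy (trunc_coord_law r z N.+1) (box_points N) u1 u2 =
   \sum_(a < N) \sum_(b < N) (coprime a b)%:R * F a b.
  rewrite -sum_box_points; apply: eq_bigr => x _.
  by rewrite !trunc_coord_law01.
have shift (G : nat -> R) : (forall a, 0 <= G a) -> \sum_(i < L) G i.+1 <= \sum_(a < N) G a.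
  move=> G0; apply: (le_trans (sum_ord_shift_le 1 L G0)).
  exact: sum_ord_le_widen.
have cF0 a b : 0 <= (coprime a b)%:R * F a b by rewrite mulr_ge0.
apply: (@le_trans _ _ (\sum_(i < L) \sum_(j < L) (coprime i.+1 j.+1)%:R * F i.+1 j.+1));
  last first.
  apply: (le_trans _ (shift (fun a => \sum_(b < N) (coprime a b)%:R * F a b) _)).
    by apply: ler_sum => i _; apply: (shift (fun b => (coprime i.+1 b)%:R * F i.+1 b)).
  by move=> a; apply: sumr_ge0.
have hg := good_point_damp L96 hu1 hu2.
have cv0 := mass01_lb_gt0.
apply: (@le_trans _ _ (mass01_lb * \sum_(i < L) \sum_(j < L) (good_point L i.+1 j.+1)%:R
  * (1 - cos (i.+1%:R * u1 + j.+1%:R * u2)))).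
  have -> : damp_const * L%:R ^+ 2 * Num.min 1 (L%:R ^+ 2 * (u1 ^+ 2 + u2 ^+ 2)) =
    mass01_lb * (L%:R ^+ 2 / (2 * 384 ^+ 3) * Num.min 1 (L%:R ^+ 2 * (u1 ^+ 2 + u2 ^+ 2))).
    have gen (x K l m : R) : x / K * l * m = x * (l / K * m) by ring.
    by rewrite /damp_const gen.
  by rewrite ler_wpM2l// ltW.
rewrite mulr_sumr; apply: ler_sum => i _; rewrite mulr_sumr; apply: ler_sum => j _.
rewrite /good_point; case: (coprime _ _) => /=; last by rewrite !mul0r mulr0.
case: (leqP L (288 * i.+1)) => hL; last by rewrite !mul0r mulr0 mul1r.
rewrite [X in mass01_lb * X]mul1r [leRHS]mul1r; apply: ler_wpM2r; last exact: negbin01_good_ge.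
by rewrite subr_ge0 cos_le1.
Qed.

Let rho3_const_ge0 : 0 <= rho3_const r c.
Proof.
apply: mulr_ge0; last exact: sqr_ge0.
apply: divr_ge0; last by apply: exprn_ge0; exact: ltW.
by apply: mulr_ge0; [exact: mom3_ratio_ge0|exact: ler0n].
Qed.

Let law N x : is_law (trunc_coord_law r z N.+1 x) N.+2. Proof. exact: (trunc_coord_law_is_law
  hQ). Qed.

Local Notation AN N := (covA cx cy (trunc_coord_law r z N.+1) N.+2 (box_points N)).
Local Notation BN N := (covB cx cy (trunc_coord_law r z N.+1) N.+2 (box_points N)).
Local Notation DN N := (covD cx cy (trunc_coord_law r z N.+1) N.+2 (box_points N)).

Lemma Etrunc_local_limit N (m1 m2 : nat) : (L < N)%N ->
  `|Etrunc r z N (fun a b => ((a == m1) && (b == m2))%:R) -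
    gauss2 (AN N) (BN N) (DN N) (m1%:R - Etrunc r z N (fun a b => a%:R)) (m2%:R - Etrunc r z
      N (fun a b => b%:R))|
  <= llt_const damp_const (rho3_const r c) / (2 * pi) ^+ 2 / L%:R ^+ 5.
Proof.
move=> LN.
exact: (@finite_local_limit R _ cx cy (trunc_coord_law r z N.+1) N (box_points N) damp_const
  (rho3_const r c) L%:R (law N) damp_const_gt0 rho3_const_ge0 L1
  (fun u1 u2 => @damp_ge N u1 u2 LN) (rho3_le N) m1 m2).
Qed.

Lemma covA_trunc_ge N : (L < N)%N -> 2 * damp_const * L%:R ^+ 4 <= AN N.
Proof.
move=> LN; exact: (@covA_ge R _ cx cy (trunc_coord_law r z N.+1) N (box_points N) damp_const
  L%:R (law N) L1
  (fun u1 u2 => @damp_ge N u1 u2 LN)).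
Qed.

Lemma det_trunc_ge N : (L < N)%N
  -> (2 * damp_const * L%:R ^+ 4) ^+ 2 <= AN N * DN N - BN N ^+ 2.
Proof.
move=> LN; exact: (@det_ge R _ cx cy (trunc_coord_law r z N.+1) N (box_points N) damp_const
  L%:R (law N) damp_const_gt0 L1
  (fun u1 u2 => @damp_ge N u1 u2 LN)).
Qed.

End assembly.

(** * Passage to the limit *)

Section moment_limits.
Variables (R : realType) (r : R) (z : 'rV[R]_2) (Q : probability config_space R).
Hypothesis hQ : is_Q r z Q.
Variable B : R.
Hypothesis hB : forall N, rho3 cx cy (trunc_coord_law r z N.+1) N (box_points N) <= B.
Local Notation E := (Etrunc r z).

Let law N x : is_law (trunc_coord_law r z N.+1 x) N.+2. Proof. exact: (trunc_coord_law_is_law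
  hQ). Qed.

Definition coordn (j : 'I_2) (a b : nat) : nat := if j == 0 then a else b.

Lemma coordn_xi j nu : xi nu 0 j = coordn j (xi1 nu) (xi2 nu).
Proof. by case: (ord2P j) => ->. Qed.

Lemma xi_coordE j : xi_coord R j = fun nu => (coordn j (xi1 nu) (xi2 nu))%:R.
Proof. by apply/funext => nu; rewrite /xi_coord /natvec mxE coordn_xi. Qed.

Let Etrunc_sum_le N : E N (fun a b => (a + b)%:R) <= B.
Proof. by apply: le_trans (hB N); apply: Ex_sum_le; exact: law. Qed.

Let Etrunc_sqr_le N : E N (fun a b => (a + b)%:R ^+ 2) <= B + B ^+ 2.
Proof.
apply: (le_trans (Ex_sum_sqr_le cx cy (law N) (box_points N))).
have r0 : 0 <= rho3 cx cy (trunc_coord_law r z N.+1) N (box_points N).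
  apply: sumr_ge0 => x _; rewrite mulr_ge0 ?exprn_ge0//.
  by have [h0 _] := law N x; apply: sumr_ge0 => k _; rewrite mulr_ge0 ?exprn_ge0.
apply: lerD => //; apply: lerXn2r => //; rewrite ?nnegrE//.
exact: le_trans (hB N).
Qed.

Let coordn_le j a b : (coordn j a b <= a + b)%N.
Proof. by rewrite /coordn; case: ifP => _; rewrite ?leq_addr ?leq_addl. Qed.

Let coordn_mono j a b a' b' : (a <= a')%N -> (b <= b')%N -> (coordn j a b <= coordn j a' b')%N.
Proof. by rewrite /coordn; case: ifP. Qed.

Let coordR (j : 'I_2) (x y : R) : R := if j == 0 then x else y.

Let measurable_coordR j : measurable_fun setT (fun p : R * R => coordR j p.1 p.2).
Proof. by rewrite /coordR; case: (j == 0); [exact: measurable_fst|exact: measurable_snd]. Qed.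

Let coordnR j a b : (coordn j a b)%:R = coordR j a%:R b%:R.
Proof. by rewrite /coordn /coordR; case: ifP. Qed.

Lemma cvg_Etrunc_coord j :
  Q.-integrable setT (EFin \o xi_coord R j) /\
  E N (fun a b => (coordn j a b)%:R) @[N --> \oo] --> mean_xi Q 0 j.
Proof.
rewrite mxE expectation.unlock xi_coordE.
apply: (@cvg_Etrunc R r z Q hQ B hB (fun a b => (coordn j a b)%:R) B).
- by split => // a b a' b' h1 h2; rewrite ler_nat coordn_mono.
- move=> N; apply: le_trans (Etrunc_sum_le N); apply: le_Ex; first exact: law.
  by move=> a b; rewrite ler_nat.
- have := measurable_fun_xi (measurable_coordR j); congr measurable_fun.
  by apply/funext => nu; rewrite coordnR.
Qed.

Lemma cvg_Etrunc_prod i j :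
  Q.-integrable setT (EFin \o (xi_coord R i * xi_coord R j)) /\
  E N (fun a b => (coordn i a b)%:R * (coordn j a b)%:R) @[N --> \oo] -->
  fine 'E_Q[xi_coord R i * xi_coord R j].
Proof.
rewrite expectation.unlock !xi_coordE.
apply: (@cvg_Etrunc R r z Q hQ B hB (fun a b => (coordn i a b)%:R * (coordn j a b)%:R) (B
  + B ^+ 2)).
- split => [a b|a b a' b' h1 h2]; first by rewrite mulr_ge0.
  by rewrite -!natrM ler_nat leq_mul ?coordn_mono.
- move=> N; apply: le_trans (Etrunc_sqr_le N); apply: le_Ex; first exact: law.
  by move=> a b; rewrite expr2 ler_pM// ler_nat.
- have := @measurable_fun_xi R (fun x y => coordR i x y * coordR j x y)
    (measurable_funM (measurable_coordR i) (measurable_coordR j)).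
  by congr measurable_fun; apply/funext => nu; rewrite !coordnR.
Qed.

Lemma cvg_Etrunc_cov i j :
  E N (fun a b => (coordn i a b)%:R * (coordn j a b)%:R) -
  E N (fun a b => (coordn i a b)%:R) * E N (fun a b => (coordn j a b)%:R)
  @[N --> \oo] --> cov_xi Q i j.
Proof.
have [ii hi] := cvg_Etrunc_coord i; have [ij hj] := cvg_Etrunc_coord j.
have [iij hij] := cvg_Etrunc_prod i j.
have li : xi_coord R i \in Lfun Q 1 by apply/Lfun1_integrable.
have lj : xi_coord R j \in Lfun Q 1 by apply/Lfun1_integrable.
have lij : (xi_coord R i * xi_coord R j) \in Lfun Q 1 by apply/Lfun1_integrable.
have -> : cov_xi Q i j = fine 'E_Q[xi_coord R i * xi_coord R j] -
   mean_xi Q 0 i * mean_xi Q 0 j.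
  rewrite !mxE covarianceE// fineB ?fin_numM ?expectation_fin_num//.
  by rewrite fineM ?expectation_fin_num.
by apply: cvgB => //; exact: cvgM.
Qed.

Lemma cov_xiC i j : cov_xi Q i j = cov_xi Q j i.
Proof. by rewrite !mxE covarianceC. Qed.

End moment_limits.

Section gauss2_limit.
Variable R : realType.

Lemma cvg_gauss2 (A B D x y : nat -> R) (a b d u v : R) : 0 < a * d - b ^+ 2 ->
  A @ \oo --> a -> B @ \oo --> b -> D @ \oo --> d -> x @ \oo --> u -> y @ \oo --> v ->
  gauss2 (A N) (B N) (D N) (x N) (y N) @[N --> \oo] --> gauss2 a b d u v.
Proof.
move=> D0 hA hB hD hx hy; rewrite /gauss2 /qform.
have hdet : A N * D N - B N ^+ 2 @[N --> \oo] --> a * d - b ^+ 2.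
  by apply: cvgB; [exact: cvgM|under eq_fun do rewrite expr2; apply: cvgM].
have hs : Num.sqrt (A N * D N - B N ^+ 2) @[N --> \oo] --> Num.sqrt (a * d - b ^+ 2).
  by apply: continuous_cvg => //; exact: sqrt_continuous.
apply: cvgM.
  apply: cvgM; first exact: cvg_cst.
  by apply: cvgV => //; rewrite gt_eqF// sqrtr_gt0.
apply: continuous_cvg; first exact: continuous_expR.
apply: cvgN; apply: cvgM; last exact: cvg_cst.
apply: cvgM; last by apply: cvgV => //; rewrite gt_eqF.
have hB' : - B N @[N --> \oo] --> - b by exact: cvgN.
have sq (f : nat -> R) (l : R) : f @ \oo --> l -> f N ^+ 2 @[N --> \oo] --> l ^+ 2.
  by move=> h; under eq_fun do rewrite expr2; apply: cvgM.
apply: cvgD; first apply: cvgD.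
- by apply: cvgM => //; exact: sq.
- by do 2 (apply: cvgM => //); apply: cvgM => //; exact: cvg_cst.
- by apply: cvgM => //; exact: sq.
Qed.

End gauss2_limit.

Section local_limit.
Variables (R : realType) (r : R) (n : 'rV[nat]_2) (Q : probability config_space R).
Variables (L : nat) (c C : R).
Hypotheses (r0 : 0 < r) (c0 : 0 < c) (C0 : 0 < C) (L96 : (96 <= L)%N).
Hypothesis hal : forall j, c / L%:R <= alpha r n j <= C / L%:R.
Local Notation z := (zparam r n).
Hypothesis hQ : is_Q r z Q.

Let hB := rho3_le r0 c0 C0 L96 hal hQ.
Let cov i j := @cvg_Etrunc_cov _ _ _ _ hQ _ hB i j.
Let dc := damp_const r c C.

Let hA : covA cx cy (trunc_coord_law r z N.+1) N.+2 (box_points N) @[N --> \oo] -->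
  cov_xi Q 0 0.
Proof. exact: (@cov 0 0). Qed.
Let hBc : covB cx cy (trunc_coord_law r z N.+1) N.+2 (box_points N) @[N --> \oo] -->
  cov_xi Q 0 1.
Proof. exact: (@cov 0 1). Qed.
Let hD : covD cx cy (trunc_coord_law r z N.+1) N.+2 (box_points N) @[N --> \oo] -->
  cov_xi Q 1 1.
Proof. exact: (@cov 1 1). Qed.

Let L0 : 0 < L%:R :> R. Proof. by rewrite ltr0n; exact: leq_trans L96. Qed.

Let s0 : 0 < 2 * dc * L%:R ^+ 4.
Proof. by apply: mulr_gt0; [apply: mulr_gt0 => //; exact: damp_const_gt0|exact: exprn_gt0]. Qed.

Let ge_lim (u : nat -> R) (l b : R) : u @ \oo --> l -> (forall N, (L < N)%N -> b <= u N)
  -> b <= l.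
Proof.
move=> h hb; rewrite -(cvg_lim (@Rhausdorff R) h); apply: limr_ge.
  by apply/cvg_ex; exists l.
by near=> N; apply: hb; near: N; exact: nbhs_infty_gt.
Unshelve. all: end_near. Qed.

Lemma cov_xi00_gt0 : 0 < cov_xi Q 0 0.
Proof.
apply: lt_le_trans s0 _; apply: (ge_lim hA) => N LN.
exact: (covA_trunc_ge r0 c0 C0 L96 hal hQ LN).
Qed.

Lemma det_cov_xi_gt0 : 0 < cov_xi Q 0 0 * cov_xi Q 1 1 - cov_xi Q 0 1 ^+ 2.
Proof.
apply: lt_le_trans (exprn_gt0 2 s0) _.
have h : covA cx cy (trunc_coord_law r z N.+1) N.+2 (box_points N)
  * covD cx cy (trunc_coord_law r z N.+1) N.+2 (box_points N) -
   covB cx cy (trunc_coord_law r z N.+1) N.+2 (box_points N) ^+ 2 @[N --> \oo] -->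
   cov_xi Q 0 0 * cov_xi Q 1 1 - cov_xi Q 0 1 ^+ 2.
  by apply: cvgB; [exact: cvgM|under eq_fun do rewrite expr2; apply: cvgM].
apply: (ge_lim h) => N LN; exact: (det_trunc_ge r0 c0 C0 L96 hal hQ LN).
Qed.

(** The estimate for the truncated sums holds for every N > L with a constant
    that does not depend on N, and the normal density is continuous in its
    parameters because the determinants stay away from 0. *)
Lemma local_limit_bound (m : 'rV[nat]_2) :
  `| fine (Q [set nu | xi nu = m])
     - normal_density (mean_xi Q) (cov_xi Q) (natvec R m) |
  <= llt_const dc (rho3_const r c) / (2 * pi) ^+ 2 / L%:R ^+ 5.
Proof.
rewrite (@normal_density_gauss2 _ _ _ _ (cov_xi Q 0 0) (cov_xi Q 0 1) (cov_xi Q 1 1));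
  last first.
- exact: det_cov_xi_gt0.
- exact: cov_xi00_gt0.
- by apply: symmx2_eqP => //; exact: cov_xiC.
rewrite [natvec R m 0 0]mxE [natvec R m 0 1]mxE.
have [_ m0] := cvg_Etrunc_coord hQ hB 0; have [_ m1] := cvg_Etrunc_coord hQ hB 1.
have h : `|Etrunc r z N (fun a b => ((a == m 0 0) && (b == m 0 1))%:R) -
    gauss2 (covA cx cy (trunc_coord_law r z N.+1) N.+2 (box_points N)) (covB cx cy
      (trunc_coord_law r z N.+1) N.+2 (box_points N))
      (covD cx cy (trunc_coord_law r z N.+1) N.+2 (box_points N))
      ((m 0 0)%:R - Etrunc r z N (fun a b => a%:R)) ((m 0 1)%:R - Etrunc r z N (fun a b =>
        b%:R))|
   @[N --> \oo] -->
  `| fine (Q [set nu | xi nu = m]) -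
     gauss2 (cov_xi Q 0 0) (cov_xi Q 0 1) (cov_xi Q 1 1)
      ((m 0 0)%:R - mean_xi Q 0 0) ((m 0 1)%:R - mean_xi Q 0 1)|.
  apply: cvg_norm; apply: cvgB; first exact: (cvg_Etrunc_ind hQ hB).
  apply: cvg_gauss2 => //; first exact: det_cov_xi_gt0.
    by apply: cvgB => //; exact: cvg_cst.
  by apply: cvgB => //; exact: cvg_cst.
rewrite -lerN2; apply: (ge_lim (cvgN h)) => N LN; rewrite lerN2.
exact: (Etrunc_local_limit r0 c0 C0 L96 hal hQ).
Qed.

End local_limit.

Theorem theorem7p1 (R : realType) (r : R) (hr : 0 < r)
    (c1 c2 : R) (hc1 : 0 < c1) (hc12 : c1 <= c2) :
  exists (C : R) (N : nat), forall n : 'rV[nat]_2,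
    (forall j : 'I_2, (N <= n 0%R j)%N) ->
    c1 <= (n 0 0)%:R / (n 0 1)%:R <= c2 ->
    forall Q : probability config_space R, is_Q r (zparam r n) Q ->
    forall m : 'rV[nat]_2,
      `| fine (Q [set nu | xi nu = m])
         - normal_density (mean_xi Q) (cov_xi Q) (natvec R m) |
      <= C * enorm (natvec R n) `^ (- (5 / 3)).
Proof.
have [c [C [K [N [c0 C0 K0 hN]]]]] := alpha_scaling hr hc1 hc12.
set G := llt_const (damp_const r c C) (rho3_const r c) / (2 * pi) ^+ 2.
exists (`|G| * K), N => n nN rat Q hQ m.
have [L [L96 hal hL]] := hN n nN rat.
apply: (le_trans (local_limit_bound hr c0 C0 L96 hal hQ m)); rewrite -/G.
apply: (@le_trans _ _ (`|G| / L%:R ^+ 5)).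
  by rewrite ler_wpM2r ?ler_norm// invr_ge0 exprn_ge0.
by rewrite -mulrA ler_wpM2l.
Qed.
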